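(* A connected graph $G$ on $10$ vertices satisfies $\gamma^\infty(G)<\theta(G)$ if and only if it is isomorphic to one of the two graphs in the list $L_{10}$, and a connected graph $G$ on $11$ vertices satisfies $\gamma^\infty(G)<\theta(G)$ if and only if it is isomorphic to one of the $54$ graphs in the list $L_{11}$, where $L_{10}$ and $L_{11}$ are the lists of graphs in graph6 format given in the context.
   Context: All graphs are finite and simple. A dominating set of $G$ is a set $D\subseteq V(G)$ such that every vertex of $V(G)\setminus D$ has a neighbour in $D$. Eternal domination game on $G$: a defender chooses a dominating set $D_0\subseteq V(G)$ with $|D_0|=k$ and places one guard on each vertex of $D_0$. At each time $t=1,2,3,\dots$ an attacker selects (attacks) a vertex $v$ carrying no guard, and the defender must respond by moving one guard located on a neighbour of $v$ to $v$ (all other guards stay; at most one guard per vertex). The defender wins if they can respond to every attack forever (equivalently, the guards always occupy a dominating set); otherwise the attacker wins. The eternal domination number $\gamma^\infty(G)$ is the minimum $k$ for which $k$ guards suffice to respond to any sequence of attacks on $G$. The clique covering number $\theta(G)$ is the minimum number of parts in a partition of $V(G)$ into sets each inducing a clique. Graph6 format (for $n\le 62$ vertices $0,\dots,n-1$): the first character has ASCII code $n+63$; each later character with ASCII code $c$ encodes the 6-bit big-endian binary expansion of $c-63$; concatenating these bits gives the upper triangle of the adjacency matrix in the order $(0,1),(0,2),(1,2),(0,3),(1,3),(2,3),\dots,(n-2,n-1)$, padded on the right with zeros. List $L_{10}$ (strings separated by spaces, to be read verbatim): IEhbtj{ro IEhbtn{ro List $L_{11}$ (strings separated by spaces, to be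 read verbatim, except that the character ! , which never occurs in graph6 strings, stands for the backslash character, ASCII code 92; each has 11 characters): JQyurj]yt|? JEhbtj{rvu? JEhbtj{rvx? JEhbtj{rvf? JEhbtj{ruv? JEhbtj{rvT_ JEhbtj{rtt_ JEhbtj{rrt_ JEhbtj{rv}? JEhbtj{rv|? JEhbtj{rvv? JEhbtj{rv^? JEhbtj{rvx_ JEhbtj{rvt_ JEhbtj{rvl_ JEhbtj{rv!_ JEhbtj{rvf_ JEhbtj{rtv_ JEhbtj{rv~? JEhbtj{rv|_ JEhbtj{rvv_ JEhbtj{rv~_ JEhbtnm~E|? JEhbtnm~FZ? JEhbtnm~D]_ JEhbtnm~@}_ JEhbtnN~Fu? JEhbtnN~Bv? JEhbtnN~Fw_ JEhbtnN~Fe_ JEhbtnN~Eu_ JEhbtnN~Bu_ JEhbtnN~Ef_ JEhbtnN~F}? JEhbtnN~Fv? JEhbtnN~F{_ JEhbtnN~Fu_ JEhbtnN~F]_ JEhbtnN~Ff_ JEhbtnN~Ev_ JEhbtnN~Bv_ JEhbtnN~F~? JEhbtnN~F}_ JEhbtnN~Fv_ JEhbtnN~F~_ JEhvUtn~D{_ JEhutz{xr!_ JEhru^u~Fj? JEhru]v~Et_ JEjbtnN~Dm_ JEnfbz!zbv? JCXetqu|uz? JCXetq}vVm? JCXetq}|uz? *)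

(* Defs.v *)
From Stdlib Require Import Ascii String.
From mathcomp Require Import all_boot.
From mathcomp Require Import boolp.

Set Implicit Arguments.
Unset Strict Implicit.
Unset Printing Implicit Defensive.

Record sgraph := SGraph {
  vertex :> finType;
  adj : rel vertex;
  adj_sym : symmetric adj;
  adj_irr : irreflexive adj
}.

Definition connected_graph (G : sgraph) : Prop :=
  forall x y : G, connect (@adj G) x y.

Definition isomorphic (G H : sgraph) : Prop :=
  exists2 f : G -> H, bijective f & forall x y, adj (f x) (f y) = adj x y.

Section EternalDomination.
Variable G : sgraph.

Definition dominating (D : {set G}) : Prop :=
  forall v, v \notin D -> exists2 u, u \in D & adj v u.

(* A strategy maps the attacks made so far, in chronological order, to the set
   of vertices then carrying a guard. *)
Definition strategy := seq G -> {set G}.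

(* The attack histories that can occur against [s]: each attacked vertex is
   unguarded when it is attacked. *)
Inductive played (s : strategy) : seq G -> Prop :=
| played_nil : played s [::]
| played_rcons h v : played s h -> v \notin s h -> played s (rcons h v).

Definition guard_move (D : {set G}) (v : G) (D' : {set G}) : Prop :=
  exists u, [/\ u \in D, adj u v & D' = v |: (D :\ u)].

Definition winning_strategy (s : strategy) : Prop :=
  forall h v, played s h -> v \notin s h -> guard_move (s h) v (s (rcons h v)).

Definition guards_suffice (k : nat) : Prop :=
  exists s : strategy,
    [/\ dominating (s [::]), #|s [::]| = k & winning_strategy s].

Lemma guards_suffice_card : guards_suffice #|G|.
Proof.
exists (fun=> setT); split; first by move=> v; rewrite inE.
  by rewrite cardsT.
by move=> h v _; rewrite inE.
Qed.

Fact exists_guards_suffice : exists k, `[< guards_suffice k >].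
Proof. by exists #|G|; apply/asboolP/guards_suffice_card. Qed.

Definition eternal_domination_number : nat := ex_minn exists_guards_suffice.

Definition clique (A : {set G}) : bool :=
  [forall x in A, forall y in A, (x != y) ==> adj x y].

Definition clique_partition (P : {set {set G}}) : bool :=
  partition P [set: G] && [forall A in P, clique A].

Fact exists_clique_partition :
  exists k, [exists P, clique_partition P && (#|P| == k)].
Proof.
pose P := [set [set x] | x in [set: G]].
exists #|P|; apply/existsP; exists P; rewrite eqxx andbT; apply/andP; split.
  apply/and3P; split.
  - apply/eqP/setP=> x; rewrite inE; apply/bigcupP.
    by exists [set x]; rewrite ?set11 ?imset_f ?inE.
  - apply/trivIsetP=> _ _ /imsetP[x _ ->] /imsetP[y _ ->] neq.
    by rewrite disjoints1 inE; apply: contraNneq neq => ->.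
  - by apply/imsetP=> -[x _ /setP/(_ x)]; rewrite !inE eqxx.
apply/forall_inP=> _ /imsetP[x _ ->]; apply/forall_inP=> y /set1P->.
by apply/forall_inP=> z /set1P->; rewrite eqxx.
Qed.

Definition clique_covering_number : nat := ex_minn exists_clique_partition.

End EternalDomination.

Definition bits6 (m : nat) : bitseq :=
  [seq odd (m %/ 2 ^ i) | i <- [:: 5; 4; 3; 2; 1; 0]].

Definition g6_codes (s : string) : seq nat :=
  [seq nat_of_ascii c - 63 | c <- list_ascii_of_string s].

Definition g6_order (s : string) : nat := head 0 (g6_codes s).

Definition g6_bits (s : string) : bitseq :=
  flatten [seq bits6 m | m <- behead (g6_codes s)].

(* In the order (0,1), (0,2), (1,2), (0,3), the pair (i, j) with i < j is
   preceded by the 'C(j, 2) pairs contained in {0, ..., j - 1} and by i pairs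
   (i', j) with i' < i. *)
Definition g6_adj (s : string) : rel 'I_(g6_order s) :=
  fun x y => (x != y) && nth false (g6_bits s) ('C(maxn x y, 2) + minn x y).

Lemma g6_adj_sym s : symmetric (@g6_adj s).
Proof. by move=> x y; rewrite /g6_adj eq_sym maxnC minnC. Qed.

Lemma g6_adj_irr s : irreflexive (@g6_adj s).
Proof. by move=> x; rewrite /g6_adj eqxx. Qed.

Definition graph6 (s : string) : sgraph := SGraph (@g6_adj_sym s) (@g6_adj_irr s).

Definition L10 : seq string :=
  [:: "IEhbtj{ro"; "IEhbtn{ro"]%string.

Definition L11 : seq string :=
  [:: "JQyurj]yt|?"; "JEhbtj{rvu?"; "JEhbtj{rvx?"; "JEhbtj{rvf?";
      "JEhbtj{ruv?"; "JEhbtj{rvT_"; "JEhbtj{rtt_"; "JEhbtj{rrt_";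
      "JEhbtj{rv}?"; "JEhbtj{rv|?"; "JEhbtj{rvv?"; "JEhbtj{rv^?";
      "JEhbtj{rvx_"; "JEhbtj{rvt_"; "JEhbtj{rvl_"; "JEhbtj{rv\_";
      "JEhbtj{rvf_"; "JEhbtj{rtv_"; "JEhbtj{rv~?"; "JEhbtj{rv|_";
      "JEhbtj{rvv_"; "JEhbtj{rv~_"; "JEhbtnm~E|?"; "JEhbtnm~FZ?";
      "JEhbtnm~D]_"; "JEhbtnm~@}_"; "JEhbtnN~Fu?"; "JEhbtnN~Bv?";
      "JEhbtnN~Fw_"; "JEhbtnN~Fe_"; "JEhbtnN~Eu_"; "JEhbtnN~Bu_";
      "JEhbtnN~Ef_"; "JEhbtnN~F}?"; "JEhbtnN~Fv?"; "JEhbtnN~F{_";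
      "JEhbtnN~Fu_"; "JEhbtnN~F]_"; "JEhbtnN~Ff_"; "JEhbtnN~Ev_";
      "JEhbtnN~Bv_"; "JEhbtnN~F~?"; "JEhbtnN~F}_"; "JEhbtnN~Fv_";
      "JEhbtnN~F~_"; "JEhvUtn~D{_"; "JEhutz{xr\_"; "JEhru^u~Fj?";
      "JEhru]v~Et_"; "JEjbtnN~Dm_"; "JEnfbz\zbv?"; "JCXetqu|uz?";
      "JCXetq}vVm?"; "JCXetq}|uz?"]%string.

Lemma size_L10 : size L10 = 2. Proof. by []. Qed.
Lemma size_L11 : size L11 = 54. Proof. by []. Qed.

(* Main.v *)
Require Import Defs.
From HB Require Import structures.
From Stdlib Require Import String BinNat.
From mathcomp Require Import all_boot.
From mathcomp Require Import boolp perm zify.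

Set Implicit Arguments.
Unset Strict Implicit.
Unset Printing Implicit Defensive.

(** Let [H] be the complement of [G], whose chromatic number is the clique covering number
of [G], and suppose that [k] guards win on [G] although [H] is not [k]-colourable. If two
vertices [A], [D] of [H] are joined to a common clique of [k - 1] vertices (a kite), then no
winning configuration contains both, and either may be exchanged for the other. Hence
contracting [A] and [D] gives a game of the same kind on one vertex fewer, where a guard on a
contracted class may be blocked at any vertex adjacent to one of its members. After at most two
contractions, [H] contains a ([k] + 1)-critical graph which is kite-free or has at most 9
vertices. These critical graphs are enumerated: starting from a clique and the adjacencies to
it, one branches on the undecided pairs that a [k]-colouring leaves monochromatic. The attacker
wins the game on all of them except one graph on 10 vertices, five graphs on 11 vertices, and
graphs with a vertex adjacent to all others (then [G] is disconnected). In the supergraphs of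
the exceptions, and in the graphs that contract to the first one, the attacker wins or [G] is
in the list. *)

(** * The game on classes of vertices *)

(** The attacker's win on a small graph is inherited in two ways: extra edges of [F] only block more
    guards, and inside a larger vertex set one considers states with the most guards on the small
    part, where no outside guard ever steps in ([eternal_restrict]). The number [j] of guards inside
    is then unknown, so attacks are needed for all [j] up to [k], with the domination clause only at
    [j] equal to [k]. The exact game does not descend to a contraction, because the defender may
    answer differently according to the member attacked. [eternal] keeps consequences that do
    descend: any one blocked guard can be avoided, and some guard is unblocked at every member.
    Contractions trade order for blocked classes: none on 11 vertices, at most one on 10, at most
    two on 9; the three families of computations assume these bounds. The searches may use arbitrary
    heuristics, since a branch closes only on a checked fact and running out of depth gives [false]:
    proposed colourings are rechecked, closure of a winning family is tested at the end, and the
    pruning of seeds rests on an extremal labelling. *)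

Section ClassGame.
Variable I : finType.
Implicit Types (F : rel I) (M X Y R B Q : {set I}) (W : {set {set I}}).

Definition move R (a b : I) := b |: (R :\ a).

(** [F] is adjacency in the complement, so an ordinary guard moves along a non-edge of [F]. [M]
    holds the contracted classes. In [et_multi] the attacker picks a member of [b] joined to [x],
    which rules out the guard on [x]. The guard provided by [et_dom] need not be the one that
    moves. *)
Record eternal F M X (k : nat) (d : bool) W : Prop := Eternal {
  et_nonempty : exists R, R \in W;
  et_state : forall R, R \in W -> R \subset X /\ #|R| = k;
  et_some : forall R b, R \in W -> b \in X -> b \notin R ->
    exists2 a, a \in R & move R a b \in W;
  et_single : forall R b, R \in W -> b \in X -> b \notin R -> b \notin M ->
    exists a, [/\ a \in R, ~~ F a b & move R a b \in W];
  et_multi : forall R b x, R \in W -> b \in X -> b \notin R -> F x b ->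
    exists a, [/\ a \in R, a != x & move R a b \in W];
  et_dom : d -> forall R b, R \in W -> b \in X -> b \notin R ->
    exists2 a, a \in R & ~~ F a b }.

Definition colorable F X k :=
  exists c : I -> nat, (forall x, x \in X -> c x < k) /\
    (forall x y, x \in X -> y \in X -> F x y -> c x != c y).

Lemma set_argmax (P : pred {set I}) (f : {set I} -> nat) R0 : P R0 ->
  exists2 R, P R & forall R', P R' -> f R' <= f R.
Proof. by move=> PR0; case: (arg_maxnP f PR0) => R PR fR; exists R. Qed.

Lemma set_argmin (P : pred {set I}) R0 : P R0 ->
  exists2 R, P R & forall R', P R' -> #|R| <= #|R'|.
Proof. by move=> PR0; case: (arg_minnP (fun R : {set I} => #|R|) PR0) => R PR fR; exists R. Qed.

Lemma in_move R a b x : (x \in move R a b) = (x == b) || (x != a) && (x \in R).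
Proof. by rewrite !inE. Qed.

Lemma card_move R a b : a \in R -> b \notin R -> #|move R a b| = #|R|.
Proof.
move=> aR bR; rewrite cardsU1 !inE negb_and bR orbT /=.
by rewrite (cardsD1 a R) aR.
Qed.

(** Among all states take one with the most guards in [Y], and freeze its guards outside as [P].
    Every attack inside [Y] is then answered from inside. The flag survives only when no guard is
    frozen, because the dominating guard of [et_dom] could lie in [P]. *)
Lemma eternal_restrict F M X Y k d W : Y \subset X -> eternal F M X k d W ->
  exists j W', j <= k /\ eternal F M Y j (d && (j == k)) W'.
Proof.
move=> sYX [[R0 R0W] st so si mu dm].
have [R1 R1W Rmax] := set_argmax (P := [in W]) (fun R => #|R :&: Y|) R0W.
pose P := R1 :\: Y; pose j := #|R1 :&: Y|.
have PY : [disjoint P & Y] by rewrite -setI_eq0 setIDAC setDIl setDv setI0.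
have nPY x : x \in Y -> x \notin P by move=> xY; rewrite inE xY.
exists j, [set Q : {set I} | (Q \subset Y) && (Q :|: P \in W)].
have cardQ Q : Q \subset Y -> #|Q :|: P| = #|Q| + #|P|.
  move=> QY; rewrite cardsU; suff -> : Q :&: P = set0 by rewrite cards0 subn0.
  apply/setP=> x; rewrite !inE; case xQ: (x \in Q) => //=.
  by rewrite (subsetP QY _ xQ).
have kE : k = j + #|P| by have [_ <-] := st _ R1W; rewrite cardsID.
have QIY Q : Q \subset Y -> (Q :|: P) :&: Y = Q.
  move=> QY; apply/setP=> x; rewrite !inE; case xQ: (x \in Q) => /=.
    by rewrite (subsetP QY _ xQ).
  by case: (x \in Y); rewrite ?andbF.
(* a response from outside [Y] would contradict the maximality of [j] *)
have resp Q a b : Q \subset Y -> Q :|: P \in W -> b \in Y -> b \notin Q ->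
    a \in Q :|: P -> move (Q :|: P) a b \in W ->
    a \in Q /\ move Q a b \in [set Q : {set I} | (Q \subset Y) && (Q :|: P \in W)].
  move=> QY QW bY bQ aQP mW.
  have cQ : #|Q| = j.
    by have [_] := st _ QW; rewrite cardQ // kE => /addIn.
  have aQ : a \in Q.
    apply: contraTT isT => aQ; have aP : a \in P by move: aQP; rewrite inE (negbTE aQ).
    have := Rmax _ mW; have -> : move (Q :|: P) a b :&: Y = b |: Q.
      apply/setP=> x; rewrite !inE; case: (eqVneq x b) => [->|xb] /=; first by rewrite bY.
      case xQ: (x \in Q); last by case: (x \in Y); rewrite ?andbF.
      rewrite (subsetP QY _ xQ) /= !andbT.
      by apply: contraNneq aQ => <-.
    by rewrite cardsU1 bQ cQ -/j ltnn.
  split=> //; rewrite inE; apply/andP; split.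
    apply/subsetP=> x; rewrite in_move => /orP[/eqP-> //|/andP[_]].
    exact: (subsetP QY).
  have -> : move Q a b :|: P = move (Q :|: P) a b; last by [].
  apply/setP=> x; rewrite !inE; case: (x == b) => //=.
  case: (eqVneq x a) => [->|] //=.
  by rewrite (subsetP QY _ aQ).
have outs Q b : b \in Y -> b \notin Q -> b \notin Q :|: P.
  by move=> bY bQ; rewrite inE negb_or bQ nPY.
split; first by rewrite kE leq_addr.
split.
- exists (R1 :&: Y); rewrite inE subsetIr /=.
  by rewrite setUC -[X in X \in W](setID R1 Y) setUC in R1W *.
- move=> Q; rewrite inE => /andP[QY QW]; split=> //.
  by by have [_] := st _ QW; rewrite cardQ // kE => /addIn.
- move=> Q b; rewrite inE => /andP[QY QW] bY bQ.
  have [a aR mW] := so _ b QW (subsetP sYX _ bY) (outs _ _ bY bQ).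
  by have [aQ mQ] := resp Q a b QY QW bY bQ aR mW; exists a.
- move=> Q b; rewrite inE => /andP[QY QW] bY bQ bM.
  have [a [aR nF mW]] := si _ b QW (subsetP sYX _ bY) (outs _ _ bY bQ) bM.
  by have [aQ mQ] := resp Q a b QY QW bY bQ aR mW; exists a.
- move=> Q b x; rewrite inE => /andP[QY QW] bY bQ Fxb.
  have [a [aR ax mW]] := mu _ b x QW (subsetP sYX _ bY) (outs _ _ bY bQ) Fxb.
  by have [aQ mQ] := resp Q a b QY QW bY bQ aR mW; exists a.
- case/andP=> dd /eqP jk Q b; rewrite inE => /andP[QY QW] bY bQ.
  have P0 : P = set0 by apply/eqP; rewrite -cards_eq0; move: kE; rewrite -jk; lia.
  rewrite P0 setU0 in QW.
  by apply: (dm dd _ _ QW) => //; apply: (subsetP sYX).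
Qed.

(** * Contracting the two tips of a kite *)

Section Merge.
Variables (F : rel I) (M X : {set I}) (k : nat) (W : {set {set I}}).
Variables (A D : I) (B : {set I}).
Hypotheses (symF : symmetric F) (irrF : irreflexive F).
Hypothesis etW : eternal F M X k true W.
Hypothesis cardM : #|M| <= 1.
Hypotheses (AX : A \in X) (DX : D \in X) (BX : B \subset X) (AD : A != D).
Hypothesis cardB : #|B|.+1 = k.
Hypothesis cliqueB : forall x y, x \in B -> y \in B -> x != y -> F x y.
Hypotheses (BA : forall x, x \in B -> F x A) (BD : forall x, x \in B -> F x D).

Let AB : A \notin B. Proof. by apply/negP=> /BA; rewrite irrF. Qed.
Let DB : D \notin B. Proof. by apply/negP=> /BD; rewrite irrF. Qed.

Let unique_multi x y : x \in M -> y \in M -> x = y.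
Proof. by move=> xM yM; apply: (card_le1_eqP cardM). Qed.

Let free_outside a b : b \in B -> a != b -> ~~ F a b -> a \notin B.
Proof. by move=> bB ab; apply: contra => aB; apply: cliqueB. Qed.

Let more_base R a b : b \in B -> b \notin R -> a \notin B ->
  #|R :&: B| < #|move R a b :&: B|.
Proof.
move=> bB bR aB; apply: proper_card; apply/properP; split.
  apply/subsetP=> x; rewrite !inE => /andP[xR xB]; rewrite xR xB andbT.
  by rewrite [x != a](_ : _ = true) ?orbT //; apply: contraNneq aB => <-.
by exists b; rewrite !inE ?eqxx ?bB // (negbTE bR).
Qed.

(* Attacking the base one vertex after the other would force the guards onto
   the whole of [A, D, B], or leave the last base vertex undominated. *)
Lemma base_exclusive R0 : R0 \in W -> A \in R0 -> D \notin R0.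
Proof.
move=> RW0 AR0; apply/negP=> DR0.
have PR0 : [&& R0 \in W, A \in R0 & D \in R0] by rewrite RW0 AR0.
have [R /and3P[RW AR DR] Rmax] := set_argmax (P := fun R => [&& R \in W, A \in R & D \in R])
  (fun R => #|R :&: B|) PR0.
have singleR b : b \in B -> b \notin M -> b \in R.
  move=> bB bM; apply: contraTT isT => bR.
  have [a [aR nF mW]] := et_single etW RW (subsetP BX _ bB) bR bM.
  have aA : A != a by apply: contraNneq nF => <-; rewrite symF BA.
  have aD : D != a by apply: contraNneq nF => <-; rewrite symF BD.
  have ab : a != b by apply: contraNneq bR => <-.
  have := Rmax (move R a b); rewrite mW !in_move AR DR aA aD !orbT => /(_ isT).
  by rewrite leqNgt more_base // (free_outside bB ab nF).
have [_ cR] := et_state etW RW.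
have sub2 (C : {set I}) : C \subset B -> C \subset R -> A |: (D |: C) \subset R.
  by move=> _ CR; apply/subsetP=> x; rewrite !inE => /or3P[/eqP->|/eqP->|/(subsetP CR)].
have card2 (C : {set I}) : C \subset B -> #|A |: (D |: C)| = #|C|.+2.
  move=> CB; rewrite !cardsU1 !inE negb_or AD /=.
  by rewrite (contra (subsetP CB A) AB) (contra (subsetP CB D) DB).
case: (boolP (B \subset R)) => [BR|/subsetPn[b bB bR]].
  by have := subset_leq_card (sub2 _ (subxx _) BR); rewrite card2 // cR -cardB ltnn.
have bM : b \in M by apply: contraNT bR; apply: singleR.
have BbR : B :\ b \subset R.
  apply/subsetP=> x; rewrite !inE => /andP[xb xB]; apply: singleR => //.
  by apply: contra xb => xM; apply/eqP; apply: unique_multi.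
have RE : A |: (D |: (B :\ b)) = R.
  apply/eqP; rewrite eqEcard sub2 ?subD1set // card2 ?subD1set // cR -cardB.
  by rewrite (cardsD1 b B) bB add1n /= ltnSn.
have [a aR /negP[]] := et_dom etW isT RW (subsetP BX _ bB) bR.
move: aR; rewrite -RE !inE => /or3P[/eqP->|/eqP->|/andP[ab aB]].
- by rewrite symF BA.
- by rewrite symF BD.
- exact: cliqueB.
Qed.

(** An attack on [D] has to be answered by the guard on [A], as any other answer would leave guards
    on both tips. *)
Let tie R : R \in W -> A \in R -> move R A D \in W.
Proof.
move=> RW AR; have DR := base_exclusive RW AR.
have [a aR mW] := et_some etW RW DX DR.
case: (eqVneq a A) => [<- //|aA].
have := base_exclusive mW; rewrite !in_move eqxx AR [A == a]eq_sym aA orbT /=.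
by move=> /(_ isT).
Qed.

Let tie' R : R \in W -> D \in R -> move R D A \in W.
Proof.
move=> RW DR; have AR : A \notin R by apply: contraL DR; apply: base_exclusive.
have [a aR mW] := et_some etW RW AX AR.
case: (eqVneq a D) => [<- //|aD].
have := base_exclusive mW; rewrite !in_move eqxx DR [D == a]eq_sym aD orbT /=.
by move=> /(_ isT).
Qed.

(** If the tips were joined, an attack on [D] could be blocked at [A], and the remaining answer
    would put guards on both tips. *)
Lemma base_nonadjacent : ~~ F A D.
Proof.
apply/negP=> FAD; have [R0 R0W] := et_nonempty etW.
have [R RW AR] : exists2 R, R \in W & A \in R.
  case: (boolP (A \in R0)) => [|AR0]; first by exists R0.
  have [a _ mW] := et_some etW R0W AX AR0; exists (move R0 a A) => //.
  by rewrite in_move eqxx.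
have [a [aR aA mW]] := et_multi etW RW DX (base_exclusive RW AR) FAD.
have := base_exclusive mW; rewrite !in_move eqxx AR [A == a]eq_sym aA orbT /=.
by move=> /(_ isT).
Qed.

(** Attacks on the base gather guards on all of [B], using states inside the union of [B] and [R].
    The single guard left outside [B] is then one of the original guards of [R], and since the
    guards on [B] are joined to both tips, it must dominate [A] and [D] alone. *)
Let dom_merged R : R \in W -> A \notin R -> D \notin R ->
  exists2 a, a \in R & ~~ F a A && ~~ F a D.
Proof.
move=> RW AR DR.
have PR : (R \in W) && (R \subset B :|: R) by rewrite RW subsetUr.
have [R1 /andP[R1W sR1] Rmax] := set_argmax (P := fun R' => (R' \in W) && (R' \subset B :|: R))
  (fun R' => #|R' :&: B|) PR.
have submove Q a b : Q \subset B :|: R -> b \in B -> move Q a b \subset B :|: R.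
  move=> /subsetP QS bB; apply/subsetP=> x; rewrite in_move.
  by case/orP=> [/eqP->|/andP[_ /QS //]]; rewrite inE bB.
have better R' : R' \in W -> R' \subset B :|: R -> #|R1 :&: B| < #|R' :&: B| -> False.
  by move=> R'W R'S; apply/negP; rewrite -leqNgt; apply: Rmax; rewrite R'W.
have singleR b : b \in B -> b \notin M -> b \in R1.
  move=> bB bM; case: (boolP (b \in R1)) => // bR.
  have [a [aR nF mW]] := et_single etW R1W (subsetP BX _ bB) bR bM.
  have ab : a != b by apply: contraNneq bR => <-.
  case: (better _ mW (submove _ _ _ sR1 bB)).
  by rewrite more_base // (free_outside bB ab nF).
have BR1 : B \subset R1.
  apply/subsetP=> b bB; case: (boolP (b \in R1)) => // bR.
  have bM : b \in M by apply: contraNT bR; apply: singleR.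
  have [a aR mW] := et_some etW R1W (subsetP BX _ bB) bR.
  have sm := submove R1 a b sR1 bB.
  case: (boolP (a \in B)) => [aB|aB]; last by case: (better _ mW sm); apply: more_base.
  have ab : a != b by apply: contraNneq bR => <-.
  (* A contracted class [b] may have been answered from inside the base, by [a]. As [M] has at most
     one member, [a] is a single class, and attacking it next brings in a guard from outside the
     base: the two attacks together gain one base vertex. *)
  have aM : a \notin M by apply: contra ab => aM; apply/eqP; apply: unique_multi.
  have aR2 : a \notin move R1 a b by rewrite in_move eqxx (negbTE ab).
  have [a' [a'R nF m'W]] := et_single etW mW (subsetP BX _ aB) aR2 aM.
  have a'a : a' != a by apply: contraNneq aR2 => E; rewrite -{1}E.
  case: (better _ m'W (submove _ _ _ sm aB)).
  apply: leq_trans (more_base aB aR2 (free_outside aB a'a nF)).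
  rewrite ltnS; suff -> : move R1 a b :&: B = b |: (R1 :&: B) :\ a.
    by rewrite cardsU1 !inE (negbTE bR) andbF /= add1n (cardsD1 a (R1 :&: B)) inE aR aB.
  apply/setP=> x; rewrite !inE; case: (eqVneq x b) => [->|_] /=; first by rewrite bB.
  by rewrite andbA.
have [_ cR1] := et_state etW R1W.
have c1 : #|R1 :\: B| = 1.
  by move: (cardsID B R1); rewrite (setIidPr BR1) cR1 -cardB -[#|B|.+1]addn1 => /addnI.
have /cards1P[t R1E] : #|R1 :\: B| == 1 by rewrite c1.
have outB C a : (forall x, x \in B -> F x C) -> a \in R1 -> ~~ F a C -> a = t.
  move=> BC aR nF; apply/set1P; rewrite -R1E inE aR andbT.
  by apply: contra nF; apply: BC.
have notR1 C : C \notin B -> C \notin R -> C \notin R1.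
  by move=> CB CR; apply: contra CB => /(subsetP sR1); rewrite inE (negbTE CR) orbF.
have [a aR nFA] := et_dom etW isT R1W AX (notR1 _ AB AR).
have [a' a'R nFD] := et_dom etW isT R1W DX (notR1 _ DB DR).
have atE := outB _ _ BA aR nFA; have a'tE := outB _ _ BD a'R nFD.
rewrite atE in nFA; rewrite a'tE in nFD.
exists t; last by rewrite nFA.
have : t \in R1 :\: B by rewrite R1E set11.
by rewrite inE => /andP[/negbTE tB /(subsetP sR1)]; rewrite inE tB.
Qed.

Definition merge (x y : I) := [|| F x y, (x == A) && F D y | (y == A) && F x D].

Lemma merge_sym : symmetric merge.
Proof. by move=> x y; rewrite /merge symF (symF D) (symF x D) orbA orbAC -orbA. Qed.

Lemma merge_irr : irreflexive merge.
Proof.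
move=> x; rewrite /merge irrF; case: eqVneq => //= ->.
by rewrite (symF D) (negbTE base_nonadjacent).
Qed.

(** A guard on the class is recorded on [A] but may be moved to [D] and back at will. When the
    attacked vertex is joined to [D], the answer is taken from the state with the guard on [D]; it
    does not come from [D], and the guard afterwards returns to [A]. Hence the class never answers
    for a vertex joined to one of its members. *)
Lemma merge_eternal : eternal merge (A |: M) (X :\ D) k true [set R in W | D \notin R].
Proof.
have keep R a b : b != D -> D \notin R -> D \notin move R a b.
  by move=> bD DR; rewrite in_move eq_sym (negbTE bD) (negbTE DR) andbF.
(* a response [a] to [b] from the state with [A] exchanged for [D] *)
have back R a b : A \in R -> D \notin R -> b != A -> b != D -> b \notin R ->
    a \in move R A D -> a != D -> move (move R A D) a b \in W ->
    [/\ a \in R, a != A & move R a b \in W].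
  move=> AR DR bA bD bR aR aD mW.
  have aA : a != A by move: aR; rewrite in_move (negbTE aD) => /andP[].
  have {}aR : a \in R by move: aR; rewrite in_move (negbTE aD) aA.
  have Dm : D \in move (move R A D) a b.
    by rewrite !in_move eqxx [D == a]eq_sym aD orbT.
  split=> //; have := tie' mW Dm; congr (_ \in W).
  apply/setP=> x; rewrite !in_move.
  case: (eqVneq x A) => [->|xA] /=.
    by rewrite [A == b]eq_sym (negbTE bA) [A == a]eq_sym aA AR.
  case: (eqVneq x D) => [->|xD] /=; last by [].
  by rewrite [D == b]eq_sym (negbTE bD) (negbTE DR) andbF.
have [ne st so si mu dm] := etW; split.
- have [R RW] := ne; case: (boolP (D \in R)) => DR; last first.
    by exists R; rewrite inE RW.
  exists (move R D A); rewrite inE tie' //=.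
  by rewrite in_move eqxx eq_sym (negbTE AD).
- move=> R; rewrite inE => /andP[RW DR]; have [RX cR] := st _ RW; split=> //.
  by rewrite subsetD1 RX.
- move=> R b; rewrite !inE => /andP[RW DR] /andP[bD bX] bR.
  have [a aR mW] := so _ _ RW bX bR; exists a => //.
  by rewrite inE mW keep.
- move=> R b; rewrite !inE => /andP[RW DR] /andP[bD bX] bR; rewrite negb_or => /andP[bA bM].
  case: (boolP ((A \in R) && F D b)) => [/andP[AR FDb]|nAR].
    have bR2 : b \notin move R A D by rewrite in_move (negbTE bD) (negbTE bR) andbF.
    have [a [aR nF mW]] := si _ _ (tie RW AR) bX bR2 bM.
    have aD : a != D by apply: contraNneq nF => ->.
    have [aR' aA mW'] := back _ _ _ AR DR bA bD bR aR aD mW.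
    exists a; rewrite inE mW' keep //; split=> //.
    by rewrite /merge (negbTE nF) (negbTE aA) (negbTE bA).
  have [a [aR nF mW]] := si _ _ RW bX bR bM.
  exists a; rewrite inE mW keep //; split=> //.
  rewrite /merge (negbTE nF) (negbTE bA) /= orbF.
  by case: (eqVneq a A) nAR aR => //= -> /[swap] -> /=.
- move=> R b x; rewrite !inE => /andP[RW DR] /andP[bD bX] bR.
  rewrite /merge => /or3P[Fxb|/andP[/eqP-> FDb]|/andP[/eqP bA FxD]].
  + have [a [aR ax mW]] := mu _ _ _ RW bX bR Fxb.
    by exists a; rewrite inE mW keep.
  + case: (boolP (A \in R)) => AR; last first.
      have [a aR mW] := so _ _ RW bX bR; exists a; rewrite inE mW keep //; split=> //.
      by apply: contraNneq AR => <-.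
    have bA : b != A by apply: contraNneq bR => ->.
    have bR2 : b \notin move R A D by rewrite in_move (negbTE bD) (negbTE bR) andbF.
    have [a [aR aD mW]] := mu _ _ _ (tie RW AR) bX bR2 FDb.
    have [aR' aA mW'] := back _ _ _ AR DR bA bD bR aR aD mW.
    by exists a; rewrite inE mW' keep.
  + rewrite bA in bX bR *; have [a [aR ax mW]] := mu _ _ _ RW DX DR FxD.
    exists a; split=> //; rewrite inE keep // andbT.
    have Dm : D \in move R a D by rewrite in_move eqxx.
    have := tie' mW Dm; congr (_ \in W); apply/setP=> y; rewrite !in_move.
    case: (eqVneq y A) => [->|yA] //=; case: (eqVneq y D) => [->|yD] //=.
    by rewrite (negbTE DR) andbF.
- move=> _ R b; rewrite !inE => /andP[RW DR] /andP[bD bX] bR.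
  case: (eqVneq b A) => [bA|bA].
    rewrite bA in bR *; have [a aR /andP[nA nD]] := dom_merged RW bR DR.
    exists a => //; rewrite /merge (negbTE nA) (negbTE nD) eqxx /= orbF.
    by case: (eqVneq a A) aR => // ->; rewrite (negbTE bR).
  case: (boolP ((A \in R) && F D b)) => [/andP[AR FDb]|nAR].
    have bR2 : b \notin move R A D by rewrite in_move (negbTE bD) (negbTE bR) andbF.
    have [a aR nF] := dm isT _ _ (tie RW AR) bX bR2.
    have aD : a != D by apply: contraNneq nF => ->.
    have [aA aR'] : a != A /\ a \in R.
      by move: aR; rewrite in_move (negbTE aD) => /andP[].
    by exists a => //; rewrite /merge (negbTE nF) (negbTE aA) (negbTE bA).
  have [a aR nF] := dm isT _ _ RW bX bR; exists a => //.
  rewrite /merge (negbTE nF) (negbTE bA) /= orbF.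
  by case: (eqVneq a A) nAR aR => //= -> /[swap] -> /=.
Qed.

Lemma merge_colorable : colorable merge (X :\ D) k -> colorable F X k.
Proof.
move=> [c [ck cF]]; exists (fun x => if x == D then c A else c x); split.
  move=> x xX; case: eqVneq => xD; apply: ck; rewrite !inE ?AD ?AX //.
  by rewrite xD.
move=> x y xX yX Fxy.
case: (eqVneq x D) Fxy => [-> |xD]; case: (eqVneq y D) => [-> |yD] Fxy.
- by rewrite irrF in Fxy.
- by apply: cF; rewrite ?inE ?AD ?AX ?yD // /merge eqxx Fxy orbT.
- by apply: cF; rewrite ?inE ?AD ?AX ?xD // /merge eqxx Fxy !orbT.
- by apply: cF; rewrite ?inE ?xD ?yD // /merge Fxy.
Qed.

End Merge.

End ClassGame.

Section Pullback.
Variables (I J : finType) (f : J -> I).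
Hypothesis injf : injective f.

End Pullback.

(** * Critical subgraphs *)

Definition del_edge (T : eqType) (F : rel T) (x y : T) : rel T := fun u v =>
  [&& F u v, ~~ ((u == x) && (v == y)) & ~~ ((u == y) && (v == x))].

Record critical (T : finType) (k : nat) (F : rel T) : Prop := Critical {
  crit_sym : symmetric F;
  crit_irr : irreflexive F;
  crit_noncol : ~ colorable F setT k;
  crit_vertex : forall v, colorable F [set~ v] k;
  crit_edge : forall x y, F x y -> colorable (del_edge F x y) setT k }.

Definition kite_free (T : finType) (k : nat) (F : rel T) :=
  forall (A D : T) (B : {set T}), A != D -> #|B|.+1 = k ->
    (forall x y, x \in B -> y \in B -> x != y -> F x y) ->
    (forall x, x \in B -> F x A) -> (forall x, x \in B -> F x D) -> False.

Lemma colorable_sub (T : finType) (F F0 : rel T) X k :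
  subrel F0 F -> colorable F X k -> colorable F0 X k.
Proof. by move=> sF [c [ck cF]]; exists c; split=> // x y xX yX /sF; apply: cF. Qed.

(** A smallest non-colourable vertex set gives criticality of vertices, and a smallest symmetric
    non-colourable set of ordered pairs on it gives criticality of edges. Vertex criticality
    survives the removal of edges. *)
Lemma exists_critical (I : finType) (F : rel I) (X : {set I}) k :
  symmetric F -> irreflexive F -> ~ colorable F X k ->
  exists m (f : 'I_m -> I) (F0 : rel 'I_m),
    [/\ injective f, forall i, f i \in X, subrel F0 (relpre f F) & critical k F0].
Proof.
move=> symF irrF ncX.
have PX : (X \subset X) && ~~ `[< colorable F X k >] by rewrite subxx; apply/asboolPn.
have [Y /andP[YX /asboolPn ncY] Ymin] := set_argmin (P := fun Y => (Y \subset X) && ~~ `[< colorable F Y k >]) PX.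
pose f (i : 'I_#|Y|) : I := enum_val i.
have injf : injective f by exact: enum_val_inj.
have fY i : f i \in Y by apply: enum_valP.
have fsurj x : x \in Y -> exists i, x = f i.
  by move=> xY; exists (enum_rank_in xY x); rewrite /f enum_rankK_in.
have ncf : ~ colorable (relpre f F) setT k.
  case=> c [ck cF]; apply: ncY.
  pose c' x := if [pick i | f i == x] is Some i then c i else 0.
  have c'f i : c' (f i) = c i.
    rewrite /c'; case: pickP => [j /eqP/injf-> //|/(_ i)]; by rewrite eqxx.
  exists c'; split=> [x /fsurj[i ->]|x y /fsurj[i ->] /fsurj[j ->] Fij]; rewrite !c'f.
    exact: ck.
  exact: cF.
have fcol v : colorable (relpre f F) [set~ v] k.
  have ltY : #|Y :\ f v| < #|Y| by rewrite proper_card ?properD1.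
  have := Ymin (Y :\ f v); rewrite leqNgt ltY.
  case: asboolP => [[c [ck cF]] _|_]; last first.
    by rewrite (subset_trans (subD1set _ _) YX) => /(_ isT).
  exists (c \o f); split=> [i|i j].
    by rewrite !inE => iv; apply: ck; rewrite !inE (inj_eq injf) iv fY.
  by rewrite !inE => iv jv; apply: cF; rewrite !inE (inj_eq injf) ?iv ?jv fY.
pose E0 := [set e : 'I_#|Y| * 'I_#|Y| | F (f e.1) (f e.2)].
pose rE (E : {set 'I_#|Y| * 'I_#|Y|}) : rel 'I_#|Y| := fun x y => (x, y) \in E.
pose P (E : {set 'I_#|Y| * 'I_#|Y|}) :=
  [&& [forall x, forall y, rE E x y == rE E y x], E \subset E0 & ~~ `[< colorable (rE E) setT k >]].
have PE0 : P E0.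
  apply/and3P; split=> //.
    by apply/forallP=> x; apply/forallP=> y; rewrite /rE !inE /= symF.
  apply/asboolPn=> /(colorable_sub (F0 := relpre f F)) nc; apply: ncf; apply: nc.
  by move=> x y; rewrite /rE inE.
have [E /and3P[symE sE /asboolPn ncE] Emin] := set_argmin (P := P) PE0.
have {}symE : symmetric (rE E).
  by move=> x y; apply/eqP; move/forallP/(_ x)/forallP/(_ y): symE.
have sFE : subrel (rE E) (relpre f F).
  by move=> x y /(subsetP sE); rewrite inE.
exists #|Y|, f, (rE E); split=> //.
  by move=> i; apply: (subsetP YX).
split=> //.
- by move=> x; apply/negP=> /sFE /=; rewrite irrF.
- by move=> v; apply: colorable_sub sFE _.
move=> x y Exy; pose E' := E :\ (x, y) :\ (y, x).
have E'E u v : rE E' u v = del_edge (rE E) x y u v.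
  by rewrite /rE /del_edge !inE !xpair_eqE [RHS]andbC -!andbA [RHS]andbCA.
have := Emin E'; rewrite leqNgt (_ : #|E'| < #|E|); last first.
  by rewrite proper_card // (sub_proper_trans (subD1set _ _)) // properD1.
rewrite /P; case: asboolP => [col _|_].
  by apply: colorable_sub col => u v; rewrite E'E.
have -> /= : E' \subset E0.
  by apply: subset_trans sE; apply: (subset_trans (subD1set _ _)); apply: subD1set.
have -> // : [forall u, forall v, rE E' u v == rE E' v u].
  apply/forallP=> u; apply/forallP=> v; apply/eqP.
  rewrite !E'E /del_edge symE; congr (_ && _); rewrite andbC.
  by rewrite [(v == y) && _]andbC [(v == x) && _]andbC.
by move=> /(_ isT).
Qed.

(** * Guards and clique covers read in the complement *)

Section Graph.
Variable G : sgraph.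

Definition nonadj : rel G := fun x y => (x != y) && ~~ adj x y.

Lemma nonadj_sym : symmetric nonadj.
Proof. by move=> x y; rewrite /nonadj eq_sym adj_sym. Qed.

Lemma nonadj_irr : irreflexive nonadj.
Proof. by move=> x; rewrite /nonadj eqxx. Qed.

Lemma nonadjN x y : x != y -> ~~ nonadj x y = adj x y.
Proof. by move=> xy; rewrite /nonadj xy negbK. Qed.

(** The family [W] consists of the states that a winning strategy reaches against legal attacks. *)
Lemma guards_eternal k : guards_suffice G k ->
  exists W, eternal nonadj set0 setT k true W.
Proof.
case=> s [_ s0 win].
pose W := [set R | `[< exists2 h, played s h & s h = R >]].
have inW h : played s h -> s h \in W by move=> ph; rewrite inE; apply/asboolP; exists h.
have resp R b : R \in W -> b \notin R ->
    exists a, [/\ a \in R, ~~ nonadj a b & move R a b \in W].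
  rewrite inE => /asboolP[h ph <-] bR; have [u [uR uv sE]] := win h b ph bR.
  have ub : u != b by apply: contraNneq bR => <-.
  exists u; split=> //; first by rewrite nonadjN // adj_sym.
  by rewrite /move -sE; apply: inW; apply: played_rcons.
exists W; split.
- by exists (s [::]); apply: inW; constructor.
- move=> R; rewrite inE => /asboolP[h ph <-]; split; first exact: subsetT.
  elim: ph => // {}h v ph IH vR; have [u [uR _ ->]] := win h v ph vR.
  by rewrite -IH; apply: card_move.
- by move=> R b RW _ bR; have [a [aR _ mW]] := resp R b RW bR; exists a.
- by move=> R b RW _ bR _; have [a [aR nF mW]] := resp R b RW bR; exists a.
- move=> R b x RW _ bR xb; have [a [aR nF mW]] := resp R b RW bR; exists a; split=> //.
  by apply: contraNneq nF => ->.
- by move=> _ R b RW _ bR; have [a [aR nF mW]] := resp R b RW bR; exists a.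
Qed.

(** Without contracted classes [et_single] answers every attack by a legal move, so choosing a
    successor inside [W] is a strategy that depends only on the current state. *)
Lemma eternal_guards k d W : eternal nonadj set0 setT k d W -> guards_suffice G k.
Proof.
move=> etW; have [R0 R0W] := et_nonempty etW.
pose step (R : {set G}) (v : G) := odflt R [pick R' in W | [exists u in R, adj u v && (R' == move R u v)]].
have stepP (R : {set G}) v : R \in W -> v \notin R -> step R v \in W /\ guard_move R v (step R v).
  move=> RW vR; rewrite /step; case: pickP => [R' /andP[R'W /exists_inP[u uR /andP[uv /eqP E]]]|no].
    by split=> //; exists u; split=> //; apply/eqP.
  have [||a [aR nF mW]] := et_single etW RW _ vR _; rewrite ?inE //.
  case/negP: (no (move R a v)); rewrite mW; apply/exists_inP; exists a => //.
  rewrite eqxx andbT -nonadjN //.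
  by apply: contraNneq vR => <-.
pose s := foldl step R0.
have sW h : played s h -> s h \in W.
  elim=> // {}h v ph IH vR; rewrite /s -cats1 foldl_cat /=.
  by have [] := stepP _ _ IH vR.
exists s; split.
- move=> v vR; have [||a [aR nF _]] := et_single etW R0W _ vR _; rewrite ?inE //.
  exists a => //; rewrite adj_sym -nonadjN //.
  by apply: contraNneq vR => <-.
- by have [] := et_state etW R0W.
- move=> h v ph vR; rewrite {2}/s -cats1 foldl_cat /=.
  by have [] := stepP _ _ (sW h ph) vR.
Qed.

Lemma cover_colorable k : clique_covering_number G <= k <-> colorable nonadj setT k.
Proof.
split.
  rewrite /clique_covering_number; case: ex_minnP => t /existsP[P /andP[/andP[partP cliP] /eqP cP]] _ tk.
  have covP x : x \in cover P by rewrite (cover_partition partP) inE.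
  have tiP : trivIset P by case/and3P: partP.
  exists (fun x => index (pblock P x) (enum P)); split.
    move=> x _; rewrite (leq_trans _ tk) // -cP cardE index_mem mem_enum.
    exact: pblock_mem.
  move=> x y _ _ Fxy; apply: contraTneq Fxy => Exy.
  have pE : pblock P x = pblock P y.
    by apply: (@index_inj _ set0 (enum P)) Exy; rewrite mem_enum pblock_mem ?covP.
  have [->|nxy] := eqVneq x y; first by rewrite nonadj_irr.
  rewrite nonadjN //.
  have /forall_inP/(_ _ (pblock_mem (covP x)))/forall_inP cl := cliP.
  have := cl x; rewrite mem_pblock covP => /(_ isT)/forall_inP/(_ y).
  by rewrite pE mem_pblock covP nxy => /(_ isT).
case=> c [ck cF].
pose P := preim_partition c [set: G].
have partP : partition P setT by apply: preim_partitionP.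
rewrite /clique_covering_number; case: ex_minnP => t _ tmin.
have cP : #|P| <= k.
  pose g (i : 'I_k) := [set y in [set: G] | c y == i].
  rewrite -[k]card_ord -(cardsT 'I_k); apply: leq_trans (leq_imset_card g _).
  apply/subset_leq_card/subsetP=> _ /imsetP[x _ ->].
  have xk : c x < k by apply: ck.
  by apply/imsetP; exists (Ordinal xk) => //; apply/setP=> y; rewrite !inE /= eq_sym.
apply: leq_trans cP; apply: tmin; apply/existsP; exists P; rewrite eqxx andbT.
rewrite /clique_partition partP; apply/forall_inP=> _ /imsetP[z _ ->].
apply/forall_inP=> x; rewrite !inE => /eqP zx; apply/forall_inP=> y.
rewrite !inE => /eqP zy; apply/implyP=> xy; rewrite -nonadjN //; apply/negP=> Fxy.
by have := cF x y (in_setT _) (in_setT _) Fxy; rewrite -zx zy eqxx.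
Qed.

End Graph.

(** * Enumeration of critical graphs *)

(* Vertex sets are pairs of base-64 digits, so that the set operations are table lookups. *)
Inductive digit :=
  d0 | d1 | d2 | d3 | d4 | d5 | d6 | d7 | d8 | d9 | d10 | d11 | d12 | d13 | d14 | d15 | d16 | d17
  | d18 | d19 | d20 | d21 | d22 | d23 | d24 | d25 | d26 | d27 | d28 | d29 | d30 | d31 | d32 | d33
  | d34 | d35 | d36 | d37 | d38 | d39 | d40 | d41 | d42 | d43 | d44 | d45 | d46 | d47 | d48 | d49
  | d50 | d51 | d52 | d53 | d54 | d55 | d56 | d57 | d58 | d59 | d60 | d61 | d62 | d63.

Definition digits :=
  [:: d0; d1; d2; d3; d4; d5; d6; d7; d8; d9; d10; d11; d12; d13; d14; d15; d16; d17; d18; d19; d20; d21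
  ; d22; d23; d24; d25; d26; d27; d28; d29; d30; d31; d32; d33; d34; d35; d36; d37; d38; d39; d40; d41
  ; d42; d43; d44; d45; d46; d47; d48; d49; d50; d51; d52; d53; d54; d55; d56; d57; d58; d59; d60; d61
  ; d62; d63].

Definition case64 (T : Type) (f : digit -> T) (x : digit) : T := match x with
  | d0 => f d0 | d1 => f d1 | d2 => f d2 | d3 => f d3 | d4 => f d4 | d5 => f d5 | d6 => f d6
  | d7 => f d7 | d8 => f d8 | d9 => f d9 | d10 => f d10 | d11 => f d11 | d12 => f d12 | d13 => f d13
  | d14 => f d14 | d15 => f d15 | d16 => f d16 | d17 => f d17 | d18 => f d18 | d19 => f d19
  | d20 => f d20 | d21 => f d21 | d22 => f d22 | d23 => f d23 | d24 => f d24 | d25 => f d25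
  | d26 => f d26 | d27 => f d27 | d28 => f d28 | d29 => f d29 | d30 => f d30 | d31 => f d31
  | d32 => f d32 | d33 => f d33 | d34 => f d34 | d35 => f d35 | d36 => f d36 | d37 => f d37
  | d38 => f d38 | d39 => f d39 | d40 => f d40 | d41 => f d41 | d42 => f d42 | d43 => f d43
  | d44 => f d44 | d45 => f d45 | d46 => f d46 | d47 => f d47 | d48 => f d48 | d49 => f d49
  | d50 => f d50 | d51 => f d51 | d52 => f d52 | d53 => f d53 | d54 => f d54 | d55 => f d55
  | d56 => f d56 | d57 => f d57 | d58 => f d58 | d59 => f d59 | d60 => f d60 | d61 => f d61
  | d62 => f d62 | d63 => f d63
  end.

Definition value (x : digit) : nat := match x with
  | d0 => 0 | d1 => 1 | d2 => 2 | d3 => 3 | d4 => 4 | d5 => 5 | d6 => 6 | d7 => 7 | d8 => 8 | d9 => 9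
  | d10 => 10 | d11 => 11 | d12 => 12 | d13 => 13 | d14 => 14 | d15 => 15 | d16 => 16 | d17 => 17
  | d18 => 18 | d19 => 19 | d20 => 20 | d21 => 21 | d22 => 22 | d23 => 23 | d24 => 24 | d25 => 25
  | d26 => 26 | d27 => 27 | d28 => 28 | d29 => 29 | d30 => 30 | d31 => 31 | d32 => 32 | d33 => 33
  | d34 => 34 | d35 => 35 | d36 => 36 | d37 => 37 | d38 => 38 | d39 => 39 | d40 => 40 | d41 => 41
  | d42 => 42 | d43 => 43 | d44 => 44 | d45 => 45 | d46 => 46 | d47 => 47 | d48 => 48 | d49 => 49
  | d50 => 50 | d51 => 51 | d52 => 52 | d53 => 53 | d54 => 54 | d55 => 55 | d56 => 56 | d57 => 57
  | d58 => 58 | d59 => 59 | d60 => 60 | d61 => 61 | d62 => 62 | d63 => 63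
  end.

Definition digit_of (n : nat) : digit := nth d63 digits n.
Definition bitd (x : digit) (i : nat) : bool := odd (value x %/ 2 ^ i).
Definition of_bits (f : nat -> bool) : digit := digit_of (foldr (fun i n => f i + n.*2) 0 (iota 0 6)).
Definition countd (x : digit) : nat := count (bitd x) (iota 0 6).

Definition andd : digit -> digit -> digit := Eval vm_compute in
  fun x y => case64 (fun x => case64 (fun y => of_bits (fun i => bitd x i && bitd y i)) y) x.
Definition orrd : digit -> digit -> digit := Eval vm_compute in
  fun x y => case64 (fun x => case64 (fun y => of_bits (fun i => bitd x i || bitd y i)) y) x.
Definition diffd : digit -> digit -> digit := Eval vm_compute in
  fun x y => case64 (fun x => case64 (fun y => of_bits (fun i => bitd x i && ~~ bitd y i)) y) x.
Definition disjd : digit -> digit -> bool := Eval vm_compute in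
  fun x y => case64 (fun x => case64 (fun y => ~~ has (fun i => bitd x i && bitd y i) (iota 0 6)) y) x.
Definition eqd : digit -> digit -> bool := Eval vm_compute in
  fun x y => case64 (fun x => case64 (fun y => value x == value y) y) x.
Definition count_and : digit -> digit -> digit := Eval vm_compute in
  fun x y => case64 (fun x => case64 (fun y => digit_of (count (fun i => bitd x i && bitd y i) (iota 0 6))) y) x.
Definition count_or : digit -> digit -> digit := Eval vm_compute in
  fun x y => case64 (fun x => case64 (fun y => digit_of (count (fun i => bitd x i || bitd y i) (iota 0 6))) y) x.
(** The cap at 63 keeps sums inside the table. Sums are used only where the true value is at most 63
    or where an underestimate is harmless. *)
Definition addd : digit -> digit -> digit := Eval vm_compute in
  fun x y => case64 (fun x => case64 (fun y => digit_of (minn 63 (value x + value y))) y) x.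
Definition ltd : digit -> digit -> bool := Eval vm_compute in
  fun x y => case64 (fun x => case64 (fun y => value x < value y) y) x.
Definition cardd : digit -> digit := Eval vm_compute in case64 (fun x => digit_of (countd x)).

Inductive vset := VS of digit & digit.
Definition v0 := VS d0 d0.
Definition vand x y := let: VS a b := x in let: VS a' b' := y in VS (andd a a') (andd b b').
Definition vor x y := let: VS a b := x in let: VS a' b' := y in VS (orrd a a') (orrd b b').
Definition vdiff x y := let: VS a b := x in let: VS a' b' := y in VS (diffd a a') (diffd b b').
Definition isz x := match x with VS d0 d0 => true | _ => false end.
Definition disj x y := let: VS a b := x in let: VS a' b' := y in if disjd a a' then disjd b b' else false.
Definition veq x y := let: VS a b := x in let: VS a' b' := y in if eqd a a' then eqd b b' else false.
Definition pc x := let: VS a b := x in addd (cardd a) (cardd b).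
Definition pcand x y n := let: VS a b := x in let: VS a' b' := y in addd n (addd (count_and a a') (count_and b b')).
Definition pcor x y := let: VS a b := x in let: VS a' b' := y in addd (count_or a a') (count_or b b').

Inductive vtx := x0 | x1 | x2 | x3 | x4 | x5 | x6 | x7 | x8 | x9 | x10 | x11.
Definition vtxs := [:: x0; x1; x2; x3; x4; x5; x6; x7; x8; x9; x10; x11].
Definition vnat (v : vtx) : nat := match v with
  | x0 => 0 | x1 => 1 | x2 => 2 | x3 => 3 | x4 => 4 | x5 => 5 | x6 => 6 | x7 => 7 | x8 => 8 | x9 => 9 | x10 => 10 | x11 => 11 end.
Definition bit0 : digit -> bool := Eval vm_compute in case64 (fun x => bitd x 0).
Definition bit1 : digit -> bool := Eval vm_compute in case64 (fun x => bitd x 1).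
Definition bit2 : digit -> bool := Eval vm_compute in case64 (fun x => bitd x 2).
Definition bit3 : digit -> bool := Eval vm_compute in case64 (fun x => bitd x 3).
Definition bit4 : digit -> bool := Eval vm_compute in case64 (fun x => bitd x 4).
Definition bit5 : digit -> bool := Eval vm_compute in case64 (fun x => bitd x 5).
Definition vin (v : vtx) (s : vset) : bool := match v, s with
  | x0, VS a b => bit0 a | x1, VS a b => bit1 a | x2, VS a b => bit2 a | x3, VS a b => bit3 a
  | x4, VS a b => bit4 a | x5, VS a b => bit5 a | x6, VS a b => bit0 b | x7, VS a b => bit1 b
  | x8, VS a b => bit2 b | x9, VS a b => bit3 b | x10, VS a b => bit4 b | x11, VS a b => bit5 b end.
Definition vone (v : vtx) : vset := match v with
  | x0 => VS d1 d0 | x1 => VS d2 d0 | x2 => VS d4 d0 | x3 => VS d8 d0 | x4 => VS d16 d0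
  | x5 => VS d32 d0 | x6 => VS d0 d1 | x7 => VS d0 d2 | x8 => VS d0 d4 | x9 => VS d0 d8
  | x10 => VS d0 d16 | x11 => VS d0 d32 end.
Definition vtxb : vtx -> vtx -> bool := Eval vm_compute in fun u v => match u, v with
  | x0, x0 => true | x1, x1 => true | x2, x2 => true | x3, x3 => true | x4, x4 => true | x5, x5 => true | x6, x6 => true | x7, x7 => true | x8, x8 => true | x9, x9 => true | x10, x10 => true | x11, x11 => true | _, _ => false end.
Definition lowlist : digit -> seq vtx := Eval vm_compute in
  case64 (fun x => [seq v <- take 6 vtxs | vin v (VS x d0)]).
Definition highlist : digit -> seq vtx := Eval vm_compute in
  case64 (fun x => [seq v <- drop 6 vtxs | vin v (VS d0 x)]).
Definition vlist (s : vset) := let: VS a b := s in lowlist a ++ highlist b.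

(** The two sets are the decided neighbours and the vertices still undecided; a vertex in neither is
    a decided non-neighbour. *)
Inductive row := Row of vset & vset.
Inductive state := St of row & row & row & row & row & row & row & row & row & row & row & row.
Definition get (v : vtx) (s : state) : row := match v, s with
|x0, St r0 _ _ _ _ _ _ _ _ _ _ _ => r0
|x1, St _ r1 _ _ _ _ _ _ _ _ _ _ => r1
|x2, St _ _ r2 _ _ _ _ _ _ _ _ _ => r2
|x3, St _ _ _ r3 _ _ _ _ _ _ _ _ => r3
|x4, St _ _ _ _ r4 _ _ _ _ _ _ _ => r4
|x5, St _ _ _ _ _ r5 _ _ _ _ _ _ => r5
|x6, St _ _ _ _ _ _ r6 _ _ _ _ _ => r6
|x7, St _ _ _ _ _ _ _ r7 _ _ _ _ => r7
|x8, St _ _ _ _ _ _ _ _ r8 _ _ _ => r8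
|x9, St _ _ _ _ _ _ _ _ _ r9 _ _ => r9
|x10, St _ _ _ _ _ _ _ _ _ _ r10 _ => r10
|x11, St _ _ _ _ _ _ _ _ _ _ _ r11 => r11
end.
Definition upd (v : vtx) (f : row -> row) (s : state) : state := match v, s with
|x0, St r0 r1 r2 r3 r4 r5 r6 r7 r8 r9 r10 r11 => St (f r0) r1 r2 r3 r4 r5 r6 r7 r8 r9 r10 r11
|x1, St r0 r1 r2 r3 r4 r5 r6 r7 r8 r9 r10 r11 => St r0 (f r1) r2 r3 r4 r5 r6 r7 r8 r9 r10 r11
|x2, St r0 r1 r2 r3 r4 r5 r6 r7 r8 r9 r10 r11 => St r0 r1 (f r2) r3 r4 r5 r6 r7 r8 r9 r10 r11
|x3, St r0 r1 r2 r3 r4 r5 r6 r7 r8 r9 r10 r11 => St r0 r1 r2 (f r3) r4 r5 r6 r7 r8 r9 r10 r11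
|x4, St r0 r1 r2 r3 r4 r5 r6 r7 r8 r9 r10 r11 => St r0 r1 r2 r3 (f r4) r5 r6 r7 r8 r9 r10 r11
|x5, St r0 r1 r2 r3 r4 r5 r6 r7 r8 r9 r10 r11 => St r0 r1 r2 r3 r4 (f r5) r6 r7 r8 r9 r10 r11
|x6, St r0 r1 r2 r3 r4 r5 r6 r7 r8 r9 r10 r11 => St r0 r1 r2 r3 r4 r5 (f r6) r7 r8 r9 r10 r11
|x7, St r0 r1 r2 r3 r4 r5 r6 r7 r8 r9 r10 r11 => St r0 r1 r2 r3 r4 r5 r6 (f r7) r8 r9 r10 r11
|x8, St r0 r1 r2 r3 r4 r5 r6 r7 r8 r9 r10 r11 => St r0 r1 r2 r3 r4 r5 r6 r7 (f r8) r9 r10 r11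
|x9, St r0 r1 r2 r3 r4 r5 r6 r7 r8 r9 r10 r11 => St r0 r1 r2 r3 r4 r5 r6 r7 r8 (f r9) r10 r11
|x10, St r0 r1 r2 r3 r4 r5 r6 r7 r8 r9 r10 r11 => St r0 r1 r2 r3 r4 r5 r6 r7 r8 r9 (f r10) r11
|x11, St r0 r1 r2 r3 r4 r5 r6 r7 r8 r9 r10 r11 => St r0 r1 r2 r3 r4 r5 r6 r7 r8 r9 r10 (f r11)
end.

Definition nbh (u : vtx) (s : state) : vset := let: Row h _ := get u s in h.
Definition poss (u : vtx) (s : state) : vset := let: Row _ l := get u s in l.

(* a class of a partial colouring, with the union of the neighbourhoods of its members *)
Inductive cls := Cls of vset & vset.
(* The arguments are the fuel, whether a colouring was found, its score (the number of
   monochromatic undecided pairs), the best colouring, and the colourings of score 1. *)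
Inductive acc := Acc of nat & bool & digit & seq cls & seq (seq cls).
Inductive scan_result := Low | Tight of vtx & vset | Fine.
Inductive orow := ORow of vtx & vset & vset.

(** * The branching search on partially decided graphs *)

Section Engine.
Variables (k c : nat) (kd : digit) (two hv : bool) (avg smax : digit) (lim : nat) (leaf : state -> bool).
Variables (vs sb ob : seq vtx).

Definition set_edge (u v : vtx) (s : state) : state :=
  let u1 := vone u in let v1 := vone v in
  upd u (fun r => let: Row h l := r in Row (vor h v1) (vdiff l v1))
    (upd v (fun r => let: Row h l := r in Row (vor h u1) (vdiff l u1)) s).
Definition clr_edge (u v : vtx) (s : state) : state :=
  upd u (fun r => let: Row h l := r in Row h (vdiff l (vone v)))
    (upd v (fun r => let: Row h l := r in Row h (vdiff l (vone u))) s).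

(** Looks for a forbidden configuration through a new pair. [z], [a] and [b] are the common
    neighbours of the vertices chosen so far with both ends, with one end, and with the other.
    Either both ends lie in the clique and the tips in [z], or one end is itself a tip and the
    second tip is found in [a] or [b]. The bounds on cardinality could at worst overlook a
    violation, which would cost only time. *)
Fixpoint forb (s : state) (ys : seq vtx) (c : nat) (z a b : vset) {struct ys} : bool :=
  match c with
  | 0 => if two then if isz a then negb (isz b) else true else true
  | c'.+1 =>
    if ltd (pc z) (digit_of c) then false else
    if (match c' with 0 => if two then ltd d1 (pc z) else true | _ => false end) then true else
    match ys with [::] => false
    | y :: ys =>
      if vin y z then let h := nbh y s in
        if forb s ys c' (vand z h) (vand a h) (vand b h) then true else forb s ys c z a b
      else forb s ys c z a b
    end
  end.
(* whether joining vertices with neighbourhoods [hu], [hv] violates the clique condition *)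
Definition forbidden (hu hv : vset) (s : state) : bool :=
  let z := vand hu hv in
  match c.-1 with 0 => forb s [::] 0 z hu hv
  | c' => if ltd (pc z) (digit_of c') then false else forb s (vlist z) c' z hu hv end.

Fixpoint refilter (u : vtx) (vs : seq vtx) (s : state) : state :=
  match vs with [::] => s
  | v :: vs => refilter u vs (if forbidden (nbh u s) (nbh v s) s then clr_edge u v s else s) end.
Definition put_edge (u v : vtx) (s : state) : option state :=
  if forbidden (nbh u s) (nbh v s) s then None
  else let s := set_edge u v s in
    let s := refilter v (vlist (poss v s)) s in
    Some (refilter u (vlist (poss u s)) s).

Fixpoint heavy (s : state) (ys : seq vtx) (c : nat) (common : vset) (d : digit) {struct ys} : bool :=
  match c with 0 => ltd smax d | c'.+1 =>
  if isz common then false else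
  match ys with [::] => false
  | y :: ys =>
    if (if vin y common then let h := nbh y s in heavy s ys c' (vand common h) (pcand h h d) else false) then true
    else heavy s ys c common d
  end end.
(* a clique of degree sum above [smax] has a vertex of degree above the average of the seed *)
Fixpoint some_heavy (s : state) (ys : seq vtx) : bool :=
  match ys with [::] => false
  | y :: ys => let h := nbh y s in let d := pc h in
    if ltd avg d then if heavy s (vlist h) (size sb).-1 h d then true else some_heavy s ys
    else some_heavy s ys end.

Fixpoint add_edges (u : vtx) (vs : seq vtx) (s : state) : option state :=
  match vs with [::] => Some s
  | v :: vs => match put_edge u v s with None => None | Some s => add_edges u vs s end end.
(** Degrees in a critical graph are at least [k]: a vertex with exactly [k] possible neighbours
    takes all of them, and one with fewer refutes the state. *)
Fixpoint scan (s : state) (ys : seq vtx) : scan_result :=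
  match ys with [::] => Fine
  | y :: ys =>
    let: Row h l := get y s in
    let p := pcor h l in
    if ltd kd p then scan s ys
    else if ltd p kd then Low
    else if isz l then scan s ys else Tight y l end.
Fixpoint force (n : nat) (s : state) : option state :=
  match n with 0 => Some s
  | n'.+1 => match scan s vs with Low => None | Fine => Some s
    | Tight y l => match add_edges y (vlist l) s with None => None | Some s => force n' s end end end.

(** Score 0 stops the search by emptying the fuel. Score 1 sets the bound to 2, so that further
    colourings of score 1 are still collected: each has a single open pair and therefore forces an
    edge. *)
Definition finish (cs : seq cls) (s : digit) (a : acc) : acc :=
  let: Acc fuel found best bc us := a in
  match s with
  | d0 => Acc 0 true d0 cs us
  | d1 => Acc fuel true d2 cs (cs :: us)
  | _ => if (if found then ltd s best else true) then Acc fuel true s cs us else a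
  end.
(** Fuel is consumed only after some colouring has been found, so the first one is searched for
    exhaustively. The result is a proposal: [open_pairs] rechecks every colouring that is used. *)
Fixpoint colour (l : seq orow) (cs : seq cls) (free : nat) (s : digit) (a : acc) {struct l} : acc :=
  match l with
  | [::] => finish cs s a
  | ORow y h al :: t =>
    let fix tr (pre cs : seq cls) (a : acc) {struct cs} : acc :=
      match cs with
      | [::] => match free with 0 => a | fr.+1 =>
          match a with
          | Acc 0 true _ _ _ => a
          | Acc fuel.+1 true best bc us =>
            if ltd s best then colour t (Cls (vone y) h :: pre) fr s (Acc fuel true best bc us) else a
          | _ => colour t (Cls (vone y) h :: pre) fr s a
          end end
      | (Cls cl nb as cn) :: cs' =>
        if vin y nb then tr (cn :: pre) cs' a else
        match a with
        | Acc 0 true _ _ _ => a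
        | Acc fuel.+1 true best bc us =>
          if disj cl al then
            tr (cn :: pre) cs' (colour t (catrev pre (Cls (vor cl (vone y)) (vor nb h) :: cs')) free s (Acc fuel true best bc us))
          else let s' := pcand cl al s in
          if ltd s' best then
            tr (cn :: pre) cs' (colour t (catrev pre (Cls (vor cl (vone y)) (vor nb h) :: cs')) free s' (Acc fuel true best bc us))
          else tr (cn :: pre) cs' a
        | _ => tr (cn :: pre) cs' (colour t (catrev pre (Cls (vor cl (vone y)) (vor nb h) :: cs')) free (pcand cl al s) a)
        end
      end in tr [::] cs a
  end.

Fixpoint insert_row (p : digit) (x : orow) (l : seq (digit * orow)) : seq (digit * orow) :=
  match l with [::] => [:: (p, x)]
  | (q, y) :: t => if ltd q p then (p, x) :: l else (q, y) :: insert_row p x t end.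
Definition by_degree (s : state) : seq orow :=
  map snd (foldr (fun y t => let: Row h l := get y s in insert_row (pc h) (ORow y h l) t) [::] ob).
Definition colourings (s : state) : acc :=
  colour (by_degree s) (map (fun y => Cls (vone y) (nbh y s)) sb) (k - size sb) d0 (Acc lim false d0 [::] [::]).

Fixpoint class_of (y : vtx) (cs : seq cls) : option vset :=
  match cs with [::] => None | Cls cl _ :: t => if vin y cl then Some cl else class_of y t end.
Fixpoint mono (s : state) (cs : seq cls) (seen : vset) (ys : seq vtx) : option (seq (vtx * vtx)) :=
  match ys with [::] => Some [::]
  | y :: ys => match class_of y cs with None => None
    | Some cl => let: Row h l := get y s in
      if disj cl h then match mono s cs (vor seen (vone y)) ys with None => None
        | Some ps => if disj cl l then Some ps else Some (map (fun x => (x, y)) (vlist (vand (vand cl l) seen)) ++ ps) end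
      else None end end.
(** Returns the undecided pairs inside the classes of a proposed colouring. One of them must become
    an edge, since otherwise the colouring would be proper. *)
Definition open_pairs (cs : seq cls) (s : state) : option (seq (vtx * vtx)) :=
  if Nat.leb (size cs) k then mono s cs v0 vs else None.

(* [None] means that no graph of the class satisfies the conditions. *)
Fixpoint add_units (us : seq (seq cls)) (s : state) : option state :=
  match us with [::] => Some s
  | cs :: us => match open_pairs cs s with
    | Some [::] => None
    | Some [:: (u, v)] => match put_edge u v s with None => None | Some s => add_units us s end
    | _ => add_units us s end end.

Definition swappable (s : state) (u v : vtx) : bool :=
  let uv := vor (vone u) (vone v) in
  if veq (vor (nbh u s) uv) (vor (nbh v s) uv) then veq (vor (poss u s) uv) (vor (poss v s) uv) else false.
(** Each case shares a vertex between [p] and the pair of [i] and [j], and exchanges the other two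
    by a transposition that preserves the state. *)
Definition sym_pair (s : state) (i j : vtx) (p : vtx * vtx) : bool :=
  let: (a, b) := p in
  if (if vtxb a i then swappable s b j else false) then true else
  if (if vtxb b j then swappable s a i else false) then true else
  if (if vtxb a j then swappable s b i else false) then true else
  (if vtxb b i then swappable s a j else false).
Fixpoint insert_pair (p : digit) (x : vtx * vtx) (l : seq (digit * (vtx * vtx))) :=
  match l with [::] => [:: (p, x)]
  | (q, y) :: t => if ltd q p then (p, x) :: l else (q, y) :: insert_pair p x t end.
Definition by_weight (s : state) (ps : seq (vtx * vtx)) : seq (vtx * vtx) :=
  map snd (foldr (fun x l => let: (u, v) := x in insert_pair (addd (pc (nbh u s)) (pc (nbh v s))) x l) [::] ps).

Fixpoint branch (go : state -> bool) (s0 : state) (ps kept : seq (vtx * vtx)) (s : state) : bool :=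
  match ps with [::] => true
  | (u, v) :: ps =>
    let s := clr_edge u v s in
    if has (sym_pair s0 u v) kept then branch go s0 ps kept s
    else if (if put_edge u v s is Some s then go s else true) then branch go s0 ps ((u, v) :: kept) s else false end.

Fixpoint dfs (n : nat) (s : state) : bool :=
  match n with 0 => false | n'.+1 =>
  match force 12 s with None => true | Some s =>
  if (if hv then some_heavy s vs else false) then true else
  let: Acc _ found _ bc us := colourings s in
  if found then
    match us with
    | [::] => match open_pairs bc s with None => false | Some ps =>
        branch (dfs n') s (by_weight s ps) [::] s end
    | _ => match add_units us s with None => true | Some s => dfs n' s end
    end
  else leaf s end end.

End Engine.

(** * Generation of the seeds: a clique with its adjacencies to the other vertices *)

Section Seeds.
Variables (k c : nat) (two hv : bool) (lim mins maxs : nat) (dmin : digit) (leaf : state -> bool).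
Variables (sb ob : seq vtx).
Fixpoint types (l : seq vtx) : seq vset :=
  match l with [::] => [:: v0] | b :: l => let ts := types l in map (vor (vone b)) ts ++ ts end.
Definition good_types := filter (fun t => (mins <= value (pc t)) && (value (pc t) <= maxs)) (types sb).

Fixpoint incr_degs (t : vset) (l : seq vtx) (d : seq digit) : seq digit :=
  match l, d with b :: l, x :: d => (if vin b t then addd x d1 else x) :: incr_degs t l d | _, _ => [::] end.
(** Types come in the order of [types], so the columns before the first bit of the current type
    receive nothing more. Such a finished column must reach [dmin], and no later column may exceed
    it, because the seed clique is sorted by decreasing degree. *)
Fixpoint done_ok (t : vset) (l : seq vtx) (d : seq digit) : bool :=
  match l, d with
  | b :: l, x :: d => if vin b t then true else
      if ltd x dmin then false else if ~~ has (ltd x) d then done_ok t l d else false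
  | _, _ => true end.
Fixpoint code (t : vset) (l : seq vtx) (n : N) : N :=
  match l with [::] => n | b :: l => code t l (if vin b t then N.succ_double n else N.double n) end.
(** Squares are essential for breaking ties: the plain sum of the codes depends only on the column
    sums, so it would not change when two columns of equal sum are exchanged. *)
Definition weight (t : vset) : N := let n := code t sb 0 in N.mul n n.
Definition swapv (a b : vtx) (t : vset) : vset :=
  if vin a t then if vin b t then t else vor (vone b) (vdiff t (vone a))
  else if vin b t then vor (vone a) (vdiff t (vone b)) else t.
Definition total (ts : seq vset) : N := foldr (fun t s => N.add (weight t) s) 0%num ts.
Definition swap_ok (ts : seq vset) (a b : vtx) : bool :=
  N.leb (total (map (swapv a b) ts)) (total ts).
Fixpoint swaps_ok (ts : seq vset) (l : seq vtx) (d : seq digit) : bool :=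
  match l, d with
  | b :: l, x :: d =>
    (fix go l' d' := match l', d' with
       | b' :: l', x' :: d' => if eqd x x' then if swap_ok ts b b' then go l' d' else false else go l' d'
       | _, _ => true end) l d && swaps_ok ts l d
  | _, _ => true end.

Fixpoint col (b : vtx) (os : seq vtx) (ts : seq vset) : vset :=
  match os, ts with o :: os, t :: ts => if vin b t then vor (vone o) (col b os ts) else col b os ts | _, _ => v0 end.
Definition all_of (l : seq vtx) := foldr (fun v s => vor (vone v) s) v0 l.
Definition seed (ts : seq vset) : state :=
  let s := foldr (fun b s => upd b (fun=> Row (vor (vdiff (all_of sb) (vone b)) (col b ob ts)) v0) s)
    (St (Row v0 v0) (Row v0 v0) (Row v0 v0) (Row v0 v0) (Row v0 v0) (Row v0 v0) (Row v0 v0) (Row v0 v0) (Row v0 v0) (Row v0 v0) (Row v0 v0) (Row v0 v0)) sb in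
  foldr (fun p s => upd p.1 (fun=> Row p.2 (vdiff (all_of ob) (vone p.1))) s) s (zip ob ts).
Definition degree_sum (s : state) := foldr (fun y n => addd (pc (nbh y s)) n) d0 sb.
Definition run_seed (ts : seq vset) (d : seq digit) : bool :=
  if done_ok v0 sb d then if swaps_ok ts sb d then
    let s := seed ts in let n := degree_sum s in
    dfs k c (digit_of k) two hv (digit_of (value n %/ size sb)) n lim leaf (sb ++ ob) sb ob 99 s
  else true else true.

(** After choosing [t] the candidates still begin with [t], since several outer vertices may have
    the same type. Each multiset of types is thus met in one order only. *)
Fixpoint gen (left : nat) : seq vset -> seq vset -> seq digit -> bool :=
  match left with
  | 0 => fun _ ts d => run_seed ts d
  | left'.+1 => fix it cands ts d := match cands with [::] => true
    | t :: cands' => let d' := incr_degs t sb d in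
      if (if done_ok t sb d' then gen left' cands (t :: ts) d' else true) then it cands' ts d else false
    end end.
Definition search := gen (size ob) good_types [::] (nseq (size sb) d0).
End Seeds.

(** An outer vertex has degree at least [k] and at most [m - w - 1] outer neighbours, which bounds
    its seed neighbours from below. From above: joined to all of a maximum clique it would enlarge
    it, and joined to all but one vertex of the seed it would form a kite with that vertex when [c]
    is [w - 1]. A seed vertex has [w - 1] neighbours in the seed and needs the rest outside. *)
Definition task (m k c : nat) (two : bool) (w : nat) (hv : bool) (lim : nat) (leaf : state -> bool) : bool :=
  search k c two hv lim (k - (m - w).-1)
    (if two then if Nat.eqb c w.-1 then w.-2 else w else if Nat.eqb c w then w.-1 else w)
    (digit_of (k - w.-1)) leaf (take w vtxs) (take (m - w) (drop w vtxs)).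

(** * Meaning of the tables and of the search states *)

Lemma vnat_lt v : vnat v < 12. Proof. by case: v. Qed.
Definition vord (v : vtx) : 'I_12 := Ordinal (vnat_lt v).
Definition ordv (i : 'I_12) : vtx := nth x0 vtxs i.
Lemma vordK : cancel vord ordv. Proof. by case. Qed.
HB.instance Definition _ := Finite.copy vtx (can_type vordK).

Lemma vtxbE u v : vtxb u v = (u == v).
Proof.
have -> : (u == v) = (vnat u == vnat v) by [].
by case: u; case: v.
Qed.

Lemma all_digits (P : digit -> bool) : all P digits -> forall x, P x.
Proof. by move=> /=; do 64 (case/andP=> ?); move=> _; case. Qed.

(** Reduces every identity about a table to one evaluation over all 64 by 64 entries. *)
Lemma all_digits2 (P : digit -> digit -> bool) :
  all (fun x => all (P x) digits) digits -> forall x y, P x y.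
Proof. by move=> H x; apply/all_digits; move: x; apply: all_digits. Qed.

Definition bits (x : digit) : seq bool := [:: bit0 x; bit1 x; bit2 x; bit3 x; bit4 x; bit5 x].
Definition map_bits (f : bool -> bool -> bool) x y :=
  [seq f p.1 p.2 | p <- zip (bits x) (bits y)].
Definition ones (s : seq bool) : nat := count id s.

Lemma bits_and x y : bits (andd x y) = map_bits andb x y.
Proof. apply/eqP; move: x y; apply: all_digits2; vm_cast_no_check (erefl true). Qed.
Lemma bits_or x y : bits (orrd x y) = map_bits orb x y.
Proof. apply/eqP; move: x y; apply: all_digits2; vm_cast_no_check (erefl true). Qed.
Lemma bits_diff x y : bits (diffd x y) = map_bits (fun a b => a && ~~ b) x y.
Proof. apply/eqP; move: x y; apply: all_digits2; vm_cast_no_check (erefl true). Qed.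
Lemma disjdE x y : disjd x y = ~~ has id (map_bits andb x y).
Proof. apply/eqP; move: x y; apply: all_digits2; vm_cast_no_check (erefl true). Qed.
Lemma count_andE x y : value (count_and x y) = ones (map_bits andb x y).
Proof. apply/eqP; move: x y; apply: all_digits2; vm_cast_no_check (erefl true). Qed.
Lemma count_orE x y : value (count_or x y) = ones (map_bits orb x y).
Proof. apply/eqP; move: x y; apply: all_digits2; vm_cast_no_check (erefl true). Qed.
Lemma adddE x y : value (addd x y) = minn 63 (value x + value y).
Proof. apply/eqP; move: x y; apply: all_digits2; vm_cast_no_check (erefl true). Qed.
Lemma ltdE x y : ltd x y = (value x < value y).
Proof. apply/eqP; move: x y; apply: all_digits2; vm_cast_no_check (erefl true). Qed.
Lemma eqdE x y : eqd x y = (value x == value y).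
Proof. apply/eqP; move: x y; apply: all_digits2; vm_cast_no_check (erefl true). Qed.
Lemma carddE x : value (cardd x) = ones (bits x).
Proof. apply/eqP; move: x; apply: all_digits; vm_cast_no_check (erefl true). Qed.
Lemma digit_ofK n : n < 64 -> value (digit_of n) = n.
Proof.
have H : all (fun i => value (digit_of i) == i) (iota 0 64) by vm_cast_no_check (erefl true).
by move=> n64; apply/eqP/(allP H); rewrite mem_iota.
Qed.
Lemma valueK x : digit_of (value x) = x. Proof. by case: x. Qed.
Lemma value_inj : injective value. Proof. exact: can_inj valueK. Qed.

Lemma vin_and v x y : vin v (vand x y) = vin v x && vin v y.
Proof. by case: x y => [a b] [a' b']; case: (bits_and a a'); case: (bits_and b b'); case: v. Qed.
Lemma vin_or v x y : vin v (vor x y) = vin v x || vin v y.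
Proof. by case: x y => [a b] [a' b']; case: (bits_or a a'); case: (bits_or b b'); case: v. Qed.
Lemma vin_diff v x y : vin v (vdiff x y) = vin v x && ~~ vin v y.
Proof. by case: x y => [a b] [a' b']; case: (bits_diff a a'); case: (bits_diff b b'); case: v. Qed.
Lemma vin_one u v : vin u (vone v) = (u == v).
Proof. by rewrite -vtxbE; case: v; case: u. Qed.
Lemma vin0 v : vin v v0 = false. Proof. by case: v. Qed.
Lemma iszP x : isz x -> x = v0. Proof. by case: x => a b /=; case: a; case: b. Qed.
Lemma isz0P x : isz x = ~~ has (vin^~ x) vtxs.
Proof.
case: x => a b; have := @all_digits2 (fun a b => isz (VS a b) == ~~ has (vin^~ (VS a b)) vtxs).
by move=> H; apply/eqP; apply: H; vm_cast_no_check (erefl true).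
Qed.
Lemma mem_vtxs v : v \in vtxs. Proof. by case: v. Qed.
Lemma uniq_vtxs : uniq vtxs. Proof. by []. Qed.
Lemma iszN x : ~~ isz x -> exists v, vin v x.
Proof. by rewrite isz0P negbK => /hasP[v _]; exists v. Qed.
Lemma disjP x y v : disj x y -> vin v x -> ~~ vin v y.
Proof.
case: x y => [a b] [a' b'] /=; rewrite !disjdE.
case: ifP => // /norP[] h1 /norP[] h2 /norP[] h3 /norP[] h4 /norP[] h5 /norP[] h6 _.
move=> /norP[] g1 /norP[] g2 /norP[] g3 /norP[] g4 /norP[] g5 /norP[] g6 _.
by case: v => /= hv; rewrite ?hv in h1 h2 h3 h4 h5 h6 g1 g2 g3 g4 g5 g6 *.
Qed.
Lemma veqP x y : veq x y -> x = y.
Proof.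
case: x y => [a b] [a' b'] /=; rewrite !eqdE.
by case: ifP => // /eqP/value_inj -> /eqP/value_inj ->.
Qed.
Lemma mem_vlist v x : (v \in vlist x) = vin v x.
Proof.
case: x => a b; rewrite mem_cat.
have low d : lowlist d = [seq u <- take 6 vtxs | vin u (VS d d0)] by case: d.
have high d : highlist d = [seq u <- drop 6 vtxs | vin u (VS d0 d)] by case: d.
by rewrite low high !mem_filter; case: v => /=; rewrite ?andbT ?andbF ?orbF.
Qed.

Definition vcard (x : vset) : nat := count (vin^~ x) vtxs.
Lemma ones_le x : ones (bits x) <= 6. Proof. exact: (count_size id (bits x)). Qed.
Lemma pcE x : value (pc x) = vcard x.
Proof.
case: x => a b; rewrite /= adddE !carddE (minn_idPr _); last first.
  by have := ones_le a; have := ones_le b; lia.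
by rewrite /vcard /ones /=; lia.
Qed.
Lemma pcorE x y : value (pcor x y) = vcard (vor x y).
Proof.
have -> : value (pcor x y) = value (pc (vor x y)); last exact: pcE.
case: x y => [a b] [a' b']; rewrite /= !adddE !count_orE !carddE.
by rewrite !bits_or.
Qed.
Lemma pcandE x y n : value (pcand x y n) = minn 63 (value n + vcard (vand x y)).
Proof.
rewrite -pcE; case: x y => [a b] [a' b']; rewrite /= !adddE !count_andE !carddE.
by rewrite !bits_and.
Qed.

Lemma get_upd u v f s : get u (upd v f s) = if u == v then f (get v s) else get u s.
Proof. by rewrite -vtxbE; case: s => *; case: v; case: u. Qed.

Lemma vset_ext x y : (forall v, vin v x = vin v y) -> x = y.
Proof.
have low a b : bits a = bits b -> a = b by case: a; case: b.
case: x y => [a b] [a' b'] E; congr VS; apply: low.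
  by move: (E x0) (E x1) (E x2) (E x3) (E x4) (E x5) => /= *; congr [:: _; _; _; _; _; _].
by move: (E x6) (E x7) (E x8) (E x9) (E x10) (E x11) => /= *; congr [:: _; _; _; _; _; _].
Qed.

Lemma vset_eqP : Equality.axiom veq.
Proof.
move=> x y; apply: (iffP idP) => [/veqP //|<-].
by case: x => a b; rewrite /veq !eqdE !eqxx.
Qed.
HB.instance Definition _ := hasDecEq.Build vset vset_eqP.

Arguments andd : simpl never.
Arguments orrd : simpl never.
Arguments diffd : simpl never.
Arguments disjd : simpl never.
Arguments eqd : simpl never.
Arguments addd : simpl never.
Arguments ltd : simpl never.
Arguments pc : simpl never.
Arguments vin : simpl never.
Arguments isz : simpl never.
Arguments vand : simpl never.
Arguments pcand : simpl never.
Arguments pcor : simpl never.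
Arguments digit_of : simpl never.

Definition N (s : state) (u v : vtx) := vin v (nbh u s).
Definition L (s : state) (u v : vtx) := vin v (poss u s).

Record wf (vs : seq vtx) (s : state) : Prop := Wf {
  wf_N : symmetric (N s);
  wf_L : symmetric (L s);
  wf_NL : forall u v, L s u v -> ~~ N s u v;
  wf_irr : forall u v, L s u v -> u != v;
  wf_supp : forall u v, L s u v -> (u \in vs) && (v \in vs) }.

Definition fits (F : rel vtx) (s : state) := forall u v, (N s u v -> F u v) /\ (F u v -> N s u v || L s u v).

Lemma N_set u v s x y : u != v ->
  N (set_edge u v s) x y = N s x y || (x == u) && (y == v) || (x == v) && (y == u).
Proof.
move=> uv; rewrite /N /nbh /set_edge !get_upd.
case: (eqVneq x u) uv => [-> |xu] uv; last first.
  rewrite orbF; case: (eqVneq x v) => [->|xv]; last by rewrite orbF.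
  by case: (get v s) => h l; rewrite vin_or vin_one.
rewrite (negbTE uv) /= orbF; case: (get u s) => h l; by rewrite vin_or vin_one.
Qed.

Lemma L_set u v s x y : u != v ->
  L (set_edge u v s) x y = [&& L s x y, ~~ ((x == u) && (y == v)) & ~~ ((x == v) && (y == u))].
Proof.
move=> uv; rewrite /L /poss /set_edge !get_upd.
case: (eqVneq x u) uv => [-> |xu] uv; last first.
  case: (eqVneq x v) => [->|xv]; last by rewrite !andbT.
  by case: (get v s) => h l; rewrite vin_diff vin_one.
by rewrite (negbTE uv) /=; case: (get u s) => h l; rewrite vin_diff vin_one andbT.
Qed.

Lemma N_clr u v s x y : N (clr_edge u v s) x y = N s x y.
Proof.
rewrite /N /nbh /clr_edge !get_upd.
case: (eqVneq x u) => [-> |xu]; case: (eqVneq _ v) => [->|?] //; by case: (get _ s).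
Qed.

Lemma L_clr u v s x y : u != v ->
  L (clr_edge u v s) x y = [&& L s x y, ~~ ((x == u) && (y == v)) & ~~ ((x == v) && (y == u))].
Proof.
move=> uv; rewrite /L /poss /clr_edge !get_upd.
case: (eqVneq x u) uv => [-> |xu] uv; last first.
  case: (eqVneq x v) => [->|xv]; last by rewrite !andbT.
  by case: (get v s) => h l; rewrite vin_diff vin_one.
by rewrite (negbTE uv) /=; case: (get u s) => h l; rewrite vin_diff vin_one andbT.
Qed.

Lemma wf_set vs u v s : u != v -> wf vs s -> wf vs (set_edge u v s).
Proof.
move=> uv [sN sL NL irr supp]; split=> x y.
- by rewrite !N_set // sN -!orbA; congr (_ || _); rewrite orbC andbC [X in _ || X]andbC.
- by rewrite !L_set // sL; congr (_ && _); rewrite andbC andbC [(y == v) && _]andbC [(y == u) && _]andbC andbC.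
- by rewrite L_set // N_set // => /and3P[Lxy /negbTE-> /negbTE->]; rewrite !orbF NL.
- by rewrite L_set // => /and3P[/irr].
- by rewrite L_set // => /and3P[/supp].
Qed.

Lemma wf_clr vs u v s : u != v -> wf vs s -> wf vs (clr_edge u v s).
Proof.
move=> uv [sN sL NL irr supp]; split=> x y.
- by rewrite !N_clr sN.
- by rewrite !L_clr // sL; congr (_ && _); rewrite andbC andbC [(y == v) && _]andbC [(y == u) && _]andbC andbC.
- by rewrite L_clr // N_clr => /and3P[/NL].
- by rewrite L_clr // => /and3P[/irr].
- by rewrite L_clr // => /and3P[/supp].
Qed.

Lemma lebE m n : Nat.leb m n = (m <= n).
Proof. by elim: m n => [|m IH] [|n] //=; rewrite IH. Qed.

Lemma forbE two s y ys c' z a b : forb two s (y :: ys) c'.+1 z a b =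
  if ltd (pc z) (digit_of c'.+1) then false else
  if (match c' with 0 => if two then ltd d1 (pc z) else true | _ => false end) then true else
  if vin y z then
    if forb two s ys c' (vand z (nbh y s)) (vand a (nbh y s)) (vand b (nbh y s)) then true
    else forb two s ys c'.+1 z a b
  else forb two s ys c'.+1 z a b.
Proof. by []. Qed.

Lemma add1_pred n c : 0 < c -> n + 1 = c.-1 -> n.+2 = c.
Proof. by lia. Qed.

Lemma count_inj (t : vtx -> vtx) (P : pred vtx) : injective t ->
  count (fun x => P (t x)) vtxs = count P vtxs.
Proof.
move=> it; rewrite -[LHS]/(count (preim t P) vtxs) -count_map; apply/seq.permP.
apply: uniq_perm; rewrite ?map_inj_uniq ?uniq_vtxs // => x.
have [u _ uK] : bijective t by exact: injF_bij.
by rewrite mem_vtxs -[x]uK map_f ?mem_vtxs.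
Qed.

Lemma dfsS k c kd two hv avg smax lim leaf vs sb ob n s :
  dfs k c kd two hv avg smax lim leaf vs sb ob n.+1 s =
  match force c kd two vs 12 s with None => true | Some s =>
  if (if hv then some_heavy avg smax sb s vs else false) then true else
  let: Acc _ found _ bc us := colourings k lim sb ob s in
  if found then
    match us with
    | [::] => match open_pairs k vs bc s with None => false | Some ps =>
        branch c two (dfs k c kd two hv avg smax lim leaf vs sb ob n) s (by_weight s ps) [::] s end
    | _ => match add_units k c two vs us s with None => true
      | Some s => dfs k c kd two hv avg smax lim leaf vs sb ob n s end
    end
  else leaf s end.
Proof. by []. Qed.

(** * Soundness of the search *)

Section Sound.
Variables (k c : nat) (two hv : bool) (avg smax : digit) (lim : nat) (leaf : state -> bool).
Variables (vs sb ob : seq vtx).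
Let X : {set vtx} := [set v in vs].

(** With [two] this excludes a kite whose base has [c] vertices. Without it [x] and [y] may
    coincide, and what is excluded is a clique of [c + 1] vertices. *)
Definition clique_free (F : rel vtx) := forall (B : seq vtx) x y, size B = c ->
  pairwise F B -> all (F x) B -> all (F y) B -> (two -> x != y) -> False.

Definition degree (F : rel vtx) (v : vtx) := count (F v) vtxs.
Definition light (F : rel vtx) := forall B : seq vtx, size B = size sb -> pairwise F B ->
  \sum_(v <- B) degree F v <= value smax.

Record target (F : rel vtx) : Prop := Target {
  tg_sym : symmetric F;
  tg_irr : irreflexive F;
  tg_supp : forall u v, F u v -> (u \in vs) && (v \in vs);
  tg_noncol : ~ colorable F X k;
  tg_deg : forall v, v \in vs -> k <= degree F v;
  tg_edge : forall x y, F x y -> colorable (del_edge F x y) X k;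
  tg_clique : clique_free F;
  tg_light : hv -> light F }.

Variable Q : rel vtx -> Prop.
Hypothesis Qswap : forall F i j, i \in vs -> j \in vs -> Q (relpre (tperm i j) F) -> Q F.
Hypothesis leafP : forall s F, leaf s -> wf vs s -> target F -> fits F s -> Q F.

Hypothesis cpos : 0 < c.
Hypothesis k64 : k < 64.
Notation wf := (wf vs).

Section OneGraph.
Variable F : rel vtx.
Hypothesis tF : target F.
Let symF := tg_sym tF.
Let irrF := tg_irr tF.

Lemma fits_set u v s : u != v -> F u v -> fits F s -> fits F (set_edge u v s).
Proof.
move=> uv Fuv fs x y; have [NF FN] := fs x y; rewrite N_set // L_set //; split.
  case/orP=> [/orP[//|/andP[/eqP-> /eqP-> //]]|/andP[/eqP-> /eqP->]]; by rewrite // symF.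
move=> /FN; case: (N s x y) => //= ->; by case: (_ && _) => //=; case: (_ && _).
Qed.

Lemma fits_clr u v s : u != v -> ~~ F u v -> fits F s -> fits F (clr_edge u v s).
Proof.
move=> uv nF fs x y; have [NF FN] := fs x y; rewrite N_clr L_clr //; split=> // Fxy.
move: (FN Fxy); case: (N s x y) => //= ->; rewrite /=.
apply/andP; split; apply/negP=> /andP[/eqP E1 /eqP E2]; move: nF; rewrite -?E1 -?E2 ?Fxy //.
by rewrite symF Fxy.
Qed.

Lemma vcard2 z : 1 < vcard z -> exists w1 w2, [/\ w1 != w2, vin w1 z & vin w2 z].
Proof.
rewrite /vcard -size_filter; have := filter_uniq (vin^~ z) uniq_vtxs.
have H w : w \in [seq w <- vtxs | vin w z] -> vin w z by rewrite mem_filter => /andP[].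
case: [seq w <- vtxs | vin w z] H => [|w1 [|w2 l]] //= H /andP[]; rewrite inE negb_or => /andP[w12 _] _ _.
by exists w1, w2; split=> //; apply: H; rewrite !inE eqxx ?orbT.
Qed.

(** [B] is the part of the clique already chosen. In [base] one end completes [B] to [c] vertices
    and the other end is a tip; in [two_tips] both ends join [B], and the tips lie in [z]. Without
    [two] both cases produce a clique of [c + 1] vertices. *)
Lemma forbP s u v : subrel (N s) F -> F u v -> forall ys c0 (B : seq vtx) z a b,
  size B + c0 = c.-1 -> pairwise F B -> all (F u) B -> all (F v) B ->
  (forall w, vin w z -> [&& F u w, F v w & all (F w) B]) ->
  (forall w, vin w a -> [&& F u w, w != v & all (F w) B]) ->
  (forall w, vin w b -> [&& F v w, w != u & all (F w) B]) ->
  forb two s ys c0 z a b -> False.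
Proof.
move=> fs Fuv; have CF := tg_clique tF.
have base (B : seq vtx) a b : size B = c.-1 -> pairwise F B -> all (F u) B -> all (F v) B ->
  (forall w, vin w a -> [&& F u w, w != v & all (F w) B]) ->
  (forall w, vin w b -> [&& F v w, w != u & all (F w) B]) ->
  (if two then if isz a then negb (isz b) else true else true) -> False.
  move=> sB pB uB vB aP bP.
  have sc x : size (x :: B) = c by rewrite /= sB prednK.
  have pu : pairwise F (u :: B) by rewrite /= uB.
  have pv : pairwise F (v :: B) by rewrite /= vB.
  have vuB : all (F v) (u :: B) by rewrite /= vB symF Fuv.
  have uvB : all (F u) (v :: B) by rewrite /= uB Fuv.
  case: (boolP two) => [t|/negP t]; last by move=> _; apply: (CF _ _ _ (sc u) pu vuB vuB) => /t.
  case: ifPn => [_ /iszN[w /bP/and3P[vw wu wB]]|/iszN[w /aP/and3P[uw wv wB]] _].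
    by apply: (CF _ w u (sc v) pv _ uvB) => //=; rewrite wB symF vw.
  by apply: (CF _ w v (sc u) pu _ vuB) => //=; rewrite wB symF uw.
have two_tips (B : seq vtx) z (c' : nat) : size B + c'.+1 = c.-1 -> pairwise F B -> all (F u) B -> all (F v) B ->
  (forall w, vin w z -> [&& F u w, F v w & all (F w) B]) ->
  ltd (pc z) (digit_of c'.+1) = false ->
  (match c' with 0 => if two then ltd d1 (pc z) else true | _ => false end) = true -> False.
  case: c' => // sB pB uB vB zP; rewrite ltdE digit_ofK // pcE => z0.
  case: (boolP two) => [_|/negP t].
    rewrite ltdE pcE => /vcard2[w1 [w2 [w12 z1 z2]]].
    have /and3P[u1 v1 B1] := zP _ z1; have /and3P[u2 v2 B2] := zP _ z2.
    apply: (CF (u :: v :: B) w1 w2) => //=.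
    - exact: add1_pred sB.
    - by rewrite Fuv uB vB.
    - by rewrite symF u1 symF v1.
    - by rewrite symF u2 symF v2.
  have : has (vin^~ z) vtxs by rewrite has_count; move: z0; rewrite /vcard; lia.
  case/hasP=> w _ /zP/and3P[uw vw wB] _.
  have vuw : all (F v) (u :: w :: B) by rewrite /= symF Fuv vw.
  apply: (CF _ _ _ _ _ vuw vuw) => [||/t //].
    exact: add1_pred sB.
  by rewrite /= uw uB wB.
elim=> [|y ys IH] [|c'] B z a b sB pB uB vB zP aP bP.
- by apply: base aP bP => //; rewrite -sB addn0.
- by rewrite /forb; case: ifP => // z1; case: ifP => // E _; apply: (two_tips B z c').
- by apply: base aP bP => //; rewrite -sB addn0.
rewrite forbE; case: ifP => // z1; case: ifP => [E2 _|_]; first by apply: (two_tips B z c').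
case yz: (vin y z); last by apply: (IH c'.+1 B z a b).
case H: (forb two s ys c' _ _ _); last by apply: (IH c'.+1 B z a b).
move=> _.
have /and3P[uy vy By] := zP _ yz.
have hP w : vin w (nbh y s) -> F w y by move=> h; rewrite symF; apply: fs.
apply: (IH c' (y :: B) _ _ _ _ _ _ _ _ _ _ H); rewrite /= ?uy ?vy ?uB ?vB ?By ?pB //.
- by rewrite -sB addnS.
- by move=> w; rewrite vin_and => /andP[/zP/and3P[-> -> ->] /hP->].
- by move=> w; rewrite vin_and => /andP[/aP/and3P[-> -> ->] /hP->].
- by move=> w; rewrite vin_and => /andP[/bP/and3P[-> -> ->] /hP->].
Qed.

Lemma forbiddenP s u v : subrel (N s) F -> F u v -> ~~ N s u v -> ~~ N s v u ->
  forbidden c two (nbh u s) (nbh v s) s -> False.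
Proof.
move=> NF Fuv nuv nvu.
have uw w : vin w (nbh u s) -> F u w by exact: NF.
have vw w : vin w (nbh v s) -> F v w by exact: NF.
have P ys c0 : c0 = c.-1 -> forb two s ys c0 (vand (nbh u s) (nbh v s)) (nbh u s) (nbh v s) -> False.
  move=> cE; apply: (@forbP s u v NF Fuv ys c0 [::]) => // w.
  - by rewrite vin_and => /andP[/uw-> /vw->].
  - by move=> h; rewrite uw //= andbT; apply: contra nuv => /eqP <-.
  - by move=> h; rewrite vw //= andbT; apply: contra nvu => /eqP <-.
rewrite /forbidden; case cE: c.-1 => [|c']; first by apply: P; rewrite cE.
by case: ifP => // _; apply: P; rewrite cE.
Qed.

Lemma fitsN s : fits F s -> subrel (N s) F.
Proof. by move=> fs u v; apply: (fs u v).1. Qed.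

Lemma refilterP u ws s : u \notin ws -> (forall w, w \in ws -> ~~ N s u w) -> wf s -> fits F s ->
  [/\ wf (refilter c two u ws s), fits F (refilter c two u ws s) & forall x y, N (refilter c two u ws s) x y = N s x y].
Proof.
elim: ws s => [|w ws IH] s //=; rewrite inE negb_or => /andP[uw uws] nN ws_ fs.
case: ifP => fb; last by apply: IH => // v vws; apply: nN; rewrite inE vws orbT.
have nF : ~~ F u w.
  apply/negP=> Fuw; have nuw : ~~ N s u w by apply: nN; rewrite inE eqxx.
  by apply: (forbiddenP (fitsN fs) Fuw nuw _ fb); rewrite (wf_N ws_).
have [|||H1 H2 H3] := IH (clr_edge u w s) uws.
- by move=> v vws; rewrite N_clr; apply: nN; rewrite inE vws orbT.
- exact: wf_clr.
- exact: fits_clr.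
by split=> // x y; rewrite H3 N_clr.
Qed.

Lemma put_edgeP u v s : u != v -> ~~ N s u v -> wf s -> fits F (set_edge u v s) ->
  if put_edge c two u v s is Some s' then
    [/\ wf s', fits F s' & forall x y, N s' x y = N s x y || (x == u) && (y == v) || (x == v) && (y == u)]
  else False.
Proof.
move=> uv nuv wfs fs; rewrite /put_edge.
have Fuv : F u v by apply: (fitsN fs); rewrite N_set // !eqxx orbT.
have NF : subrel (N s) F by move=> x y h; apply: (fitsN fs); rewrite N_set // h.
case: ifP => [|_]; first by apply: (forbiddenP NF Fuv nuv); rewrite (wf_N wfs).
have wf1 := wf_set uv wfs.
set s1 := set_edge u v s in fs wf1 *.
have nP w s2 : wf s2 -> w \notin vlist (poss w s2).
  by move=> w2; rewrite mem_vlist; apply/negP=> /(wf_irr w2); rewrite eqxx.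
have nN w s2 y : wf s2 -> y \in vlist (poss w s2) -> ~~ N s2 w y.
  by move=> w2; rewrite mem_vlist => /(wf_NL w2).
have [wf2 f2 N2] := refilterP (nP v s1 wf1) (fun y => @nN v s1 y wf1) wf1 fs.
set s2 := refilter _ _ _ _ s1 in wf2 f2 N2 *.
have [wf3 f3 N3] := refilterP (nP u s2 wf2) (fun y => @nN u s2 y wf2) wf2 f2.
by split=> // x y; rewrite N3 N2 N_set.
Qed.

Lemma add_edgesP u ws s : uniq ws -> (forall w, w \in ws -> [&& F u w, u != w & ~~ N s u w]) ->
  wf s -> fits F s ->
  if add_edges c two u ws s is Some s' then wf s' /\ fits F s' else False.
Proof.
elim: ws s => [|w ws IH] s //= /andP[wws uws] P wfs fs.
have /and3P[Fuw uw nuw] : [&& F u w, u != w & ~~ N s u w] by apply: P; rewrite inE eqxx.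
have := put_edgeP uw nuw wfs (fits_set uw Fuw fs).
case: put_edge => // s' [wf' f' N']; apply: IH => // v vws.
have /and3P[-> uv nuv] : [&& F u v, u != v & ~~ N s u v] by apply: P; rewrite inE vws orbT.
rewrite uv N' eqxx (negbTE nuv) (negbTE uw) /= orbF.
by apply: contraNneq wws => <-.
Qed.

Lemma degree_le s v : fits F s -> degree F v <= vcard (vor (nbh v s) (poss v s)).
Proof. by move=> fs; apply: sub_count => w; rewrite vin_or => Fvw; apply: (fs v w).2. Qed.

Lemma tightP s v : fits F s -> v \in vs -> vcard (vor (nbh v s) (poss v s)) = k ->
  forall w, L s v w -> F v w.
Proof.
move=> fs vvs cE w Lvw; set p := vor _ _ in cE.
have sub : {subset [seq x <- vtxs | F v x] <= [seq x <- vtxs | vin x p]}.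
  by move=> x; rewrite !mem_filter mem_vtxs !andbT vin_or => /(fs v x).2.
have [|_ E] := uniq_min_size (filter_uniq _ uniq_vtxs) sub.
  by rewrite !size_filter -/(vcard p) cE; apply: tg_deg tF _ vvs.
by have := E w; rewrite !mem_filter mem_vtxs !andbT vin_or [vin w (poss v s)]Lvw orbT => ->.
Qed.

Lemma scanP s ys : {subset ys <= vs} -> fits F s ->
  match scan (digit_of k) s ys with
  | Low => False
  | Tight y l => [/\ y \in vs, l = poss y s & vcard (vor (nbh y s) (poss y s)) = k]
  | Fine => True end.
Proof.
elim: ys => [|y ys IH] //= sub fs.
have IH' := IH (fun x xys => sub x (mem_behead (s := y :: ys) xys)) fs.
have yvs : y \in vs by apply: sub; rewrite inE eqxx.
have rE : get y s = Row (nbh y s) (poss y s) by rewrite /nbh /poss; case: (get y s).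
rewrite rE !ltdE pcorE digit_ofK //; case: ltnP => // le1; case: ltnP => lt2.
  by have := leq_trans (tg_deg tF yvs) (degree_le y fs); rewrite leqNgt lt2.
by case: ifP => // _; split=> //; apply/eqP; rewrite eqn_leq le1 lt2.
Qed.

Lemma uniq_vlist x : uniq (vlist x).
Proof.
case: x => a b; have low d : lowlist d = [seq u <- take 6 vtxs | vin u (VS d d0)] by case: d.
have high d : highlist d = [seq u <- drop 6 vtxs | vin u (VS d0 d)] by case: d.
have ul : uniq (lowlist a) by rewrite low filter_uniq.
have uh : uniq (highlist b) by rewrite high filter_uniq.
rewrite /vlist cat_uniq ul uh andbT; apply/hasPn=> v.
rewrite low high ![in X in X -> _]mem_filter => /andP[_ h]; rewrite mem_filter; apply/negP=> /andP[_]; by case: v h.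
Qed.

Lemma forceP n s : wf s -> fits F s ->
  if force c (digit_of k) two vs n s is Some s' then wf s' /\ fits F s' else False.
Proof.
elim: n s => [|n IH] s //= wfs fs.
have := @scanP s vs (fun x h => h) fs; case: scan => // y l [yvs -> cE].
have P w : w \in vlist (poss y s) -> [&& F y w, y != w & ~~ N s y w].
  by rewrite mem_vlist => h; rewrite (tightP fs yvs cE h) (wf_irr wfs h) (wf_NL wfs h).
have := add_edgesP (uniq_vlist _) P wfs fs.
by case: add_edges => // s' [wf' f']; apply: IH.
Qed.

Lemma vcardN s v : fits F s -> vcard (nbh v s) <= degree F v.
Proof. by move=> fs; apply: sub_count => w; apply: (fitsN fs). Qed.

Lemma vandxx h : vand h h = h.
Proof. by case: h => a b; rewrite /vand; congr VS; [case: a | case: b]. Qed.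

(** The capped sum [d] never exceeds the degree sum of the clique [B] in [F], so exceeding [smax] is
    a genuine contradiction to [light]. *)
Lemma heavyP s ys c0 common d (B : seq vtx) : light F -> fits F s ->
  size B + c0 = size sb -> pairwise F B -> (forall w, vin w common -> all (F w) B) ->
  value d <= \sum_(v <- B) degree F v -> heavy smax s ys c0 common d -> False.
Proof.
move=> li fs; elim: ys c0 common d B => [|y ys IH] [|c0] common d B sB pB cB dB /=.
- by rewrite ltdE => lt; have := leq_trans dB (li B _ pB); rewrite -sB addn0 leqNgt lt => /(_ erefl).
- by case: ifP.
- by rewrite ltdE => lt; have := leq_trans dB (li B _ pB); rewrite -sB addn0 leqNgt lt => /(_ erefl).
case: ifP => // _; case yc: (vin y common); last exact: (IH c0.+1 common d B sB pB cB dB).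
case H: (heavy _ _ _ _ _ _); last exact: (IH c0.+1 common d B sB pB cB dB).
have yB := cB y yc; move=> _; apply: (IH _ _ _ (y :: B) _ _ _ _ H).
- by rewrite -sB addnS.
- by rewrite /= yB.
- by move=> w; rewrite vin_and => /andP[/cB wB Nyw]; rewrite /= wB andbT symF; apply: (fitsN fs).
- rewrite big_cons pcandE vandxx (leq_trans (geq_minr _ _)) // addnC leq_add //; exact: vcardN.
Qed.

Lemma some_heavyP s ys : 0 < size sb -> light F -> fits F s -> some_heavy avg smax sb s ys -> False.
Proof.
move=> sb0 li fs; elim: ys => //= y ys IH; case: ifP => // _.
case H: (heavy _ _ _ _ _ _) => // _; apply: (@heavyP s _ _ _ _ [:: y] li fs _ _ _ _ H) => //=.
- by rewrite add1n prednK.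
- by move=> w Nyw; rewrite andbT symF; apply: (fitsN fs).
- by rewrite big_seq1 pcE vcardN.
Qed.

Lemma monoP s cs seen ys ps : wf s -> mono s cs seen ys = Some ps ->
  (forall p, p \in ps -> L s p.1 p.2) /\
  forall y, y \in ys -> exists cl, [/\ class_of y cs = Some cl, disj cl (nbh y s) &
    forall x, vin x cl -> L s y x -> vin x seen || (index x ys < index y ys) -> (x, y) \in ps].
Proof.
move=> wfs; elim: ys seen ps => [|y ys IH] seen ps /=; first by move=> [<-].
case clE: (class_of y cs) => [cl|] //.
have rE : get y s = Row (nbh y s) (poss y s) by rewrite /nbh /poss; case: (get y s).
rewrite rE; case: ifP => // dj; case mE: (mono _ _ _ _) => [qs|] //.
have [Lqs Pqs] := IH _ _ mE.
set new := [seq (x, y) | x <- vlist (vand (vand cl (poss y s)) seen)] => psE.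
have memnew x : vin x cl -> L s y x -> vin x seen -> (x, y) \in new.
  by move=> h1 h2 h3; apply: map_f; rewrite mem_vlist !vin_and h1 [vin x (poss y s)]h2 h3.
have [pin [psub pnew]] : (forall p, p \in ps -> p \in new \/ p \in qs) /\ {subset qs <= ps} /\
    (forall x, vin x cl -> L s y x -> vin x seen -> (x, y) \in ps).
  move: psE; case: ifP => [dl|_] [<-].
    split=> [p|]; [by right | split=> // x h1 h2 _].
    by have := disjP dl h1; rewrite [vin x (poss y s)]h2.
  split=> [p|]; first by rewrite mem_cat => /orP[]; [left|right].
  split=> [p|x h1 h2 h3]; rewrite mem_cat; first by move=> ->; rewrite orbT.
  by rewrite memnew.
split=> [p /pin[/mapP[x]|/Lqs //]|z].
  by rewrite mem_vlist !vin_and => /andP[/andP[_ h] _] -> /=; rewrite (wf_L wfs).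
rewrite inE; case: (eqVneq z y) => [-> _|zy /= zys].
  by exists cl; split=> // x h1 h2; rewrite ltn0 orbF; apply: pnew.
have [cl' [cE' dj' P']] := Pqs z zys; exists cl'; split=> // x h1 h2.
move=> h3; apply: psub; apply: P' => //.
rewrite vin_or vin_one; case/orP: h3 => [->//|].
by case: (eqVneq y x) => _; rewrite ?orbT // ltnS => ->; rewrite orbT.
Qed.

Definition class_index y cs := find (fun a => let: Cls s _ := a in vin y s) cs.

Lemma class_ofP y cs cl : class_of y cs = Some cl ->
  [/\ class_index y cs < size cs, vin y cl &
    (let: Cls s _ := nth (Cls v0 v0) cs (class_index y cs) in s) = cl].
Proof.
elim: cs => //= -[a b] cs IH; rewrite /class_index /=; case: ifP => [ya [<-]|ya /IH[i1 i2 i3]] //.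
Qed.

(** If none of the listed pairs were an edge, sending each vertex to the position of its class would
    be a colouring of [F] with [k] colours. *)
Lemma open_pairsP cs s ps : wf s -> fits F s -> open_pairs k vs cs s = Some ps ->
  (forall p, p \in ps -> L s p.1 p.2) /\ exists2 p, p \in ps & F p.1 p.2.
Proof.
rewrite /open_pairs => wfs fs; rewrite lebE; case: leqP => // sk /(monoP wfs)[Lps P]; split=> //.
case: (boolP (has (fun p => F p.1 p.2) ps)) => [/hasP[p]|/hasPn no]; first by exists p.
case: (tg_noncol tF); exists (fun y => class_index y cs).
have inX y : (y \in X) = (y \in vs) by rewrite inE.
split=> [y|x y]; rewrite !inX => yvs.
  have [cl [cE _ _]] := P y yvs; rewrite (leq_trans _ sk) //.
  by have [] := class_ofP cE.
(* [mono] lists a pair when it meets the later of its two vertices. *)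
wlog lt : x y yvs / index x vs <= index y vs.
  move=> H zvs Fxy; case: (leqP (index x vs) (index y vs)) => h; first exact: H h zvs Fxy.
  by rewrite eq_sym; apply: (H y x) => //; [apply: ltnW | rewrite symF].
move=> zvs Fxy; apply/eqP=> E.
have xy : x != y by apply: contraTneq Fxy => ->; rewrite irrF.
have [cl [cE dj Py]] := P y zvs; have [cl' [cE' _ _]] := P x yvs.
have xcl : vin x cl.
  have [_ h1 h2] := class_ofP cE'; have [_ _ h3] := class_ofP cE.
  by rewrite -h3 -E h2.
have := (fs y x).2; rewrite symF => /(_ Fxy); rewrite /N (negbTE (disjP dj xcl)) /= => Lyx.
have /no : (x, y) \in ps.
  by apply: Py => //; rewrite ltn_neqAle lt andbT; apply/orP; right; apply: contra_neq xy => /index_inj; apply.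
by rewrite Fxy.
Qed.

Lemma add_unitsP us s : wf s -> fits F s ->
  if add_units k c two vs us s is Some s' then wf s' /\ fits F s' else False.
Proof.
elim: us s => [|cs us IH] s //= wfs fs.
case opE: (open_pairs _ _ _ _) => [ps|]; last exact: IH.
have [Lps [p pps Fp]] := open_pairsP wfs fs opE.
case: ps opE Lps pps => [|[u v] [|q ps]] opE Lps pps //; last exact: IH.
move: pps Fp; rewrite inE => /eqP-> /= Fuv; have Luv : L s u v by apply: (Lps (u, v)); rewrite inE eqxx.
have uv := wf_irr wfs Luv.
have := put_edgeP uv (wf_NL wfs Luv) wfs (fits_set uv Fuv fs).
by case: put_edge => // s' [wf' f' _]; apply: IH.
Qed.

End OneGraph.

Lemma target_comp (t t' : vtx -> vtx) F : cancel t t' -> cancel t' t -> (forall x, (t x \in vs) = (x \in vs)) ->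
  target F -> target (relpre t F).
Proof.
move=> tK tK' tvs [sF iF suppF ncF degF edgeF cliF liF]; have tI := can_inj tK.
have tX' x : (t' x \in X) = (x \in X) by rewrite !inE -tvs tK'.
have tX x : (t x \in X) = (x \in X) by rewrite !inE.
have degE B : \sum_(v <- B) degree (relpre t F) v = \sum_(v <- map t B) degree F v.
  rewrite big_map; apply: eq_bigr => v _; rewrite /degree.
  exact: (@count_inj t (F (t v))).
split.
- by move=> x y; apply: sF.
- by move=> x; apply: iF.
- by move=> x y /suppF; rewrite !tvs.
- case=> col [colk colF]; apply: ncF; exists (col \o t'); split=> [x xX|x y xX yX Fxy] /=.
    by apply: colk; rewrite tX'.
  by apply: colF; rewrite ?tX' //= !tK'.
- move=> v vvs; have := degF (t v); rewrite tvs => /(_ vvs); have := degE [:: v].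
  by rewrite /= !big_seq1 => ->.
- move=> x y /edgeF[col [colk colF]]; exists (col \o t); split=> [z zX|z w zX wX] /=.
    by apply: colk; rewrite tX.
  by move=> h; apply: colF; rewrite ?tX //; move: h; rewrite /del_edge !(inj_eq tI).
- move=> B x y sB pB xB yB xy; apply: (cliF (map t B) (t x) (t y)).
  + by rewrite size_map.
  + by rewrite pairwise_map.
  + by rewrite all_map.
  + by rewrite all_map.
  + by move=> /xy; rewrite (inj_eq tI).
- by move=> /liF li B sB pB; rewrite degE; apply: li; rewrite ?size_map ?pairwise_map.
Qed.

Lemma target_perm F i j : i \in vs -> j \in vs -> target F -> target (relpre (tperm i j) F).
Proof.
move=> ivs jvs; apply: (target_comp (t' := tperm i j)); [exact: tpermK | exact: tpermK |].
by move=> x; case: tpermP => [->|->|] //; rewrite ivs jvs.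
Qed.

Lemma tperm_rel (P : rel vtx) u v x y : symmetric P -> irreflexive P ->
  (forall w, w != u -> w != v -> P u w = P v w) -> P (tperm u v x) (tperm u v y) = P x y.
Proof.
move=> sP iP H; case: tpermP => [->|->|/eqP xu /eqP xv]; case: tpermP => [->|->|/eqP yu /eqP yv]; rewrite ?iP //.
- exact/esym/H.
- exact: H.
- by rewrite sP [RHS]sP; apply/esym/H.
- by rewrite sP [RHS]sP; apply: H.
Qed.

Lemma swappableP s u v F : swappable s u v -> u \in vs -> v \in vs -> wf s -> target F -> fits F s ->
  target (relpre (tperm u v) F) /\ fits (relpre (tperm u v) F) s.
Proof.
rewrite /swappable => sw uvs vvs wfs tF fs; split; first exact: target_perm.
have iN : irreflexive (N s).
  by move=> x; apply/negP=> /(fitsN fs); rewrite (tg_irr tF).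
have iL : irreflexive (L s).
  by move=> x; apply/negP=> /(wf_irr wfs); rewrite eqxx.
move: sw; case: ifP => // /veqP E1 /veqP E2.
have key z1 z2 w : vor z1 (vor (vone u) (vone v)) = vor z2 (vor (vone u) (vone v)) ->
  w != u -> w != v -> vin w z1 = vin w z2.
  by move=> E wu wv; have := congr1 (vin w) E; rewrite !vin_or !vin_one (negbTE wu) (negbTE wv) !orbF.
have tN x y : N s (tperm u v x) (tperm u v y) = N s x y.
  by apply: tperm_rel (wf_N wfs) iN _ => w; apply: key.
have tL x y : L s (tperm u v x) (tperm u v y) = L s x y.
  by apply: tperm_rel (wf_L wfs) iL _ => w; apply: key.
by move=> x y; have := fs (tperm u v x) (tperm u v y); rewrite tN tL.
Qed.

Lemma sym_pairP s i j p F : sym_pair s i j p -> L s i j -> L s p.1 p.2 -> wf s -> target F -> fits F s -> F i j ->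
  exists u v, [/\ (u \in vs) && (v \in vs), target (relpre (tperm u v) F), fits (relpre (tperm u v) F) s & relpre (tperm u v) F p.1 p.2].
Proof.
case: p => a b /= sp Lij Lab wfs tF fs Fij.
have ij := wf_irr wfs Lij; have ab := wf_irr wfs Lab.
have /andP[ivs jvs] := wf_supp wfs Lij; have /andP[avs bvs] := wf_supp wfs Lab.
have Fji : F j i by rewrite (tg_sym tF).
have fin u v : swappable s u v -> u \in vs -> v \in vs -> F (tperm u v a) (tperm u v b) -> exists u v,
    [/\ (u \in vs) && (v \in vs), target (relpre (tperm u v) F), fits (relpre (tperm u v) F) s & F (tperm u v a) (tperm u v b)].
  by move=> sw uvs vvs Fab; exists u, v; have [] := swappableP sw uvs vvs wfs tF fs; rewrite uvs.
have : [|| (a == i) && swappable s b j, (b == j) && swappable s a i, (a == j) && swappable s b i | (b == i) && swappable s a j].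
  move: sp; rewrite !vtxbE.
  move: (swappable s b j) (swappable s a i) (swappable s b i) (swappable s a j) (a == i) (b == j) (a == j) (b == i).
  by do 8 case.
have ji : j != i by rewrite eq_sym.
have ba : b != a by rewrite eq_sym.
case/or4P=> /andP[/eqP E sw]; apply: fin sw _ _ _ => //.
all: rewrite ?E in ab ba *; rewrite tpermL.
- by rewrite tpermD.
- by rewrite tpermD.
- by rewrite tpermD.
- by rewrite tpermD.
Qed.

Lemma mem_insert_pair (q : digit) (x y : vtx * vtx) l :
  (y \in map snd (insert_pair q x l)) = (y == x) || (y \in map snd l).
Proof.
elim: l => [|[r z] l IH] //=; case: ifP => _ //=; rewrite !inE IH.
by case: (y == z); rewrite ?orbT.
Qed.

Lemma mem_by_weight s ps : by_weight s ps =i ps.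
Proof.
rewrite /by_weight => y; elim: ps => [|[u v] ps IH] //=.
by rewrite mem_insert_pair inE IH.
Qed.

(** A graph fitting [s0] contains one of the pairs, and the case of a pair only has to handle graphs
    without the earlier ones. If a symmetry of [s0] maps an earlier explored pair to the current
    one, the relabelled graph contains the explored pair and is already settled. *)
Lemma branchP (go : state -> bool) s0 ps : wf s0 ->
  (forall s, go s -> wf s -> forall F, target F -> fits F s -> Q F) ->
  (forall p, p \in ps -> L s0 p.1 p.2) ->
  branch c two go s0 ps [::] s0 ->
  forall F, target F -> fits F s0 -> (exists2 p, p \in ps & F p.1 p.2) -> Q F.
Proof.
move=> wf0 goP Lps0 br.
pose good p := forall F, target F -> fits F s0 -> F p.1 p.2 -> Q F.
suff H : forall p, p \in ps -> good p by move=> F tF fF [p pps Fp]; apply: (H p).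
(* [done] collects all pairs passed so far, also those skipped by symmetry, and describes which
   graphs still fit [s]; [kept] collects the explored pairs, which serve as representatives. *)
have gen : forall kept (done : seq (vtx * vtx)) s, wf s ->
    (forall p, p \in kept -> good p /\ L s0 p.1 p.2) -> (forall p, p \in done -> good p) ->
    (forall F, target F -> fits F s0 -> (forall p, p \in done -> ~~ F p.1 p.2) -> fits F s) ->
    (forall x y, N s x y = N s0 x y) ->
    branch c two go s0 ps kept s -> forall p, p \in ps -> good p; last first.
  by apply: (gen [::] [::] s0) => //.
elim: ps Lps0 {br} => [|[u v] ps IH] Lps kept done s wfs keptP doneP fitP Ns /=; first by [].
have Luv : L s0 u v by apply: (Lps (u, v)); rewrite inE eqxx.
have uv := wf_irr wf0 Luv.
have Lps' p : p \in ps -> L s0 p.1 p.2 by move=> h; apply: Lps; rewrite inE h orbT.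
have fit' F : target F -> fits F s0 -> (forall p, p \in (u, v) :: done -> ~~ F p.1 p.2) -> fits F (clr_edge u v s).
  move=> tF fF no; apply: (fits_clr tF) => //; first by apply: (no (u, v)); rewrite inE eqxx.
  by apply: fitP => // p pd; apply: no; rewrite inE pd orbT.
have N' x y : N (clr_edge u v s) x y = N s0 x y by rewrite N_clr.
have next kept' : (forall p, p \in kept' -> good p /\ L s0 p.1 p.2) -> good (u, v) ->
    branch c two go s0 ps kept' (clr_edge u v s) -> forall p, p \in (u, v) :: ps -> good p.
  move=> kP guv br p; rewrite inE => /orP[/eqP->//|]; apply: (IH Lps' kept' ((u, v) :: done)) br p => //.
    exact: wf_clr.
  by move=> q; rewrite inE => /orP[/eqP->//|]; apply: doneP.
case: ifP => [/hasP[p pk sp]|_].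
  apply: next => // F tF fF Fuv; have [gp Lp] := keptP p pk.
  have [a [b [/andP[avs bvs] h1 h2 h3]]] := sym_pairP sp Luv Lp wf0 tF fF Fuv.
  by apply: (Qswap avs bvs); apply: gp.
case go1: (if _ is Some _ then _ else _) => //.
have guv : good (u, v).
  move=> F tF fF /= Fuv; case: (boolP (has (fun p => F p.1 p.2) done)) => [/hasP[p pd Fp]|/hasPn no].
    exact: doneP Fp.
  have fs := fitP F tF fF no.
  have fs' : fits F (set_edge u v (clr_edge u v s)).
    move=> x y; have [NF FN] := fs x y; rewrite N_set // L_set // N_clr L_clr //; split.
      by case/orP=> [/orP[//|/andP[/eqP-> /eqP-> //]]|/andP[/eqP-> /eqP->]]; rewrite // (tg_sym tF).
    move=> /FN; case: (N s x y) => //= ->; by case: (_ && _) => //=; case: (_ && _).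
  have nN : ~~ N (clr_edge u v s) u v by rewrite N' (wf_NL wf0 Luv).
  have := put_edgeP tF uv nN (wf_clr uv wfs) fs'; move: go1; case: put_edge => // s' gs' [wf' f' _].
  exact: goP gs' wf' F tF f'.
apply: next => // p; rewrite inE => /orP[/eqP->//|]; exact: keptP.
Qed.

Hypothesis sb0 : 0 < size sb.

Theorem dfsP n s : dfs k c (digit_of k) two hv avg smax lim leaf vs sb ob n s ->
  wf s -> forall F, target F -> fits F s -> Q F.
Proof.
elim: n s => [|n IH] s //; rewrite dfsS => H wfs F tF fF; move: H.
have := forceP tF 12 wfs fF; case: force => // s1 [wf1 f1].
case: ifP => [|_].
  by case: ifP => // hv1 sh; have := some_heavyP tF sb0 (tg_light tF hv1) f1 sh.
case: colourings => fuel found best bc us; case: found => [|lf]; last exact: leafP lf wf1 tF f1.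
case: us => [|u us].
  case opE: open_pairs => [ps|] // br.
  have [Lps [p pps Fp]] := open_pairsP tF wf1 f1 opE.
  apply: (branchP wf1 IH _ br tF f1) => [q|]; first by rewrite mem_by_weight; apply: Lps.
  by exists p; rewrite ?mem_by_weight.
have := add_unitsP tF (u :: us) wf1 f1; case: add_units => // s2 [wf2 f2] h; exact: IH h wf2 F tF f2.
Qed.

End Sound.

(** * Every target graph is reached by the generator *)

Fixpoint type_of (F : rel vtx) (o : vtx) (l : seq vtx) : vset :=
  match l with [::] => v0 | b :: l => if F o b then vor (vone b) (type_of F o l) else type_of F o l end.

Lemma vin_type_of F o l b : vin b (type_of F o l) = (b \in l) && F o b.
Proof.
elim: l => [|x l IH] /=; first by rewrite vin0.
rewrite inE; case: ifP => Fo; rewrite ?vin_or ?vin_one IH; first by case: (eqVneq b x) => [->|].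
by case: (eqVneq b x) => [->|] //=; rewrite Fo andbF.
Qed.

Lemma types_type_of F o l : type_of F o l \in types l.
Proof. by elim: l => [|b l IH] //=; rewrite mem_cat; case: ifP => _; rewrite ?IH ?orbT // map_f. Qed.

(* If the types are listed in the order of [types], a column that starts before the
   first bit of [t] has no bit in the types listed after [t]. *)
Fixpoint lead (l : seq vtx) (t u : vset) : bool :=
  match l with [::] => true | b :: l => if vin b t then true else if vin b u then false else lead l t u end.

Lemma lead_refl l t : lead l t t.
Proof. by elim: l => //= b l IH; case: ifP => // ->. Qed.

Lemma types_sub l t v : t \in types l -> vin v t -> v \in l.
Proof.
elim: l t => [|b l IH] t /=; first by rewrite inE => /eqP->; rewrite vin0.
rewrite mem_cat inE => /orP[/mapP[u ul ->]|tl]; last by move/(IH t tl) => ->; rewrite orbT.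
by rewrite vin_or vin_one => /orP[->//|/(IH u ul)->]; rewrite orbT.
Qed.

Lemma pairwise_types l : uniq l -> pairwise (lead l) (types l).
Proof.
elim: l => [|b l IH] //= /andP[bl /IH pl]; rewrite pairwise_cat; apply/and3P; split.
- apply/allrelP=> _ u /mapP[t _ ->] _ /=; by rewrite vin_or vin_one eqxx.
- rewrite pairwise_map; apply: sub_pairwise (pl) => t u _ /=; by rewrite vin_or vin_one eqxx.
- apply: (sub_in_pairwise (P := [in types l]) (r := lead l)) pl; last exact/allP.
  move=> t u tl ul /= h.
  have nb x : x \in types l -> vin b x = false by move=> xl; apply: contraNF bl => /(types_sub xl).
  by rewrite !nb.
Qed.

Section Coverage.
Variables (k c : nat) (two hv : bool) (lim mins maxs dm : nat) (leaf : state -> bool).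
Variables (sb ob : seq vtx).
Hypothesis dm64 : dm < 64.
Hypothesis usb : uniq sb.
Notation dmin := (digit_of dm).
Notation run_seed := (run_seed k c two hv lim dmin leaf sb ob).
Notation gen := (gen k c two hv lim dmin leaf sb ob).
Definition columns (ts : seq vset) (l : seq vtx) := [seq digit_of (count (vin b) ts) | b <- l].

Lemma incr_columns t ts l : size ts < 60 -> incr_degs t l (columns ts l) = columns (t :: ts) l.
Proof.
move=> s60; have c60 b : count (vin b) ts < 60 by apply: leq_ltn_trans (count_size _ _) s60.
elim: l => //= b l ->; congr (_ :: _); case: ifP => // _; apply: value_inj.
by rewrite adddE !digit_ofK /=; have := c60 b; lia.
Qed.

(** When the scan passes [b], the bits of [t] up to [b] are all absent, and by [lead] they are
    absent from [rest]. The current count of column [b] is therefore its final one. *)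
Lemma done_okP t ts rest l : size (ts ++ rest) < 60 -> all (lead l t) rest ->
  pairwise (fun b b' => count (vin b) (ts ++ rest) >= count (vin b') (ts ++ rest)) l ->
  (forall b, b \in l -> dm <= count (vin b) (ts ++ rest)) ->
  done_ok dmin t l (columns ts l).
Proof.
move=> s60; have c60 b : count (vin b) ts < 60.
  by apply: leq_ltn_trans (leq_trans (count_size _ _) _) s60; rewrite size_cat leq_addr.
elim: l => //= b l IH ld /andP[hb pl] ge; case: ifP => // bt.
have rb : count (vin b) rest = 0.
  apply/eqP; rewrite -leqn0 leqNgt -has_count; apply/hasPn => u ur.
  by have := allP ld u ur; rewrite bt; case: ifP.
rewrite ltdE !digit_ofK //; last by have := c60 b; lia.
have /= gb := ge b (mem_head _ _); rewrite count_cat rb addn0 in gb.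
rewrite ltnNge gb /= ifT.
  apply: IH => // [|b' h]; last by apply: ge; rewrite inE h orbT.
  by apply: sub_all ld => u /=; rewrite bt; case: ifP.
rewrite /columns has_map; apply/hasPn=> b' b'l /=; rewrite ltdE !digit_ofK; try by have := c60 b; have := c60 b'; lia.
by have := allP hb b' b'l; rewrite !count_cat rb -leqNgt; lia.
Qed.

Fixpoint chosen (ch cands : seq vset) : Prop :=
  match ch with [::] => True | t :: ch => exists pre post, cands = pre ++ t :: post /\ chosen ch (t :: post) end.
Fixpoint admissible (ch ts : seq vset) : Prop :=
  match ch with [::] => True | t :: ch => done_ok dmin t sb (columns (t :: ts) sb) /\ admissible ch (t :: ts) end.

Lemma genP ch cands ts : size ch + size ts < 50 -> chosen ch cands -> admissible ch ts ->
  gen (size ch) cands ts (columns ts sb) -> run_seed (rev ch ++ ts) (columns (rev ch ++ ts) sb).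
Proof.
elim: ch cands ts => [|t ch IH] cands ts s50 //=.
case=> pre [post [-> chP]] [ok ad]; elim: pre => [|u pre IHp] /=.
  rewrite incr_columns ?ok; last by move: s50 => /=; lia.
  case: ifP => // h _; rewrite rev_cons cat_rcons; apply: IH chP ad h.
  by move: s50 => /=; lia.
by case: ifP => // _; apply: IHp.
Qed.

Lemma chosen_sorted G ch n : path leq n [seq index t G | t <- ch] -> {subset ch <= G} -> chosen ch (drop n G).
Proof.
elim: ch n => //= t ch IH n /andP[nt pt] sub.
have tG : t \in G by apply: sub; rewrite inE eqxx.
have dE : drop (index t G) G = t :: drop (index t G).+1 G by rewrite (drop_nth v0) ?index_mem // nth_index.
exists (take (index t G - n) (drop n G)), (drop (index t G).+1 G); split.
  by rewrite -dE -{2}(subnK nt) -drop_drop cat_take_drop.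
by rewrite -dE; apply: IH => // u h; apply: sub; rewrite inE h orbT.
Qed.

Lemma admissibleP G ch ts : pairwise (lead sb) G -> sorted leq [seq index t G | t <- ch] -> {subset ch <= G} ->
  size (ch ++ ts) < 60 ->
  pairwise (fun b b' => count (vin b) (ch ++ ts) >= count (vin b') (ch ++ ts)) sb ->
  (forall b, b \in sb -> dm <= count (vin b) (ch ++ ts)) -> admissible ch ts.
Proof.
move=> pG; elim: ch ts => //= t ch IH ts st sub s60 pw ge.
have cE b : count (vin b) (ch ++ t :: ts) = count (vin b) (t :: ch ++ ts) by rewrite /= !count_cat /= addnCA.
have cE' b : count (vin b) ((t :: ts) ++ ch) = count (vin b) (t :: ch ++ ts).
  by rewrite /= !count_cat [count _ ts + _]addnC.
have tG : t \in G by apply: sub; rewrite inE eqxx.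
split.
  apply: (@done_okP t (t :: ts) ch) => [||| b /ge].
  - by move: s60; rewrite /= !size_cat addnC.
  - apply/allP=> u uch; have uG : u \in G by apply: sub; rewrite inE uch orbT.
    have : index t G <= index u G.
      by apply: (allP (order_path_min leq_trans st)); apply/mapP; exists u.
    rewrite leq_eqVlt => /orP[/eqP E|lt].
      by rewrite -(nth_index v0 uG) -E nth_index // lead_refl.
    have /(pairwiseP v0) := pG => /(_ (index t G) (index u G)); rewrite !inE !index_mem tG uG => /(_ isT isT lt).
    by rewrite !nth_index.
  - by apply: sub_pairwise pw => b b'; rewrite !cE'.
  - by rewrite cE'.
apply: IH => //.
- exact: path_sorted st.
- by move=> u h; apply: sub; rewrite inE h orbT.
- by move: s60; rewrite !size_cat /= addnS.
- by apply: sub_pairwise pw => b b'; rewrite !cE.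
- by move=> b /ge; rewrite cE.
Qed.

Lemma swaps_okP ts l : {in l &, forall b b', count (vin b) ts = count (vin b') ts -> swap_ok sb ts b b'} ->
  size ts < 60 -> swaps_ok sb ts l (columns ts l).
Proof.
move=> H s60; have c60 b : count (vin b) ts < 64 by apply: leq_ltn_trans (count_size _ _) _; lia.
elim: l H => //= b l IH H; apply/andP; split; last first.
  by apply: IH => x y xl yl; apply: H; rewrite inE ?xl ?yl orbT.
have : {subset l <= l} by [].
elim: {1 3 4}l => //= b' l' IHl sub.
have IHl' := IHl (fun x h => sub x (mem_behead (s := b' :: l') h)).
rewrite eqdE !digit_ofK //; case: eqP => // E; rewrite H //; rewrite ?inE ?eqxx //.
by rewrite sub ?orbT // inE eqxx.
Qed.

End Coverage.

Lemma total_sum sb ts : N.to_nat (total sb ts) = \sum_(t <- ts) N.to_nat (weight sb t).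
Proof. by elim: ts => [|t ts IH] /=; rewrite ?big_nil // big_cons -IH Nnat.N2Nat.inj_add. Qed.

Lemma swap_okP sb ts a b : \sum_(t <- map (swapv a b) ts) N.to_nat (weight sb t) <= \sum_(t <- ts) N.to_nat (weight sb t) ->
  swap_ok sb ts a b.
Proof. rewrite -!total_sum /swap_ok => /leP h; apply/N.leb_le; lia. Qed.

Lemma vin_swapv x a b t : vin x (swapv a b t) = vin (tperm a b x) t.
Proof.
rewrite /swapv; case: (eqVneq a b) => [->|ab].
  by rewrite tperm1 perm1; case h: (vin b t).
have ba : b != a by rewrite eq_sym.
case: tpermP => [->|->|/eqP xa /eqP xb].
all: case va: (vin a t); case vb: (vin b t); rewrite ?vin_or ?vin_diff ?vin_one ?va ?vb ?eqxx ?(negbTE ab) ?(negbTE ba) ?(negbTE xa) ?(negbTE xb) //=.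
all: by rewrite andbT.
Qed.

Lemma get_rows (f : vtx -> row) l s u :
  get u (foldr (fun b s => upd b (fun=> f b) s) s l) = if u \in l then f u else get u s.
Proof. by elim: l => //= b l IH; rewrite get_upd inE; case: (eqVneq u b) => [->|_] //=. Qed.

Lemma get_zip_rows (h : vtx -> vset) (f : vset -> vtx -> row) l s u :
  get u (foldr (fun p s => upd p.1 (fun=> f p.2 p.1) s) s (zip l (map h l))) = if u \in l then f (h u) u else get u s.
Proof. by elim: l => //= b l IH; rewrite get_upd inE; case: (eqVneq u b) => [->|_] //=. Qed.

Lemma vin_col b l h x : vin x (col b l (map h l)) = (x \in l) && vin b (h x).
Proof.
elim: l => [|y l IH] /=; first by rewrite vin0.
rewrite inE; case: ifP => hy; rewrite ?vin_or ?vin_one IH; first by case: (eqVneq x y) => [->|].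
by case: (eqVneq x y) => [->|] //=; rewrite hy andbF.
Qed.

Lemma vin_all_of l x : vin x (all_of l) = (x \in l).
Proof. by elim: l => [|y l IH] /=; rewrite ?vin0 // vin_or vin_one inE IH. Qed.

Lemma pairwise_clique (F : rel vtx) l u v : symmetric F -> pairwise F l -> u \in l -> v \in l -> u != v -> F u v.
Proof.
move=> sF; elim: l => //= x l IH /andP[xl pl]; rewrite !inE => /orP[/eqP->|ul] /orP[/eqP->|vl] uv.
- by rewrite eqxx in uv.
- exact: (allP xl).
- by rewrite sF; apply: (allP xl).
- exact: IH.
Qed.

Lemma clique_uniq (F : rel vtx) l : irreflexive F -> pairwise F l -> uniq l.
Proof.
move=> iF; elim: l => //= x l IH /andP[xl /IH->]; rewrite andbT.
by apply/negP=> /(allP xl); rewrite iF.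
Qed.

Section Run.
Variables (k c : nat) (two hv : bool) (lim dm : nat) (leaf : state -> bool) (sb ob : seq vtx).
Variable Q : rel vtx -> Prop.
Notation vs := (sb ++ ob).
Hypothesis uvs : uniq vs.
Hypothesis sb0 : 0 < size sb.
Hypothesis cpos : 0 < c.
Hypothesis k64 : k < 64.
Hypothesis hv63 : hv -> size sb * 12 <= 63.
Hypothesis Qswap : forall F i j, i \in vs -> j \in vs -> Q (relpre (tperm i j) F) -> Q F.
Hypothesis leafP : forall smax s F, leaf s -> wf vs s -> target k c two hv smax vs sb F -> fits F s -> Q F.
Notation goal smax := (target k c two hv smax vs sb).

Variable F : rel vtx.
Hypothesis symF : symmetric F.
Hypothesis irrF : irreflexive F.
Hypothesis suppF : forall u v, F u v -> (u \in vs) && (v \in vs).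
Hypothesis clF : pairwise F sb.
Hypothesis lightF : hv -> forall B : seq vtx, size B = size sb -> pairwise F B ->
  \sum_(v <- B) degree F v <= \sum_(v <- sb) degree F v.
Hypothesis coreF : forall smax, (hv -> light smax sb F) -> goal smax F.

Let ts := [seq type_of F o sb | o <- ob].
Let s := seed sb ob ts.
Let disj_so u : u \in sb -> u \in ob = false.
Proof. by move=> us; have := uvs; rewrite cat_uniq => /and3P[_ /hasPn h _]; apply/negP=> /h; rewrite us. Qed.

Lemma get_seed u : get u s = if u \in ob then Row (type_of F u sb) (vdiff (all_of ob) (vone u))
  else if u \in sb then Row (vor (vdiff (all_of sb) (vone u)) (col u ob ts)) v0 else Row v0 v0.
Proof.
rewrite /s /seed (get_zip_rows _ (fun a b => Row a (vdiff (all_of ob) (vone b)))); case: ifP => // _.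
by rewrite (get_rows (fun b => Row (vor (vdiff (all_of sb) (vone b)) (col b ob ts)) v0)); case: ifP => // _; case: u.
Qed.

Lemma N_seed u v : N s u v = F u v && ((u \in sb) || (v \in sb)).
Proof.
rewrite /N /nbh get_seed; case: ifP => uo.
  rewrite vin_type_of andbC; congr (_ && _).
  by case us: (u \in sb) => //; rewrite disj_so in uo.
case: ifP => us /=; last first.
  by rewrite vin0; apply/esym/negP=> /andP[/suppF]; rewrite mem_cat us uo.
rewrite andbT vin_or vin_diff vin_all_of vin_one vin_col vin_type_of us /=.
apply/orP/idP => [[/andP[vs_ vu]|/andP[_]]|Fuv]; first by apply: pairwise_clique clF _ _ _; rewrite // eq_sym.
  by rewrite symF.
have /andP[_] := suppF Fuv; rewrite mem_cat => /orP[h|h]; [left|right].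
  by rewrite h; apply: contraTneq Fuv => ->; rewrite irrF.
by rewrite h symF.
Qed.

Lemma L_seed u v : L s u v = [&& u \in ob, v \in ob & u != v].
Proof.
rewrite /L /poss get_seed; case: ifP => uo /=; first by rewrite vin_diff vin_all_of vin_one [v == u]eq_sym.
by case: ifP => _; rewrite vin0.
Qed.

Lemma wf_seed : wf vs s.
Proof.
split=> [u v|u v|u v|u v|u v].
- by rewrite !N_seed symF orbC.
- by rewrite !L_seed eq_sym; case: (u \in ob); case: (v \in ob).
- rewrite L_seed N_seed => /and3P[uo vo uv]; apply/negP=> /andP[_ /orP[]] /disj_so; by rewrite ?uo ?vo.
- by rewrite L_seed => /and3P[].
- by rewrite L_seed !mem_cat => /and3P[-> ->]; rewrite !orbT.
Qed.

Lemma fits_seed : fits F s.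
Proof.
move=> u v; rewrite N_seed L_seed; split=> [/andP[]//|Fuv].
have /andP[] := suppF Fuv; rewrite !mem_cat Fuv /=.
case: (u \in sb) => //= uo; case: (v \in sb) => //= vo; rewrite uo vo /=.
by apply: contraTneq Fuv => ->; rewrite irrF.
Qed.

Lemma degree_sumE : value (degree_sum sb s) = minn 63 (\sum_(v <- sb) degree F v).
Proof.
rewrite /degree_sum; have : {subset sb <= sb} by [].
elim: {1 3 4}sb => [|y l IH] sub; first by rewrite big_nil.
rewrite big_cons /= adddE IH; last by move=> x h; apply: sub; rewrite inE h orbT.
rewrite pcE; have -> : vcard (nbh y s) = degree F y.
  apply: eq_count => v; rewrite -/(N s y v) N_seed (sub y) ?andbT //.
  by rewrite inE eqxx.
by lia.
Qed.

Lemma run_seedP : done_ok (digit_of dm) v0 sb (columns ts sb) -> swaps_ok sb ts sb (columns ts sb) ->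
  run_seed k c two hv lim (digit_of dm) leaf sb ob ts (columns ts sb) -> Q F.
Proof.
rewrite /run_seed => -> -> h.
have tF : goal (degree_sum sb s) F.
  apply: coreF => hh B sB pB; rewrite degree_sumE (leq_trans (lightF hh sB pB)) // leq_min leqnn andbT.
  (* Each degree is at most 12, so the degree sum of the seed stays within the cap of 63 and was
     computed exactly. *)
  apply: leq_trans (hv63 hh); rewrite -[X in _ <= X * _]sum1_size big_distrl /=.
  by apply: leq_sum => v _; rewrite mul1n (leq_trans (count_size _ _)).
exact: (dfsP Qswap (leafP (smax := _)) cpos k64 sb0 h wf_seed tF fits_seed).
Qed.
End Run.

Lemma count_support (p : pred vtx) (vs : seq vtx) : uniq vs -> (forall v, p v -> v \in vs) ->
  count p vtxs = count p vs.
Proof.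
move=> uv sub; rewrite -!size_filter; apply/perm_size/uniq_perm; rewrite ?filter_uniq ?uniq_vtxs // => v.
by rewrite !mem_filter mem_vtxs andbT; case pv: (p v) => //=; rewrite sub.
Qed.

Lemma clique_pairwise (F : rel vtx) l : uniq l -> {in l &, forall u v, u != v -> F u v} -> pairwise F l.
Proof.
elim: l => //= x l IH /andP[xl ul] H; rewrite IH // ?andbT => [|u v ul' vl]; last first.
  by apply: H; rewrite inE ?ul' ?vl orbT.
by apply/allP=> y yl; apply: H; rewrite ?inE ?eqxx ?yl ?orbT //; apply: contraNneq xl => ->.
Qed.

Lemma clique_sub (F : rel vtx) (X : seq vtx) l : 1 < size l -> pairwise F l ->
  (forall u v, F u v -> (u \in X) && (v \in X)) -> {subset l <= X}.
Proof.
case: l => [|x [|y l]] //= _ /andP[/andP[xy xl] _] sup z; rewrite inE => /orP[/eqP->|].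
  by case/andP: (sup _ _ xy).
by rewrite inE => /orP[/eqP->|/(allP xl) /sup/andP[]//]; case/andP: (sup _ _ xy).
Qed.

(** * The extremal labelling *)

Section Master.
Variables (k c : nat) (two hv : bool) (lim mins maxs : nat) (leaf : state -> bool) (sb ob : seq vtx).
Variable Q : rel vtx -> Prop.
Notation vs := (sb ++ ob).
Notation w := (size sb).
Notation dm := (k - w.-1).
Hypothesis uvs : uniq vs.
Hypothesis sb1 : 1 < w.
Let sb0 : 0 < w := ltnW sb1.
Hypothesis cpos : 0 < c.
Hypothesis k60 : k < 50.
Hypothesis hv63 : hv -> w * 12 <= 63.
Hypothesis Qperm : forall F (p : {perm vtx}), (forall v, (p v \in vs) = (v \in vs)) -> Q (relpre p F) -> Q F.
Hypothesis leafP : forall smax s F, leaf s -> wf vs s -> target k c two hv smax vs sb F -> fits F s -> Q F.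
(** Lightness is left out here because it holds only after the seed has been chosen with maximal
    degree sum. *)
Let core F := target k c two false d0 vs sb F.
Hypothesis bounds : forall F o, core F -> pairwise F sb -> o \in ob -> mins <= count (F o) sb <= maxs.

Lemma core_target F smax : core F -> (hv -> light smax sb F) -> target k c two hv smax vs sb F.
Proof. by case=> *; split. Qed.

(** Among the cliques of size [w], listed by decreasing degree, take one of largest degree sum and,
    among those, of largest total weight of types. Labelling it by [sb] and the remaining vertices
    in the order of their types makes every pruning test of the generator succeed. *)
Theorem searchP F (S : seq vtx) : core F -> size S = w -> pairwise F S -> {subset S <= vs} ->
  search k c two hv lim mins maxs (digit_of dm) leaf sb ob -> Q F.
Proof.
move=> cF sS pS Svs run; have symF := tg_sym cF; have irrF := tg_irr cF.
have usb : uniq sb by have := uvs; rewrite cat_uniq => /and3P[].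
have uob : uniq ob by have := uvs; rewrite cat_uniq => /and3P[].
have dis v : v \in sb -> v \in ob = false.
  by move=> us; have := uvs; rewrite cat_uniq => /and3P[_ /hasPn h _]; apply/negP=> /h; rewrite us.
have degE G v : core G -> degree G v = count (G v) sb + count (G v) ob.
  by move=> cG; rewrite /degree -count_cat; apply: count_support => // u /(tg_supp cG)/andP[].
pose dge x y := degree F y <= degree F x.
(* Types refer to positions in the clique rather than to its vertices, so that they can be compared
   between different cliques. *)
pose tyL (l : seq vtx) o := type_of (fun _ b => F o (nth x0 l (index b sb))) o sb.
pose D (t : w.-tuple vtx) := \sum_(v <- t) degree F v.
pose TT (t : w.-tuple vtx) := \sum_(o <- [seq v <- vs | v \notin tval t]) N.to_nat (weight sb (tyL t o)).
pose P (t : w.-tuple vtx) := [&& all [in vs] t, pairwise F t & pairwise dge t].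
have Psort (B : seq vtx) : size B = w -> pairwise F B -> {subset B <= vs} ->
    exists2 t : w.-tuple vtx, P t & perm_eq t B.
  move=> sB pB Bvs; have st : size (sort dge B) == w by rewrite size_sort sB.
  exists (Tuple st); last by rewrite /= perm_sort.
  apply/and3P; split => /=.
  - by apply/allP=> v; rewrite mem_sort => /Bvs.
  - apply: clique_pairwise; first by rewrite sort_uniq (clique_uniq irrF pB).
    by move=> u v; rewrite !mem_sort; apply: pairwise_clique.
  - rewrite -sorted_pairwise; first by apply: sort_sorted => x y; apply: leq_total.
    by move=> y x z; rewrite /dge => h1 h2; apply: leq_trans h2 h1.
have [t0 Pt0 _] := Psort S sS pS Svs.
case: (arg_maxnP D Pt0) => t1 Pt1 maxD.
have P1 : P t1 && (D t1 == D t1) by rewrite Pt1 eqxx.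
case: (@arg_maxnP _ t1 (fun t => P t && (D t == D t1)) TT P1) => t /andP[Pt /eqP Dt] maxT.
have {maxD}maxD t' : P t' -> D t' <= D t by rewrite Dt; apply: maxD.
have {maxT}maxT t' : P t' -> D t' = D t -> TT t' <= TT t by move=> p1 p2; apply: maxT; rewrite p1 p2 Dt eqxx.
have /and3P[/allP tvs pt dt] := Pt.
have ut : uniq t := clique_uniq irrF pt.
pose G := good_types mins maxs sb.
pose O := [seq v <- vs | v \notin tval t].
pose ole x y := index (tyL t x) G <= index (tyL t y) G.
(* Reversed because the generator puts each new type in front of the previous ones. *)
pose LO := rev (sort ole O).
have pLO : perm_eq LO O by rewrite /LO perm_rev perm_sort.
have pL : perm_eq (t ++ LO) vs.
  apply: (@perm_trans _ (t ++ O)); first by rewrite perm_cat2l.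
  apply: uniq_perm => // [|v].
    rewrite cat_uniq ut filter_uniq // andbT /=; apply/hasPn=> v; by rewrite mem_filter => /andP[].
  rewrite mem_cat mem_filter; case vt: (v \in tval t) => //=; by rewrite tvs.
have sL : size (t ++ LO) = size vs by apply: perm_size.
have uL : uniq (t ++ LO) by rewrite (perm_uniq pL).
have mL v : (v \in t ++ LO) = (v \in vs) by rewrite (perm_mem pL).
pose f v := if v \in vs then nth x0 (t ++ LO) (index v vs) else v.
have fvs v : (f v \in vs) = (v \in vs).
  rewrite /f; case: ifP => [vv|->] //; by rewrite -mL mem_nth // sL index_mem.
have fI : injective f.
  move=> u v E; have uv : (u \in vs) = (v \in vs) by rewrite -(fvs u) -(fvs v) E.
  move: E; rewrite /f uv; case: ifP => // vv; have uu : u \in vs by rewrite uv.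
  move/eqP; rewrite nth_uniq ?sL ?index_mem // => /eqP E.
  by rewrite -(nth_index x0 uu) E nth_index.
pose p := perm fI.
have pE v : p v = f v by rewrite permE.
have mapf : map f vs = t ++ LO.
  apply: (@eq_from_nth _ x0); rewrite ?size_map ?sL // => i iv.
  by rewrite (nth_map x0) // /f mem_nth // index_uniq.
have mapt : map f sb = t.
  have := congr1 (take w) mapf; rewrite map_cat take_size_cat ?size_map //.
  by rewrite take_size_cat // size_tuple.
have mapo : map f ob = LO.
  have := congr1 (drop w) mapf; rewrite map_cat drop_size_cat ?size_map //.
  by rewrite drop_size_cat // size_tuple.
have fsb b : b \in sb -> f b = nth x0 t (index b sb).
  by move=> bs; rewrite -mapt (nth_map x0) ?index_mem // nth_index.
pose F' := relpre f F.
apply: (@Qperm F p) => [v|]; first by rewrite pE fvs.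
have -> : Q (relpre p F) = Q F'.
  by congr Q; apply: boolp.funext => x; apply: boolp.funext => y; rewrite /F' /= !pE.
have [f' fK f'K] := injF_bij fI.
have cF' : core F' by apply: (target_comp fK f'K fvs).
have degf v : degree F' v = degree F (f v).
  by rewrite /degree -(count_inj (F (f v)) fI).
have clF' : pairwise F' sb by rewrite -(pairwise_map f) mapt.
have tyE o : o \in ob -> type_of F' o sb = tyL t (f o).
  move=> oo; apply: vset_ext => b; rewrite /tyL !vin_type_of; case bs: (b \in sb) => //=.
  by rewrite -fsb.
pose ts := [seq type_of F' o sb | o <- ob].
have tsE : ts = map (tyL t) LO.
  by rewrite -mapo -map_comp; apply/eq_in_map => o oo; rewrite /= tyE.
have cntb b : b \in sb -> count (vin b) ts = count (F' b) ob.
  by move=> bs; rewrite count_map; apply: eq_count => o /=; rewrite vin_type_of bs /F' /= symF.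
have clq b : b \in sb -> count (F' b) sb = w.-1.
  move=> bs; rewrite -[w](count_predC (pred1 b)) (@eq_in_count _ (F' b) (predC (pred1 b))).
    by rewrite count_uniq_mem // bs.
  move=> u us /=; apply/idP/idP => [h|ub]; first by apply: contraTneq h => ->; rewrite ?/F' /= irrF.
  by apply: (pairwise_clique (tg_sym cF') clF') => //; rewrite eq_sym.
have degb b : b \in sb -> degree F' b = w.-1 + count (vin b) ts.
  by move=> bs; rewrite degE // clq // cntb.
have sob : size ts < 20.
  rewrite size_map; apply: leq_ltn_trans (uniq_leq_size uob (s2 := vtxs) _) _ => // v _; exact: mem_vtxs.
have dmb b : b \in sb -> dm <= count (vin b) ts.
  by move=> bs; rewrite leq_subLR -degb //; apply: (tg_deg cF'); rewrite mem_cat bs.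
have pwd : pairwise (fun b b' => count (vin b') ts <= count (vin b) ts) sb.
  have : pairwise (fun b b' => degree F' b' <= degree F' b) sb.
    have := dt; rewrite -mapt pairwise_map; apply: sub_pairwise => x y; by rewrite /dge /= !degf.
  move=> pwd'; apply: (sub_in_pairwise (P := [in sb]) (r := fun b b' => degree F' b' <= degree F' b)) pwd'; last exact/allP.
  by move=> x y xs ys; rewrite !degb // leq_add2l.
have GP : pairwise (lead sb) G by apply: pairwise_filter; apply: pairwise_types.
have tsG : {subset ts <= G}.
  move=> z /mapP[o oo ->]; rewrite mem_filter types_type_of andbT pcE.
  have -> : vcard (type_of F' o sb) = count (F' o) sb; last exact: (bounds cF' clF' oo).
  transitivity (count (fun b => (b \in sb) && F' o b) vtxs); first by apply: eq_count => b; rewrite vin_type_of.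
  rewrite (count_support usb) => [|v /andP[]//]; apply: eq_in_count => b bs; by rewrite bs.
pose ch := rev ts.
have chE : ch = map (tyL t) (sort ole O) by rewrite /ch tsE -map_rev revK.
have st : sorted leq [seq index x G | x <- ch].
  rewrite chE -map_comp sorted_map; apply: (@sort_sorted _ ole) => x y; exact: leq_total.
have chG : {subset ch <= G} by move=> x; rewrite mem_rev; apply: tsG.
have cnt_rev b : count (vin b) (ch ++ [::]) = count (vin b) ts by rewrite cats0 count_rev.
have dm64 : dm < 64 by apply: leq_ltn_trans (leq_subr _ _) (ltn_trans k60 _).
have ad : admissible (k - w.-1) sb ch [::].
  apply: (admissibleP dm64 usb GP st chG).
  - by rewrite cats0 size_rev; apply: leq_trans sob _.
  - by apply: sub_pairwise pwd => b b' /=; rewrite !cnt_rev.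
  - by move=> b bs; rewrite cnt_rev dmb.
have c0 : columns [::] sb = nseq w d0 by rewrite /columns; elim: (sb) => //= b l ->.
have chos : chosen ch G.
  by rewrite -[G]drop0; apply: chosen_sorted chG; case: (ch) st => //= x l ->.
have run' : gen k c two hv lim (digit_of dm) leaf sb ob (size ch) G [::] (columns [::] sb).
  by move: run; rewrite c0 size_rev size_map.
have s50 : size ch + size (@nil vset) < 50 by rewrite addn0 size_rev; apply: leq_trans sob _.
have rs := genP dm64 usb s50 chos ad run'; rewrite cats0 revK in rs.
apply: (run_seedP uvs sb0 cpos _ hv63 _ leafP (tg_sym cF') (tg_irr cF') (tg_supp cF') clF' _ _ _ _ rs).
- exact: ltn_trans k60 _.
- move=> F1 i j ivs jvs; apply: Qperm => v; by case: tpermP => [->|->|] //; rewrite ivs jvs.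
- move=> _ B sB pB; have pfB : pairwise F (map f B) by rewrite pairwise_map.
  have sfB : size (map f B) = w by rewrite size_map.
  have subB : {subset map f B <= vs} by apply: (clique_sub _ pfB (tg_supp cF)); rewrite sfB.
  have [t' Pt' pt'] := Psort _ sfB pfB subB.
  have := maxD t' Pt'; rewrite /D (perm_big _ pt') -mapt !big_map /=.
  by rewrite (eq_bigr (degree F')) => [|v _]; rewrite ?degf // (eq_bigr (degree F') (r := sb)) // => v _; rewrite degf.
- by move=> smax; apply: core_target.
- apply: (done_okP (rest := [::]) dm64 usb); rewrite ?cats0 //; first by apply: leq_trans sob _.
- apply: (swaps_okP dm64 usb); last by apply: leq_trans sob _.
  (* Exchanging two seed vertices of equal degree gives another admissible list with the same degree
     sum, so the maximality of [TT] is precisely the inequality tested by [swap_ok]. *)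
  move=> b b' bs bs' E; apply: swap_okP.
  pose r := tperm b b'.
  have rs_ x : (r x \in sb) = (x \in sb) by rewrite /r; case: tpermP => [->|->|] //; rewrite bs bs'.
  have rK : involutive r := tpermK b b'.
  have sz' : size [seq f (r x) | x <- sb] == w by rewrite size_map.
  pose t' := Tuple sz'.
  have t'E v : (v \in tval t') = (v \in tval t).
    rewrite -mapt /=; apply/mapP/mapP => -[x xs ->]; exists (r x); rewrite ?rs_ ?rK //.
  have degr x : degree F' (r x) = degree F' x by rewrite /r; case: tpermP => [->|->|] //; rewrite !degb // E.
  have Pt' : P t'.
    apply/and3P; split.
    - by apply/allP=> v; rewrite t'E; apply: tvs.
    - rewrite /= (map_comp f r) pairwise_map; apply: clique_pairwise; first by rewrite map_inj_uniq //; apply: inv_inj.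
      move=> u v /mapP[x xs ->] /mapP[y ys ->] xy; apply: (pairwise_clique (tg_sym cF') clF') => //; by rewrite rs_.
    - rewrite /= pairwise_map; have := dt; rewrite -mapt pairwise_map; apply: sub_pairwise => x y.
      by rewrite /dge /= -(degf (r x)) -(degf (r y)) -(degf x) -(degf y) !degr.
  have Dt' : D t' = D t.
    rewrite /D -mapt /= !big_map; apply: eq_bigr => v _; by rewrite -(degf (r v)) -(degf v) degr.
  have := maxT t' Pt' Dt'; rewrite /TT.
  rewrite (eq_filter (a2 := fun v => v \notin tval t)) => [|v]; last by rewrite t'E.
  rewrite -/O -!(perm_big _ pLO) /= -[in X in _ <= X](big_map (tyL t) xpredT (fun z => N.to_nat (weight sb z))) -tsE.
  rewrite -(big_map (tyL t') xpredT (fun z => N.to_nat (weight sb z))).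
  rewrite (_ : map (tyL t') LO = map (swapv b b') ts) // tsE -map_comp; apply: eq_map => o /=.
  apply: vset_ext => x; rewrite vin_swapv -/r /tyL !vin_type_of rs_; case xs: (x \in sb) => //=.
  by rewrite (nth_map x0) ?index_mem // nth_index // fsb ?rs_.
Qed.
End Master.

(** * Attacks on a critical graph *)

(* A partial colouring is recorded by the neighbourhoods of its classes. *)
Fixpoint place (rec : seq vset -> nat -> bool) (y : vtx) (h : vset) (free : nat) (pre cs : seq vset) : bool :=
  match cs with
  | [::] => if free is fr.+1 then rec (h :: pre) fr else false
  | nb :: cs => if (if vin y nb then false else rec (catrev pre (vor nb h :: cs)) free)
      then true else place rec y h free (nb :: pre) cs
  end.
Fixpoint col_search (s : state) (ys : seq vtx) (cs : seq vset) (free : nat) : bool :=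
  match ys with
  | [::] => true
  | y :: ys => place (col_search s ys) y (nbh y s) free [::] cs
  end.

Definition cut (u v : vtx) (s : state) : state :=
  upd u (fun r => let: Row h l := r in Row (vdiff h (vone v)) l)
    (upd v (fun r => let: Row h l := r in Row (vdiff h (vone u)) l) s).
(** In a critical graph the removal of any vertex or edge restores colourability. If the decided
    edges stay non-colourable after such a removal, no critical graph contains them. *)
Definition redundant (k : nat) (vs : seq vtx) (s : state) : bool :=
  if has (fun u => ~~ col_search s (filter (fun v => ~~ vtxb u v) vs) [::] k) vs then true else
  has (fun u => has (fun v => if Nat.ltb (vnat u) (vnat v) then ~~ col_search (cut u v s) vs [::] k else false)
    (vlist (nbh u s))) vs.

(* sets of words over [vtx]: [TE] is empty, [TD] contains the empty word *)
Inductive trie := TE | TD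
  | TN of trie & trie & trie & trie & trie & trie & trie & trie & trie & trie & trie & trie.
Definition child (v : vtx) (t : trie) : trie := match v, t with
  | x0, TN t0 _ _ _ _ _ _ _ _ _ _ _ => t0
  | x1, TN _ t1 _ _ _ _ _ _ _ _ _ _ => t1
  | x2, TN _ _ t2 _ _ _ _ _ _ _ _ _ => t2
  | x3, TN _ _ _ t3 _ _ _ _ _ _ _ _ => t3
  | x4, TN _ _ _ _ t4 _ _ _ _ _ _ _ => t4
  | x5, TN _ _ _ _ _ t5 _ _ _ _ _ _ => t5
  | x6, TN _ _ _ _ _ _ t6 _ _ _ _ _ => t6
  | x7, TN _ _ _ _ _ _ _ t7 _ _ _ _ => t7
  | x8, TN _ _ _ _ _ _ _ _ t8 _ _ _ => t8
  | x9, TN _ _ _ _ _ _ _ _ _ t9 _ _ => t9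
  | x10, TN _ _ _ _ _ _ _ _ _ _ t10 _ => t10
  | x11, TN _ _ _ _ _ _ _ _ _ _ _ t11 => t11
  | _, t => t
  end.
Fixpoint ins (p : seq vtx) (t : trie) {struct p} : trie :=
  match p with [::] => TD | v :: p =>
  match t with TD => TD
  | TE => match v with
  | x0 => TN (ins p TE) TE TE TE TE TE TE TE TE TE TE TE
  | x1 => TN TE (ins p TE) TE TE TE TE TE TE TE TE TE TE
  | x2 => TN TE TE (ins p TE) TE TE TE TE TE TE TE TE TE
  | x3 => TN TE TE TE (ins p TE) TE TE TE TE TE TE TE TE
  | x4 => TN TE TE TE TE (ins p TE) TE TE TE TE TE TE TE
  | x5 => TN TE TE TE TE TE (ins p TE) TE TE TE TE TE TE
  | x6 => TN TE TE TE TE TE TE (ins p TE) TE TE TE TE TE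
  | x7 => TN TE TE TE TE TE TE TE (ins p TE) TE TE TE TE
  | x8 => TN TE TE TE TE TE TE TE TE (ins p TE) TE TE TE
  | x9 => TN TE TE TE TE TE TE TE TE TE (ins p TE) TE TE
  | x10 => TN TE TE TE TE TE TE TE TE TE TE (ins p TE) TE
  | x11 => TN TE TE TE TE TE TE TE TE TE TE TE (ins p TE)
    end
  | TN t0 t1 t2 t3 t4 t5 t6 t7 t8 t9 t10 t11 => match v with
  | x0 => TN (ins p t0) t1 t2 t3 t4 t5 t6 t7 t8 t9 t10 t11
  | x1 => TN t0 (ins p t1) t2 t3 t4 t5 t6 t7 t8 t9 t10 t11
  | x2 => TN t0 t1 (ins p t2) t3 t4 t5 t6 t7 t8 t9 t10 t11
  | x3 => TN t0 t1 t2 (ins p t3) t4 t5 t6 t7 t8 t9 t10 t11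
  | x4 => TN t0 t1 t2 t3 (ins p t4) t5 t6 t7 t8 t9 t10 t11
  | x5 => TN t0 t1 t2 t3 t4 (ins p t5) t6 t7 t8 t9 t10 t11
  | x6 => TN t0 t1 t2 t3 t4 t5 (ins p t6) t7 t8 t9 t10 t11
  | x7 => TN t0 t1 t2 t3 t4 t5 t6 (ins p t7) t8 t9 t10 t11
  | x8 => TN t0 t1 t2 t3 t4 t5 t6 t7 (ins p t8) t9 t10 t11
  | x9 => TN t0 t1 t2 t3 t4 t5 t6 t7 t8 (ins p t9) t10 t11
  | x10 => TN t0 t1 t2 t3 t4 t5 t6 t7 t8 t9 (ins p t10) t11
  | x11 => TN t0 t1 t2 t3 t4 t5 t6 t7 t8 t9 t10 (ins p t11)
    end
  end end.
Fixpoint look (p : seq vtx) (t : trie) {struct p} : bool :=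
  match p with
  | [::] => if t is TD then true else false
  | v :: p => match t with TE | TD => false | _ => look p (child v t) end
  end.

(** * Computing the attacker's win *)

Section Kill.
Variables (s : state) (M : vset) (dom : bool) (V : vset).

Definition step (r : vset) (a b : vtx) : vset := vor (vdiff r (vone a)) (vone b).
Definition answer (t : trie) (r : vset) (b : vtx) (resp : vset) : bool :=
  has (fun a => ~~ look (vlist (step r a b)) t) (vlist resp).
(* [t] lists states from which the attacker wins *)
Definition holds (t : trie) (r : vset) : bool :=
  all (fun b => let h := nbh b s in
    if vin b M then
      if (if dom then isz (vdiff r h) else false) then false
      else all (fun x => answer t r b (vdiff r (vone x))) (vlist (vand r h))
    else answer t r b (vdiff r h)) (vlist (vdiff V r)).
Fixpoint sweep (l kept : seq vset) (t : trie) : seq vset * trie :=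
  match l with [::] => (kept, t)
  | r :: l => if holds t r then sweep l (r :: kept) t else sweep l kept (ins (vlist r) t) end.
Fixpoint rounds (n : nat) (S : vset) (l : seq vset) (t : trie) : bool :=
  match n with 0 => false
  | n.+1 => let: (l', t) := sweep l [::] t in
    if all (fun r => ~~ isz (vdiff S r)) l' then true
    else rounds n S l' t end.
End Kill.

Fixpoint extensions (l : seq vtx) (n : nat) (r : vset) : seq vset :=
  match n with 0 => [:: r]
  | n'.+1 => match l with [::] => [::]
    | x :: l => extensions l n' (vor (vone x) r) ++ extensions l n r end end.

Definition set_of (l : seq vtx) := foldr (fun v r => vor (vone v) r) v0 l.

(* Guards never leave a clique of single classes, so some state contains all of [S]. *)
Definition dead (n : nat) (s : state) (vs : seq vtx) (S M : vset) (dom : bool) (j : nat) : bool :=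
  let V := set_of vs in let S := vdiff S M in
  if ~~ all (fun u => isz (vdiff (vdiff S (vone u)) (nbh u s))) (vlist S) then false else
  if Nat.ltb j (value (pc S)) then true
  else rounds s M dom V n S (extensions vs j v0) TE.

(** With [exact] non-edges must be preserved as well, so an embedding of all vertices into a graph
    of the same order is an isomorphism. *)
Fixpoint embeds (exact : bool) (pat s : state) (us : seq vtx) (asg : seq (vtx * vtx)) (avail : vset) : bool :=
  match us with [::] => true
  | u :: us =>
    let h := nbh u pat in
    let cand := foldr (fun p z => let: (u', v') := p in if vin u' h then vand z (nbh v' s)
      else if exact then vdiff z (nbh v' s) else z) avail asg in
    has (fun v => embeds exact pat s us ((u, v) :: asg) (vdiff avail (vone v))) (vlist cand)
  end.

Definition universal (vs : seq vtx) (s : state) : bool :=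
  let V := set_of vs in has (fun u => isz (vdiff (vdiff V (vone u)) (nbh u s))) vs.

Definition no_edges : state := let r := Row v0 v0 in St r r r r r r r r r r r r.
Definition graph_of (es : seq (vtx * vtx)) : state := foldr (fun e s => set_edge e.1 e.2 s) no_edges es.
(** This is the complement of the second graph in [L10], with the same numbering of vertices. *)
Definition crit10 : state := Eval vm_compute in graph_of
  [:: (x0, x1); (x0, x2); (x0, x5); (x0, x6); (x1, x2); (x1, x4); (x1, x7); (x2, x3); (x2, x9); (x3, x4); (x3, x5); (x3, x9); (x4, x5); (x4, x7); (x5, x6); (x6, x8); (x7, x8); (x8, x9)].
Definition crits11 : seq state := Eval vm_compute in map graph_of
  [:: [:: (x0, x1); (x0, x3); (x0, x7); (x1, x2); (x1, x5); (x1, x10); (x2, x3); (x2, x6); (x2, x8); (x3, x4); (x3, x9); (x4, x5); (x4, x7); (x5, x6); (x5, x9); (x6, x7); (x7, x8); (x7, x10); (x8, x9); (x9, x10)];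
   [:: (x0, x1); (x0, x2); (x0, x5); (x1, x2); (x1, x4); (x1, x7); (x2, x3); (x2, x9); (x3, x5); (x3, x9); (x4, x5); (x4, x7); (x5, x6); (x5, x10); (x6, x7); (x6, x8); (x7, x8); (x8, x9); (x8, x10); (x9, x10)];
   [:: (x0, x1); (x0, x2); (x0, x5); (x0, x6); (x1, x2); (x1, x4); (x1, x7); (x1, x10); (x2, x3); (x2, x9); (x3, x4); (x3, x5); (x3, x9); (x4, x5); (x5, x6); (x5, x10); (x6, x7); (x6, x8); (x7, x8); (x7, x10); (x8, x9)];
   [:: (x0, x1); (x0, x2); (x0, x5); (x0, x8); (x1, x2); (x1, x4); (x1, x10); (x2, x3); (x2, x7); (x3, x4); (x3, x6); (x3, x8); (x4, x5); (x5, x6); (x5, x7); (x6, x9); (x7, x9); (x7, x10); (x8, x9); (x8, x10)];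
   [:: (x0, x1); (x0, x2); (x0, x5); (x0, x10); (x1, x4); (x1, x7); (x2, x3); (x2, x6); (x3, x4); (x3, x9); (x3, x10); (x4, x5); (x4, x9); (x5, x6); (x6, x7); (x6, x8); (x7, x8); (x7, x10); (x8, x9)]].

Lemma mem_set_of l v : vin v (set_of l) = (v \in l).
Proof. by elim: l => [|u l IH] /=; rewrite ?vin0 // vin_or vin_one inE IH. Qed.

(** * Completeness of the colouring search *)

Section ColSearch.
Variables (s : state) (c : vtx -> nat) (vs : seq vtx) (k : nat).
Hypothesis ck : forall x, x \in vs -> c x < k.
Hypothesis cN : forall x y, x \in vs -> y \in vs -> N s x y -> c x != c y.

(** Describes a stage of the search that follows the colouring [c]: every class carries its colour,
    and no vertex of that colour lies in the neighbourhood recorded for the class. *)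
Definition coherent (ps : seq (vset * nat)) :=
  [/\ uniq (map snd ps), {in map snd ps, forall q, q < k} &
      {in ps, forall p x, x \in vs -> vin x p.1 -> c x != p.2}].

Lemma coherent_perm ps qs : perm_eq ps qs -> coherent ps -> coherent qs.
Proof.
move=> pq [u b n]; have mE := perm_mem pq; split.
- by rewrite -(perm_uniq (perm_map snd pq)).
- by move=> q; rewrite -(perm_mem (perm_map snd pq)); apply: b.
- by move=> p; rewrite -mE; apply: n.
Qed.

(** The vertex [y] follows [c]: it joins the class tagged with its colour or opens a new one. A free
    class remains in the latter case, because the tags in use are distinct colours below [k]
    different from that of [y]. *)
Lemma placeP (rec : seq vset -> nat -> bool) y : y \in vs ->
  (forall ps free, coherent ps -> size ps + free = k -> rec (map fst ps) free) ->
  forall ps pre free, coherent (pre ++ ps) -> size (pre ++ ps) + free = k ->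
    c y \notin map snd pre -> place rec y (nbh y s) free (map fst pre) (map fst ps).
Proof.
move=> yvs recP; elim=> [|[nb q] ps IH] pre free coh sz nin /=.
  rewrite cats0 in coh sz; have [u b n] := coh.
  have : size (c y :: map snd pre) <= size (iota 0 k).
    apply: uniq_leq_size; first by rewrite /= nin.
    by move=> z; rewrite inE mem_iota => /orP[/eqP->|/b]; rewrite ?ck.
  rewrite /= size_map size_iota; case: free sz => [|fr] sz lt; first by move: sz lt; lia.
  apply: (recP ((nbh y s, c y) :: pre)); last by rewrite -sz /= addSnnS.
  split=> //=; first by rewrite nin.
    by move=> z; rewrite inE => /orP[/eqP->|/b]; rewrite ?ck.
  by move=> p; rewrite inE => /orP[/eqP-> x xvs h|/n //]; rewrite eq_sym cN.
have [u b n] := coh.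
case: (eqVneq q (c y)) => [qE|qy].
  have nyb : vin y nb = false.
    apply: contraTF isT => h; have := n (nb, q); rewrite mem_cat inE eqxx orbT => /(_ isT y yvs h).
    by rewrite qE eqxx.
  rewrite nyb ifT //.
  have -> : catrev (map fst pre) (vor nb (nbh y s) :: map fst ps) = map fst (rev pre ++ (vor nb (nbh y s), q) :: ps).
    by rewrite catrevE map_cat map_rev.
  apply: recP; last by rewrite -sz !size_cat size_rev /=.
  apply: (@coherent_perm (pre ++ (vor nb (nbh y s), q) :: ps)).
    by rewrite perm_cat2r perm_sym perm_rev.
  split.
  - by move: u; rewrite !map_cat.
  - by move: b; rewrite !map_cat.
  - move=> p; rewrite mem_cat inE => /or3P[h|/eqP->|h]; first by apply: n; rewrite mem_cat h.
      move=> x xvs /=; rewrite vin_or => /orP[h|h].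
        by have := n (nb, q); rewrite mem_cat inE eqxx orbT; apply.
      by rewrite qE eq_sym cN.
    by apply: n; rewrite mem_cat inE h !orbT.
case: ifP => // _; apply: (IH ((nb, q) :: pre)).
- by apply: coherent_perm coh; rewrite -cat1s perm_catCA.
- by rewrite -sz /= !size_cat /= addnS.
- by rewrite /= inE eq_sym negb_or qy.
Qed.

Lemma col_search_complete ys ps free : {subset ys <= vs} -> coherent ps -> size ps + free = k ->
  col_search s ys (map fst ps) free.
Proof.
elim: ys ps free => [|y ys IH] ps free sub coh sz //=.
have yvs : y \in vs by apply: sub; rewrite inE eqxx.
apply: (placeP yvs _ (pre := [::])) => // qs fr coh' sz'.
by apply: IH => // z h; apply: sub; rewrite inE h orbT.
Qed.
End ColSearch.

Lemma col_searchP s (F : rel vtx) vs k : subrel (N s) F -> ~~ col_search s vs [::] k ->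
  ~ colorable F [set v in vs] k.
Proof.
move=> NF /negP nc [c [ck cF]]; apply: nc.
apply: (@col_search_complete s c vs k _ _ vs [::] k) => //.
  by move=> x xvs; apply: ck; rewrite inE.
by move=> x y xvs yvs /NF; apply: cF; rewrite inE.
Qed.

Lemma N_cut u v s x y : u != v ->
  N (cut u v s) x y = [&& N s x y, ~~ ((x == u) && (y == v)) & ~~ ((x == v) && (y == u))].
Proof.
move=> uv; rewrite /N /nbh /cut !get_upd.
case: (eqVneq x u) uv => [-> |xu] uv; last first.
  case: (eqVneq x v) => [->|xv]; last by rewrite !andbT.
  by case: (get v s) => h l; rewrite vin_diff vin_one.
by rewrite (negbTE uv) /=; case: (get u s) => h l; rewrite vin_diff vin_one andbT.
Qed.

Lemma ltbE m n : Nat.ltb m n = (m < n).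
Proof. exact: lebE. Qed.

Lemma redundantP k vs s (F : rel vtx) : redundant k vs s -> subrel (N s) F -> symmetric F ->
  (forall x y, F x y -> colorable (del_edge F x y) [set v in vs] k) ->
  (forall v, v \in vs -> exists w, F v w) -> False.
Proof.
rewrite /redundant => red NF sF edge deg; move: red.
case: ifP => [/hasP[u uvs nc] _|_ /hasP[u uvs /hasP[v]]].
  have [w Fuw] := deg u uvs; have [c [ck cF]] := edge u w Fuw.
  apply/negP: nc; rewrite negbK.
  apply: (@col_search_complete s c [seq v <- vs | ~~ vtxb u v] k _ _ _ [::] k) => // [x|x y].
    by rewrite mem_filter => /andP[_ xvs]; apply: ck; rewrite inE.
  rewrite !mem_filter !vtxbE => /andP[ux xvs] /andP[uy yvs] /NF Fxy; apply: cF; rewrite ?inE //.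
  by rewrite /del_edge Fxy eq_sym (negbTE ux) /= [y == u]eq_sym (negbTE uy) andbF.
rewrite mem_vlist ltbE; case: ltnP => // uv Nuv nc.
have uNv : u != v by apply: contraTneq uv => ->; rewrite ltnn.
apply: (col_searchP _ nc (edge u v (NF _ _ Nuv))) => x y; rewrite N_cut // /del_edge.
by case/and3P=> /NF-> -> ->.
Qed.

(** * Attacks transported into a larger game *)

Section Emb.
Variables (I : finType) (F0 : rel I) (g : vtx -> I) (vs : seq vtx).
Hypothesis gI : {in vs &, injective g}.
Definition emb (r : vset) : {set I} := [set g v | v in [set v | vin v r]].
Definition inside (r : vset) := forall v, vin v r -> v \in vs.

Lemma mem_emb r v : inside r -> v \in vs -> (g v \in emb r) = vin v r.
Proof.
move=> ir vvs; apply/imsetP/idP => [[u]|h]; last by exists v; rewrite ?inE.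
by rewrite inE => ur /gI -> //; apply: ir.
Qed.

Lemma step_emb r a b : inside r -> vin a r -> b \in vs ->
  move (emb r) (g a) (g b) = emb (step r a b).
Proof.
move=> ir ar bvs; apply/setP=> x; rewrite in_move.
apply/orP/imsetP => [[/eqP->|/andP[xa /imsetP[v]]]|[v]].
- by exists b; rewrite // inE vin_or vin_one eqxx orbT.
- rewrite inE => vr E; exists v => //; rewrite inE vin_or vin_diff vr vin_one.
  by rewrite (_ : v != a) //; apply: contraNneq xa => va; rewrite E va.
rewrite inE vin_or vin_diff !vin_one => /orP[/andP[vr va]|/eqP->] ->; last by left.
right; rewrite imset_f ?inE // andbT; apply: contraNneq va => /gI-> //; [exact: ir | exact: ir].
Qed.

Variables (s : state) (M : vset) (dom : bool) (M0 : {set I}) (j : nat) (W : {set {set I}}).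
Hypothesis sub : forall u v, u \in vs -> v \in vs -> N s u v -> F0 (g u) (g v).
Hypothesis Msub : forall v, v \in vs -> g v \in M0 -> vin v M.
Hypothesis etW : eternal F0 M0 [set g v | v in vs] j dom W.
Hypothesis symF0 : symmetric F0.
Notation V := (set_of vs).
Definition live r := inside r /\ emb r \in W.
Definition sound (t : trie) := forall r, look (vlist r) t -> ~ live r.

Lemma vlist_inj r r' : vlist r = vlist r' -> r = r'.
Proof. by move=> E; apply: vset_ext => v; rewrite -!mem_vlist E. Qed.

Lemma look_ins p q t : look q (ins p t) -> look q t \/ q = p.
Proof.
elim: p q t => [|v p IH] q t /=.
  by case: q => [|u q]; [right | ].
case: t => [||t0 t1 t2 t3 t4 t5 t6 t7 t8 t9 t10 t11]; last 1 first.
- case: q => [|u q]; first by case: v.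
  case: (eqVneq u v) => [->|uv].
    by case: v => /= /IH[|->]; by [left | right].
  by rewrite -vtxbE in uv; case: v uv; case: u => //= _ h; left.
- case: q => [|u q]; first by case: v.
  case: (eqVneq u v) => [->|uv].
    by case: v => /= /IH[|->]; by [case: q | right].
  by rewrite -vtxbE in uv; case: v uv; case: u => //= _; case: q.
- by move=> h; left.
Qed.

Lemma answerP t r b (A : pred vtx) resp : sound t -> live r -> b \in vs -> ~~ vin b r ->
  (exists a, [/\ vin a r, vin a resp & emb (step r a b) \in W]) -> answer t r b resp.
Proof.
move=> st [ir _] bvs br [a [ar aresp aW]]; apply/hasP; exists a; rewrite ?mem_vlist //.
apply/negP=> /st; apply; split=> // v; rewrite vin_or vin_diff vin_one => /orP[/andP[/ir] //|].
by rewrite vin_one => /eqP->.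
Qed.

(** A state of the defender answers each attack by another such state, which a sound trie does not
    contain. Consequently a state failing the test can be added to the trie. *)
Lemma holdsP t r : sound t -> live r -> holds s M dom V t r.
Proof.
move=> st lr; have [ir rW] := lr; apply/allP=> b; rewrite mem_vlist vin_diff mem_set_of => /andP[bvs br].
have bX : g b \in [set g v | v in vs] by apply: imset_f.
have bR : g b \notin emb r by rewrite mem_emb.
have [rX _] := et_state etW rW.
have pre x : x \in emb r -> exists2 v, vin v r & x = g v.
  by case/imsetP=> v; rewrite inE => h ->; exists v.
have resp x : x \in emb r -> move (emb r) x (g b) \in W ->
    exists a, [/\ vin a r, x = g a & emb (step r a b) \in W].
  by move=> /pre[a ar ->]; rewrite step_emb // => h; exists a.
rewrite -/(nbh b s) /=; case: ifP => bM; last first.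
  have gM : g b \notin M0 by apply: contraFN bM; apply: Msub.
  have [x [xR nF mW]] := et_single etW rW bX bR gM.
  have [a [ar xE aW]] := resp x xR mW.
  apply: (answerP predT st lr bvs br); exists a; split=> //; rewrite vin_diff ar /=.
  by apply: contra nF => h; rewrite xE symF0; apply: sub => //; apply: ir.
rewrite (_ : (if dom then _ else _) = false).
  apply/allP=> x; rewrite mem_vlist vin_and => /andP[xr xb].
  have Fxb : F0 (g x) (g b) by rewrite symF0; apply: sub => //; apply: ir.
  have [y [yR yx mW]] := et_multi etW rW bX bR Fxb.
  have [a [ar yE aW]] := resp y yR mW.
  apply: (answerP predT st lr bvs br); exists a; split=> //; rewrite vin_diff ar vin_one /=.
  by apply: contra yx => /eqP <-; rewrite yE.
case: ifP => // dd; apply/negP=> /iszP E.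
have [x xR nF] := et_dom etW dd rW bX bR; have [a ar xE] := pre x xR.
have : vin a (vdiff r (nbh b s)) by rewrite vin_diff ar; apply: contra nF => h; rewrite xE symF0; apply: sub => //; apply: ir.
by rewrite E vin0.
Qed.

Lemma sweepP l kept t : sound t -> (forall r, live r -> r \in l \/ r \in kept) ->
  let: (l', t') := sweep s M dom V l kept t in sound t' /\ forall r, live r -> r \in l'.
Proof.
elim: l kept t => [|r l IH] kept t st al /=; first by split=> // r /al[].
case: ifP => hr; apply: IH => //.
- move=> x /al[|h]; last by right; rewrite inE h orbT.
  by rewrite inE => /orP[/eqP->|h]; [right; rewrite inE eqxx | left].
- move=> x /look_ins[/st //|/vlist_inj-> lr].
  by rewrite (holdsP st lr) in hr.
- move=> x lx; case: (al x lx) => [|h]; last by right.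
  by rewrite inE => /orP[/eqP xr|h]; [rewrite -xr (holdsP st lx) in hr | left].
Qed.

Lemma roundsP n S l t : sound t -> (forall r, live r -> r \in l) ->
  rounds s M dom V n S l t -> exists2 l', (forall r, live r -> r \in l') & all (fun r => ~~ isz (vdiff S r)) l'.
Proof.
elim: n l t => //= n IH l t st al.
have := @sweepP l [::] t st (fun r lr => or_introl (al r lr)).
case: sweep => l' t' [st' al']; case: ifP => [h _|_]; last exact: IH.
by exists l'.
Qed.

Lemma extensionsP l n r r' : uniq l -> (forall v, vin v r -> vin v r') ->
  (forall v, vin v r' -> ~~ vin v r -> v \in l) -> count (vin^~ r') l = n -> {in l, forall v, ~~ vin v r} ->
  r' \in extensions l n r.
Proof.
elim: l n r => [|x l IH] n r ul sr cov cn dis.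
  case: n cn => // _; rewrite inE; apply/eqP/vset_ext => v; apply/idP/idP; last exact: sr.
  by move=> h; apply: contraT => /(cov v h).
have /andP[xl ul'] := ul.
have done0 : (forall v, vin v r' -> vin v r) -> n = 0.
  move=> E; rewrite -cn; apply/eqP; rewrite -leqn0 leqNgt -has_count; apply/hasPn => v vl.
  by apply: contra (dis v vl); apply: E.
case: n cn done0 => [|n] cn done0.
  rewrite inE; apply/eqP/vset_ext => v; apply/idP/idP; last exact: sr.
  move=> h; apply: contraT => nr; have vl := cov v h nr.
  by have : has (vin^~ r') (x :: l) by [apply/hasP; exists v]; rewrite has_count cn.
rewrite /= mem_cat; case xr: (vin x r'); apply/orP; [left|right]; apply: IH => //.
- by move=> v; rewrite vin_or vin_one => /orP[/eqP->|/sr].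
- move=> v h; rewrite vin_or vin_one negb_or => /andP[vx nr].
  by have := cov v h nr; rewrite inE (negbTE vx).
- by move: cn; rewrite /= xr => -[].
- move=> v vl; rewrite vin_or vin_one negb_or dis ?inE ?vl ?orbT // andbT.
  by apply: contraNneq xl => <-.
- move=> v h nr; have := cov v h nr; rewrite inE => /orP[/eqP E|//].
  by rewrite E xr in h.
- by move: cn; rewrite /= xr.
- by move=> v vl; apply: dis; rewrite inE vl orbT.
Qed.

Hypothesis uvs : uniq vs.

Lemma deadP n S : (forall v, vin v S -> v \in vs) -> dead n s vs S M dom j -> False.
Proof.
move=> Svs; rewrite /dead; set S' := vdiff S M; case: ifP => // /negbFE cl.
have S'P v : vin v S' -> [&& v \in vs, ~~ vin v M & vin v S].
  by rewrite vin_diff => /andP[h ->]; rewrite Svs // h.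
have clF u v : vin u S' -> vin v S' -> u != v -> F0 (g u) (g v).
  move=> uS vS uv; have /and3P[uvs' _ _] := S'P u uS; have /and3P[vvs' _ _] := S'P v vS.
  apply: sub => //; apply: contraT => nN; have := allP cl u; rewrite mem_vlist => /(_ uS) /iszP E.
  have : vin v (vdiff (vdiff S' (vone u)) (nbh u s)) by rewrite vin_diff [X in X && _]vin_diff vS vin_one eq_sym uv /=; exact: nN.
  by rewrite E vin0.
pose GS : {set I} := emb S'.
have [R0 R0W] := et_nonempty etW.
have [R RW Rmax] := set_argmax (P := [in W]) (fun R => #|R :&: GS|) R0W.
have [RX cR] := et_state etW RW.
have iS : inside S' by move=> v /S'P/and3P[].
have GSR : GS \subset R.
  apply/subsetP=> x /imsetP[b]; rewrite inE => bS ->; apply: contraT => bR.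
  have /and3P[bvs bM _] := S'P b bS.
  have bX : g b \in [set g v | v in vs] by apply: imset_f.
  have gM : g b \notin M0 by apply: contra bM; apply: Msub.
  have [a [aR nF mW]] := et_single etW RW bX bR gM.
  have : #|R :&: GS| < #|move R a (g b) :&: GS|.
    apply: proper_card; apply/properP; split.
      apply/subsetP=> x0; rewrite inE in_setI in_move => /andP[xR xS]; rewrite xR xS !andbT.
      apply/orP; right; apply: contraNneq nF => <-.
      case/imsetP: xS => u; rewrite inE => uS E; rewrite E; apply: clF => //.
      by apply: contraNneq bR => <-; rewrite -E.
    exists (g b); rewrite !inE ?eqxx /= ?(negbTE bR) //.
    by apply/imsetP; exists b; rewrite ?inE.
  by rewrite ltnNge Rmax.
pose r0 := set_of [seq v <- vs | g v \in R].
have mr0 v : vin v r0 = (v \in vs) && (g v \in R) by rewrite mem_set_of mem_filter andbC.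
have i0 : inside r0 by move=> v; rewrite mr0 => /andP[].
have e0 : emb r0 = R.
  apply/setP=> x; apply/imsetP/idP => [[v]|xR]; first by rewrite inE mr0 => /andP[_ h] ->.
  have := subsetP RX x xR => /imsetP[v vvs xE]; exists v => //.
  by rewrite inE mr0 [v \in vs]vvs -xE.
have l0 : live r0 by split; rewrite ?e0.
have S0 v : vin v S' -> vin v r0.
  move=> h; rewrite mr0 iS //=; apply: (subsetP GSR); apply/imsetP; exists v; by rewrite ?inE.
have cnt r : live r -> count (vin^~ r) vs = j.
  case=> ir rW; have [_ <-] := et_state etW rW; rewrite -size_filter.
  have -> : emb r = [set x in map g [seq v <- vs | vin v r]].
    apply/setP=> x; rewrite inE; apply/imsetP/mapP => -[v].
      by rewrite inE => h ->; exists v; rewrite // mem_filter h ir.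
    by rewrite mem_filter => /andP[h _] ->; exists v; rewrite ?inE.
  rewrite cardsE (card_uniqP _) ?size_map //.
  rewrite map_inj_in_uniq ?filter_uniq // => u v; rewrite !mem_filter => /andP[_ h1] /andP[_ h2]; exact: gI.
case: ifP => [|_].
  rewrite ltbE pcE -(cnt r0 l0) ltnNge /vcard => /negP[].
  rewrite -!size_filter; apply: uniq_leq_size; first exact: filter_uniq uniq_vtxs.
  by move=> v; rewrite !mem_filter => /andP[h _]; rewrite S0 // iS.
have al0 r : live r -> r \in extensions vs j v0.
  move=> lr; apply: extensionsP => //; try by move=> v; rewrite ?vin0.
    by move=> v h _; case: lr => ir _; apply: ir.
  exact: cnt.
have st0 : sound TE by move=> r; case: (vlist r).
move=> rd; have [l' al' /allP no] := roundsP st0 al0 rd.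
have := no r0 (al' r0 l0); rewrite isz0P negbK => /hasP[v _]; rewrite vin_diff => /andP[h].
by rewrite S0.
Qed.
End Emb.

Lemma eqbE m n : Nat.eqb m n = (m == n).
Proof. by elim: m n => [|m IH] [|n] //=; rewrite IH. Qed.

(** * Outcomes of the enumeration *)

Section Task.
Variables (m k c : nat) (two hv : bool) (w lim : nat) (leaf : state -> bool) (Q : rel vtx -> Prop).
Notation vs := (take m vtxs).
Notation sb := (take w vtxs).
Notation ob := (take (m - w) (drop w vtxs)).
Hypothesis w2 : 1 < w.
Hypothesis wm : w <= m.
Hypothesis m12 : m <= 12.
Hypothesis cpos : 0 < c.
Hypothesis k60 : k < 50.
Hypothesis hv63 : hv -> w * 12 <= 63.
Hypothesis Qperm : forall F (p : {perm vtx}), (forall v, (p v \in vs) = (v \in vs)) -> Q (relpre p F) -> Q F.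
Let core F := target k c two false d0 vs sb F.
Hypothesis leafP : forall s F, leaf s -> core F -> subrel (N s) F -> symmetric (N s) -> Q F.

Theorem taskP F (S : seq vtx) : core F -> size S = w -> pairwise F S ->
  task m k c two w hv lim leaf -> Q F.
Proof.
have vsE : vs = sb ++ ob by rewrite -takeD subnKC.
have sbw : size sb = w by rewrite size_take; move: wm m12; case: ltngtP => //=; lia.
have sob : size ob = m - w by rewrite size_take size_drop /=; case: ltngtP => //=; lia.
have uv : uniq (sb ++ ob) by rewrite -vsE take_uniq.
move=> cF sS pS; rewrite /task -[w.-1]/(w.-1) => h.
have cF' : target k c two false d0 (sb ++ ob) sb F by rewrite -vsE.
set mx := (if two then _ else _) in h.
apply: (searchP (mins := k - (m - w).-1) (maxs := mx) (lim := lim) (k := k) (c := c) (two := two) (hv := hv) (sb := sb) (ob := ob) (leaf := leaf) (Q := Q) uv _ cpos k60 _ _ _ _ cF' (S := S)).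
- by rewrite sbw.
- by rewrite sbw.
- by move=> F1 p pv; apply: Qperm => v; rewrite vsE.
- move=> smax s F1 lf wfs tF1 fs; apply: (leafP lf); [|exact: fitsN fs|exact: wf_N wfs].
  by rewrite /core vsE; case: tF1 => *; split.
- move=> F1 o cF1 pF1 oo.
  have symF := tg_sym cF1; have irrF := tg_irr cF1.
  have osb : o \notin sb.
    by apply: contraL oo => us; have := uv; rewrite cat_uniq => /and3P[_ /hasPn hh _]; apply/negP=> /hh; rewrite us.
  apply/andP; split.
    have := tg_deg cF1 (v := o); rewrite mem_cat oo orbT => /(_ isT).
    rewrite /degree (count_support uv) => [|u /(tg_supp cF1)/andP[]//].
    have : count (F1 o) ob <= (m - w).-1.
      have -> : (m - w).-1 = (size ob).-1 by rewrite sob.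
      rewrite -(count_predC (pred1 o) ob) count_uniq_mem ?oo ?add1n /=; last by move: uv; rewrite cat_uniq => /and3P[].
      by apply: sub_count => u /= Fu; apply: contraTneq Fu => ->; rewrite irrF.
    by rewrite count_cat => h1 h2; rewrite leq_subLR addnC (leq_trans h2) // leq_add2l.
  rewrite /mx !eqbE; case: (boolP two) => [t|/negP nt]; case: eqP => [cE|_]; try by rewrite -[X in _ <= X]sbw count_size.
    rewrite -ltnS prednK; last by move: cpos; rewrite cE; case: (w) => [|[]].
    rewrite ltnNge; apply/negP=> le.
    pose B := take c [seq b <- sb | F1 o b].
    have sB : size B = c by rewrite size_takel // size_filter cE.
    have Bsub b : b \in B -> (b \in sb) && F1 o b by move/mem_take; rewrite mem_filter andbC.
    have : has (fun b => b \notin B) sb.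
      apply: contraTT isT => /hasPn al.
      have := uniq_leq_size (take_uniq w uniq_vtxs) (s2 := B) (fun b bs => negbNE (al b bs)).
      rewrite sbw sB cE; move: w2; lia.
    case/hasP=> s ss sB'; apply: (tg_clique cF1 sB (x := o) (y := s)).
    - apply: clique_pairwise; first by rewrite take_uniq // filter_uniq // take_uniq.
      by move=> u v /Bsub/andP[us _] /Bsub/andP[vs' _]; apply: (pairwise_clique symF pF1 us vs').
    - by apply/allP=> b /Bsub/andP[].
    - apply/allP=> b bB; have /andP[bs _] := Bsub b bB; apply: (pairwise_clique symF pF1) => //.
      by apply: contraNneq sB' => ->.
    - by move=> _; apply: contraNneq osb => ->.
  rewrite -ltnS prednK; last by rewrite -cE.
  rewrite ltn_neqAle -[X in _ <= X]sbw count_size andbT; apply/eqP=> E.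
  have al : all (F1 o) sb by rewrite all_count E sbw.
  by apply: (tg_clique cF1 (B := sb) (x := o) (y := o)) => //; rewrite sbw.
- by rewrite sbw.
- exact: pS.
- by rewrite -vsE; apply: clique_sub pS (tg_supp cF); rewrite sS.
- by rewrite sbw.
Qed.
End Task.

Lemma embedsP exact pat s us asg avail : symmetric (N pat) -> symmetric (N s) -> uniq us ->
  embeds exact pat s us asg avail -> exists p : vtx -> vtx,
  [/\ forall u, u \in us -> vin (p u) avail, {in us &, injective p},
    forall u q, u \in us -> q \in asg -> (N pat u q.1 -> N s q.2 (p u)) /\ (exact -> ~~ N pat u q.1 -> ~~ N s q.2 (p u)) &
    {in us &, forall u v, u != v -> (N pat u v -> N s (p u) (p v)) /\ (exact -> ~~ N pat u v -> ~~ N s (p u) (p v))}].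
Proof.
move=> sp ss; elim: us asg avail => [|u us IH] asg avail /=; first by move=> _ _; exists id.
case/andP=> uus uu; set cand := foldr _ _ _ => /hasP[v vc h].
have [p [pa pI pq pp]] := IH _ _ uu h; exists (fun x => if x == u then v else p x).
have candP : vin v cand -> vin v avail /\ forall q, q \in asg ->
    (N pat u q.1 -> N s q.2 v) /\ (exact -> ~~ N pat u q.1 -> ~~ N s q.2 v).
  rewrite /cand; elim: (asg) => [|[a b] l IHl] //=; case: ifP => hu.
    rewrite vin_and => /andP[/IHl[h1 h2] h3]; split=> // q; rewrite inE => /orP[/eqP->|/h2 //].
    by split=> // _; rewrite /N hu.
  have E z : vin v (if exact then vdiff z (nbh b s) else z) = vin v z && ~~ (exact && vin v (nbh b s)).
    by case: (exact); rewrite ?vin_diff ?andbT.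
  rewrite E => /andP[/IHl[h1 h2] h3]; split=> // q; rewrite inE => /orP[/eqP->|/h2 //].
  by split=> [|e _]; [rewrite /N /= hu | move: h3; rewrite e].
rewrite mem_vlist in vc; have [va vq] := candP vc.
have nu x : x \in us -> (x == u) = false by move=> xus; apply: contraNF uus => /eqP <-.
have pv x : x \in us -> vin (p x) avail && (p x != v).
  by move=> /pa; rewrite vin_diff vin_one.
split.
- by move=> x; rewrite inE => /orP[/eqP->|xus]; rewrite ?eqxx ?nu //; case/andP: (pv x xus).
- move=> x y; rewrite !inE => /orP[/eqP->|xus] /orP[/eqP->|yus] //; rewrite ?eqxx ?nu //.
  + by move=> E; have /andP[_] := pv y yus; rewrite E eqxx.
  + by move=> E; have /andP[_] := pv x xus; rewrite E eqxx.
  + exact: pI.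
- move=> x q; rewrite inE => /orP[/eqP->|xus] qa; rewrite ?eqxx ?nu //; first exact: vq.
  by apply: pq; rewrite // inE qa orbT.
- move=> x y; rewrite !inE => /orP[/eqP->|xus] /orP[/eqP->|yus] xy; rewrite ?eqxx ?nu //.
  + by rewrite eqxx in xy.
  + by have := pq y (u, v) yus (mem_head _ _); rewrite /= sp.
  + by have := pq x (u, v) xus (mem_head _ _); rewrite /= ss.
  + exact: pp.
Qed.

(** The attacker must win for every possible set of contracted classes and every number of guards in
    the subgraph. A copy of an exception among the decided edges is enough, because all supergraphs
    of the exceptions are examined later. *)
Definition leafG (k w : nat) (Ms : seq vset) (js : seq nat) (univ : bool) (types : seq state) (vs : seq vtx) (s : state) : bool :=
  if redundant k vs s then true else
  if all (fun M => all (fun j => dead 12 s vs (set_of (take w vtxs)) M (Nat.eqb j k) j) js) Ms then true else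
  if (if univ then universal vs s else false) then true else
  has (fun t => embeds false t s vs [::] (set_of vs)) types.

Section Outcome.
Variables (m k r : nat) (js : seq nat) (univ : bool) (types : seq state).
Notation vs := (take m vtxs).

(** The quantification over [F0] and [g] allows one computed attack to be used in any larger
    relation that contains the critical graph, be it a complement or a contraction of one. *)
Definition dead_end (F : rel vtx) := forall (I : finType) (F0 : rel I) (g : vtx -> I), symmetric F0 ->
  {in vs &, injective g} -> (forall u v, F u v -> F0 (g u) (g v)) ->
  forall (M0 : {set I}) j W, j \in js -> count (fun v => g v \in M0) vs <= r ->
  eternal F0 M0 [set g v | v in vs] j (j == k) W -> False.
Definition copy_of (t : state) (F : rel vtx) := exists p : vtx -> vtx,
  [/\ {in vs &, injective p}, forall u, u \in vs -> p u \in vs &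
    {in vs &, forall u v, u != v -> N t u v -> F (p u) (p v)}].
Definition outcome (F : rel vtx) :=
  [\/ dead_end F, univ /\ (exists2 u, u \in vs & forall v, v \in vs -> v != u -> F u v) |
    exists2 i, i < size types & copy_of (nth no_edges types i) F].

Lemma outcome_perm F (p : {perm vtx}) : (forall v, (p v \in vs) = (v \in vs)) -> outcome (relpre p F) -> outcome F.
Proof.
move=> pvs; have pE : perm_eq (map p vs) vs.
  apply: uniq_perm; rewrite ?map_inj_uniq ?take_uniq //; first exact: perm_inj.
  move=> v; rewrite -[v](permKV p) mem_map ?pvs //; exact: perm_inj.
case=> [d|[un [u uvs h]]|[i it [q [qI qv qF]]]].
- apply: Or31 => I F0 g sF gI gF M0 j W js_ cM et.
  apply: (d I F0 (g \o p) sF _ _ M0 j W js_).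
  + by move=> x y xvs yvs /= E; apply: (@perm_inj _ p); apply: gI; rewrite ?pvs.
  + by move=> x y Fxy; apply: gF.
  + have E : count (fun v => g v \in M0) (map p vs) = count (fun v => g v \in M0) vs := seq.permP pE _.
    by rewrite -E count_map in cM.
  + have -> // : [set (g \o p) v | v in vs] = [set g v | v in vs].
    apply/setP=> x; apply/imsetP/imsetP => -[v vvs ->]; first by exists (p v); rewrite ?pvs.
    by exists ((p^-1)%g v); rewrite /= ?permKV // -pvs permKV.
- apply: Or32; split=> //; exists (p u); rewrite ?pvs // => v vvs vu.
  have := h ((p^-1)%g v); rewrite /= permKV -pvs permKV; apply=> //.
  by apply: contraNneq vu => <-; rewrite permKV.
- apply: Or33; exists i => //; exists (p \o q); split=> [x y xvs yvs /= /perm_inj|x xvs /=|x y xvs yvs xy Nxy /=].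
  + exact: qI.
  + by rewrite pvs qv.
  + exact: qF.
Qed.

Variables (c : nat) (two : bool) (w : nat) (Ms : seq vset).
Hypothesis wm : w <= m.
Hypothesis k0 : 0 < k.
Hypothesis types_sym : forall i, symmetric (N (nth no_edges types i)).
Hypothesis cover : forall P : pred vtx, count P vs <= r -> exists2 M, M \in Ms & forall v, v \in vs -> P v -> vin v M.

Lemma leafGP s F : leafG k w Ms js univ types vs s -> target k c two false d0 vs (take w vtxs) F ->
  subrel (N s) F -> symmetric (N s) -> outcome F.
Proof.
rewrite /leafG => h tF NF sN; move: h; case: ifP => [red _|_].
  case: (redundantP red NF (tg_sym tF)) => [x y|v vvs]; first exact: (tg_edge tF).
  have := leq_trans k0 (tg_deg tF vvs); rewrite /degree -has_count => /hasP[u _ Fvu]; by exists u.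
case: ifP => [al _|_].
  apply: Or31 => I F0 g sF gI gF M0 j W jj cM et; have [M MM cov] := cover cM.
  have := allP (allP al M MM) j jj; rewrite eqbE => d.
  apply: (@deadP I F0 g vs gI s M (j == k) M0 j W _ cov et sF (take_uniq m uniq_vtxs) 12 (set_of (take w vtxs)) _ d).
    by move=> u v _ _ /NF/gF.
  move=> v; rewrite mem_set_of -(subnKC wm) takeD mem_cat => ->; by [].
case: ifP => [|_].
  case: ifP => // un /hasP[u uvs /iszP E] _; apply: Or32; split=> //; exists u => // v vvs vu.
  apply: NF; apply: contraT => nN.
  have : vin v (vdiff (vdiff (set_of vs) (vone u)) (nbh u s)).
    by rewrite vin_diff vin_diff mem_set_of vvs vin_one vu.
  by rewrite E vin0.
move=> hs; apply: Or33; set P := (fun t => _) in hs; exists (find P types); first by rewrite -has_find.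
have := nth_find no_edges hs; rewrite /P => /(embedsP (types_sym _) sN (take_uniq _ uniq_vtxs))[p [pa pI _ pp]].
exists p; split=> // [u uvs|u v uvs vvs uv].
  by have := pa u uvs; rewrite mem_set_of.
by have [h _] := pp u v uvs vvs uv => /h; apply: NF.
Qed.

Theorem task_outcome (hv : bool) (lim : nat) (F : rel vtx) (S : seq vtx) : 1 < w -> m <= 12 -> 0 < c -> k < 50 -> (hv -> w * 12 <= 63) ->
  task m k c two w hv lim (leafG k w Ms js univ types vs) ->
  target k c two false d0 vs (take w vtxs) F -> size S = w -> pairwise F S -> outcome F.
Proof.
move=> w2 m12 cpos k60 hv63 run tF sS pS.
apply: (taskP w2 wm m12 cpos k60 hv63 (Q := outcome) _ _ tF sS pS run).
  by move=> F1 p pv; apply: outcome_perm.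
by move=> s F1 lf tF1 NF sN; apply: (leafGP lf tF1 NF sN).
Qed.
End Outcome.

Lemma mem_take_vtxs m u : (u \in take m vtxs) = (vnat u < m).
Proof. by rewrite in_take ?mem_vtxs //; congr (_ < _); case: u. Qed.

Lemma nth_vnat u : nth x0 vtxs (vnat u) = u. Proof. by case: u. Qed.
Lemma vnat_nth i : i < 12 -> vnat (nth x0 vtxs i) = i.
Proof. by do 12 (case: i => [//|i]). Qed.

Definition singles (vs : seq vtx) : seq vset := map vone vs.
(** Equal entries are included. Replacing the contracted classes by a larger set is safe, since the
    clauses for contracted classes hold at every vertex. *)
Definition doubles (vs : seq vtx) : seq vset :=
  [seq vor (vone a) (vone b) | a <- vs, b <- [seq b <- vs | Nat.leb (vnat a) (vnat b)]].

Section Cover.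
Variables (vs : seq vtx) (P : pred vtx).
Hypothesis x0vs : x0 \in vs.
Hypothesis uvs : uniq vs.

Lemma cover0 : count P vs <= 0 -> exists2 M, M \in [:: v0] & forall v, v \in vs -> P v -> vin v M.
Proof.
rewrite leqn0 => /eqP c0; exists v0; rewrite ?inE // => v vvs Pv.
by have : has P vs by [apply/hasP; exists v]; rewrite has_count c0.
Qed.

Lemma in_support v : v \in vs -> P v -> v \in [seq v <- vs | P v].
Proof. by move=> vvs Pv; rewrite mem_filter Pv. Qed.

Lemma cover1 : count P vs <= 1 -> exists2 M, M \in singles vs & forall v, v \in vs -> P v -> vin v M.
Proof.
rewrite -size_filter; have := in_support; have : {subset [seq v <- vs | P v] <= vs} by exact: mem_subseq (filter_subseq _ _).
case: [seq v <- vs | P v] => [|a [|b l]] //= sub sup _.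
  by exists (vone x0); [apply: map_f | move=> v vvs /(sup v vvs)].
exists (vone a); first by apply/map_f/sub; rewrite inE.
by move=> v vvs /(sup v vvs); rewrite inE vin_one.
Qed.

Lemma mem_doubles a b : a \in vs -> b \in vs -> vnat a <= vnat b -> vor (vone a) (vone b) \in doubles vs.
Proof.
move=> avs bvs ab; apply/allpairsPdep; exists a, b; split=> //.
by rewrite mem_filter lebE ab.
Qed.

Lemma cover2 : count P vs <= 2 -> exists2 M, M \in doubles vs & forall v, v \in vs -> P v -> vin v M.
Proof.
rewrite -size_filter; have := in_support; have : {subset [seq v <- vs | P v] <= vs} by exact: mem_subseq (filter_subseq _ _).
case: [seq v <- vs | P v] => [|a [|b [|d l]]] //= sub sup _.
- by exists (vor (vone x0) (vone x0)); [apply: mem_doubles | move=> v vvs /(sup v vvs)].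
- exists (vor (vone a) (vone a)); first by apply: mem_doubles; rewrite ?sub ?inE.
  by move=> v vvs /(sup v vvs); rewrite inE vin_or vin_one => ->.
have avs : a \in vs by apply: sub; rewrite inE eqxx.
have bvs : b \in vs by apply: sub; rewrite !inE eqxx orbT.
case: (leqP (vnat a) (vnat b)) => ab.
  exists (vor (vone a) (vone b)); first exact: mem_doubles.
  by move=> v vvs /(sup v vvs); rewrite !inE vin_or !vin_one.
exists (vor (vone b) (vone a)); first by apply: mem_doubles => //; apply: ltnW.
by move=> v vvs /(sup v vvs); rewrite !inE vin_or !vin_one orbC.
Qed.
End Cover.

(** * Critical graphs on the vertices of the search *)

Section Push.
Variables (m' k : nat) (F1 : rel 'I_m'.+1).
Notation m := m'.+1.
Notation vs := (take m vtxs).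
Hypothesis m12 : m <= 12.
Hypothesis crF : critical k F1.

Definition inv (u : vtx) : 'I_m := inord (vnat u).
Definition vtx_of (i : 'I_m) : vtx := nth x0 vtxs i.
Definition push : rel vtx := fun u v => [&& u \in vs, v \in vs & F1 (inv u) (inv v)].

Lemma vtx_of_vs i : vtx_of i \in vs.
Proof. by rewrite mem_take_vtxs vnat_nth // (leq_trans (ltn_ord i)). Qed.
Lemma vtx_ofK : cancel vtx_of inv.
Proof. by move=> i; rewrite /inv vnat_nth ?inord_val // (leq_trans (ltn_ord i)). Qed.
Lemma invK u : u \in vs -> vtx_of (inv u) = u.
Proof. by rewrite mem_take_vtxs /vtx_of => h; rewrite inordK // nth_vnat. Qed.
Lemma inv_inj : {in vs &, injective inv}.
Proof. by move=> u v uvs vvs E; rewrite -(invK uvs) E invK. Qed.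
Lemma push_sym : symmetric push.
Proof. by move=> u v; rewrite /push (crit_sym crF); case: (u \in vs); case: (v \in vs). Qed.
Lemma push_irr : irreflexive push.
Proof. by move=> u; rewrite /push (crit_irr crF) !andbF. Qed.
Lemma push_supp u v : push u v -> (u \in vs) && (v \in vs).
Proof. by case/and3P=> -> ->. Qed.

(** A vertex of degree below [k] would leave a colour free in a colouring of the remaining
    vertices. *)
Lemma push_degree v : v \in vs -> k <= degree push v.
Proof.
move=> vvs; rewrite leqNgt; apply/negP=> lt; have [col [ck cF]] := crit_vertex crF (inv v).
pose l := [seq col (inv u) | u <- vtxs & push v u].
have : has (fun q => q \notin l) (iota 0 k).
  rewrite has_predC; apply/allP=> al; have := uniq_leq_size (iota_uniq 0 k) al.
  by rewrite size_iota size_map size_filter leqNgt lt.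
case/hasP=> q; rewrite mem_iota /= => qk ql.
apply: (crit_noncol crF); exists (fun i => if i == inv v then q else col i).
have inX i : i != inv v -> i \in [set~ inv v] by rewrite !inE.
have nb i : F1 (inv v) i -> q != col i.
  move=> Fi; apply: contraNneq ql => ->; apply/mapP; exists (vtx_of i); last by rewrite vtx_ofK.
  by rewrite mem_filter mem_vtxs andbT /push vvs vtx_of_vs vtx_ofK.
split=> [i _|i j _ _ Fij].
  by case: (eqVneq i (inv v)) => // iv; apply: ck; apply: inX.
case: (eqVneq i (inv v)) => [iv|iv]; case: (eqVneq j (inv v)) => [jv|jv].
- by rewrite iv jv (crit_irr crF) in Fij.
- by apply: nb; rewrite -iv.
- by rewrite eq_sym; apply: nb; rewrite -jv (crit_sym crF).
- by apply: cF => //; apply: inX.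
Qed.

Lemma push_target c two sb : clique_free c two push -> target k c two false d0 vs sb push.
Proof.
move=> cf; split=> //.
- exact: push_sym.
- exact: push_irr.
- exact: push_supp.
- case=> col [ck cF]; apply: (crit_noncol crF); exists (col \o vtx_of); split=> [i _|i j _ _ Fij].
    by apply: ck; rewrite inE vtx_of_vs.
  have Fp : push (vtx_of i) (vtx_of j) by rewrite /push !vtx_of_vs !vtx_ofK.
  by apply: (cF _ _ _ _ Fp); rewrite in_set vtx_of_vs.
- exact: push_degree.
- move=> x y /and3P[xvs yvs Fxy]; have [col [ck cF]] := crit_edge crF Fxy.
  exists (col \o inv); split=> [u _|u v _ _]; first by apply: ck; rewrite inE.
  case/and3P=> /and3P[uvs vvs Fuv] h1 h2; apply: cF; rewrite ?inE // /del_edge Fuv /=.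
  by rewrite !(inj_in_eq inv_inj) ?h1.
Qed.

Definition clique_bound (F : rel vtx) w := forall S : seq vtx, pairwise F S -> size S <= w.

Lemma omega (F : rel vtx) : irreflexive F -> exists w, (exists2 S, size S = w & pairwise F S) /\ clique_bound F w.
Proof.
move=> irrF; pose P w := [exists t : w.-tuple vtx, pairwise F t].
have P0 : exists w, P w by exists 0; apply/existsP; exists [tuple].
have Pb w : P w -> w <= 12.
  case/existsP=> t /(clique_uniq irrF) ut; have := uniq_leq_size ut (s2 := vtxs) (fun v _ => mem_vtxs v).
  by rewrite size_tuple.
case: (ex_maxnP P0 Pb) => w /existsP[t pt] mx; exists w; split; first by exists t; rewrite ?size_tuple.
by move=> S pS; apply: mx; apply/existsP; exists (in_tuple S).
Qed.

Lemma bound_free F w : clique_bound F w -> clique_free w false F.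
Proof.
move=> b B x y sB pB xB _ _; have := b (x :: B); rewrite /= xB pB sB ltnn; by move/(_ isT).
Qed.

Lemma kite_push : kite_free k F1 -> 1 < k -> clique_free k.-1 true push.
Proof.
move=> kf k1 B x y sB pB xB yB /(_ isT) xy; have uB := clique_uniq push_irr pB.
have Bvs b : b \in B -> b \in vs by move/(allP xB)/push_supp/andP=> [].
have sub z : all (push z) B -> z \in vs.
  case: (B) sB => [|b l] /=; first by move: k1; case: (k) => [|[]].
  by move=> _ /andP[/push_supp/andP[]].
have xvs := sub x xB; have yvs := sub y yB.
apply: (kf (inv x) (inv y) [set i in map inv B]).
- by rewrite (inj_in_eq inv_inj).
- rewrite cardsE (card_uniqP _) ?size_map ?sB ?prednK ?(ltnW k1) //.
  by rewrite map_inj_in_uniq // => u v /Bvs uvs /Bvs vvs; apply: inv_inj.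
- move=> i j; rewrite !inE => /mapP[a aB ->] /mapP[b bB ->] ab.
  have : a != b by apply: contraNneq ab => ->.
  by move/(pairwise_clique push_sym pB aB bB) => /and3P[].
- by move=> i; rewrite inE => /mapP[b bB ->]; have := allP xB b bB; rewrite (crit_sym crF) => /and3P[].
- by move=> i; rewrite inE => /mapP[b bB ->]; have := allP yB b bB; rewrite (crit_sym crF) => /and3P[].
Qed.

(** A clique of [k + 1] vertices contains a kite: [k - 1] of them form the base, the other two are
    the tips. *)
Lemma kite_bound : kite_free k F1 -> 1 < k -> clique_bound push k.
Proof.
move=> kf k1 [|a [|d B]] //= pS; first by apply: ltnW.
rewrite leqNgt; apply/negP=> lt.
have /and3P[/andP[ad /allP aB] /allP dB pB] := pS.
apply: (kite_push kf k1 (B := take k.-1 B) (x := a) (y := d)).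
- rewrite size_take; case: ltngtP => //; move: lt k1; lia.
- by move: pB; rewrite -{1}(cat_take_drop k.-1 B) pairwise_cat => /and3P[].
- by apply/allP=> b /mem_take/aB.
- by apply/allP=> b /mem_take/dB.
- by move=> _; apply: contraTneq ad => ->; rewrite push_irr.
Qed.

(** A vertex outside the clique could be deleted, and criticality would colour [k + 1] pairwise
    adjacent vertices with [k] colours. *)
Lemma clique_complete S : 0 < k -> pairwise push S -> size S = k.+1 ->
  m = k.+1 /\ forall u v, u \in vs -> v \in vs -> u != v -> push u v.
Proof.
move=> k0 pS kS; have uS := clique_uniq push_irr pS.
have Svs : {subset S <= vs} by apply: clique_sub pS push_supp; rewrite kS.
have inS u : u \in vs -> u \in S.
  move=> uvs; apply: contraT => uS'; have [col [ck cF]] := crit_vertex crF (inv u).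
  have inX x : x \in S -> inv x \in [set~ inv u].
    by move=> xS; rewrite in_setC in_set1; apply: contraNneq uS' => E; rewrite -(inv_inj (Svs x xS) uvs E).
  have : uniq (map (col \o inv) S).
    rewrite map_inj_in_uniq // => x y xS yS /= E; apply/eqP; apply: contraT => xy.
    have /and3P[_ _ Fxy] := pairwise_clique push_sym pS xS yS xy.
    by have := cF _ _ (inX x xS) (inX y yS) Fxy; rewrite E eqxx.
  move/uniq_leq_size => /(_ (iota 0 k)); rewrite size_map size_iota kS ltnn; apply.
  by move=> _ /mapP[x xS ->]; rewrite mem_iota /= ck // inX.
split; last by move=> u v uvs vvs uv; apply: (pairwise_clique push_sym pS); rewrite ?inS.
have sv : size vs = m by rewrite size_take_min; apply/minn_idPl.
by apply/eqP; rewrite eqn_leq -sv -{1 2}kS (uniq_leq_size (take_uniq _ uniq_vtxs) inS) (uniq_leq_size uS Svs).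
Qed.
End Push.

(** * The listed graphs *)

(* A family of triples: [third T a b] is the set of [c] with [(a, b, c)] in the family. *)
Definition third (T : seq state) (a b : vtx) : vset := nbh b (nth no_edges T (vnat a)).

(** One step of the descent to the largest family of triples that survives all attacks. For fixed
    [a] and [b] all third guards are filtered at once: against an attack on [v], a third guard stays
    if it equals [v], if [a] or [b] can move to [v] within the family, or if it can itself move to
    [v]. *)
Definition refine (s : state) (vs : seq vtx) (T : seq state) : seq state :=
  let V := set_of vs in
  map (fun a => foldr (fun b r =>
      let z := foldr (fun v z =>
        if vtxb v a then z else if vtxb v b then z else
        let h := nbh v s in
        vand z (vor (vone v) (vor (if vin a h then v0 else third T v b)
          (vor (if vin b h then v0 else third T a v) (if vin v (third T a b) then vdiff V h else v0)))))
        (third T a b) vs in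
      upd b (fun=> Row z v0) r) no_edges vs) vs.
Definition start (vs : seq vtx) : seq state :=
  let V := set_of vs in
  map (fun a => foldr (fun b r => if vtxb a b then r else
    upd b (fun=> Row (vdiff (vdiff V (vone a)) (vone b)) v0) r) no_edges vs) vs.
Definition closed (s : state) (vs : seq vtx) (T : seq state) : bool :=
  let V := set_of vs in
  all (fun a => all (fun b => all (fun c =>
    if vtxb a b then false else if vtxb a c then false else if vtxb b c then false else
    if vin c V then all (fun v =>
      if vtxb v a then true else if vtxb v b then true else if vtxb v c then true else
      let h := nbh v s in
      if (if vin a h then false else vin c (third T v b)) then true else
      if (if vin b h then false else vin c (third T a v)) then true else
      if vin c h then false else vin v (third T a b)) vs else false)
    (vlist (third T a b))) vs) vs.
(** Nothing is claimed about convergence after 12 steps: [closed] tests the resulting family,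
    including that the three guards are distinct. *)
Definition winning (s : state) (vs : seq vtx) : bool :=
  let T := iter 12 (refine s vs) (start vs) in
  if closed s vs T then has (fun a => has (fun b => ~~ isz (third T a b)) vs) vs else false.

Section Closed.
Variables (I : finType) (F : rel I) (f : I -> vtx) (s : state) (vs : seq vtx).
Hypothesis fI : injective f.
Hypothesis fvs : forall i, f i \in vs.
Hypothesis fS : forall v, v \in vs -> exists i, f i = v.
Hypothesis FN : forall i j, F i j = N s (f i) (f j).
Hypothesis symF : symmetric F.

Lemma set3_move1 (a b c v : I) : a != b -> a != c -> move [set a; b; c] a v = [set v; b; c].
Proof. by move=> ab ac; apply/setP=> x; rewrite !inE; case: (eqVneq x a) => [->|_]; rewrite ?(negbTE ab) ?(negbTE ac) ?orbF //= !orbA. Qed.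
Lemma set3_move2 (a b c v : I) : a != b -> b != c -> move [set a; b; c] b v = [set a; v; c].
Proof.
move=> ab bc; apply/setP=> x; rewrite !inE; case: (eqVneq x b) => [->|_] /=.
  by rewrite [b == a]eq_sym (negbTE ab) (negbTE bc) !orbF.
by case: (x == a); case: (x == v); case: (x == c).
Qed.
Lemma set3_move3 (a b c v : I) : a != c -> b != c -> move [set a; b; c] c v = [set a; b; v].
Proof.
move=> ac bc; apply/setP=> x; rewrite !inE; case: (eqVneq x c) => [->|_] /=.
  by rewrite [c == a]eq_sym (negbTE ac) [c == b]eq_sym (negbTE bc) !orbF.
by case: (x == a); case: (x == v); case: (x == b).
Qed.

Lemma winning_eternal : winning s vs -> exists W, eternal F set0 setT 3 true W.
Proof.
rewrite /winning; move: (iter _ _ _) => T; case: ifP => // cl ne.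
pose W := [set R | [exists a, exists b, exists c, (R == [set a; b; c]) && vin (f c) (third T (f a) (f b))]].
have inW a b c : vin (f c) (third T (f a) (f b)) -> [set a; b; c] \in W.
  by move=> h; rewrite inE; apply/existsP; exists a; apply/existsP; exists b; apply/existsP; exists c; rewrite eqxx.
have WP R : R \in W -> exists a b c, [/\ R = [set a; b; c], a != b, a != c, b != c &
    forall v, v \notin R -> exists x, [/\ x \in R, ~~ F x v & move R x v \in W]].
  rewrite inE => /existsP[a /existsP[b /existsP[c /andP[/eqP-> h]]]]; exists a, b, c.
  have := allP (allP (allP cl _ (fvs a)) _ (fvs b)) (f c); rewrite mem_vlist => /(_ h).
  rewrite !vtxbE !(inj_eq fI); case: eqVneq => // ab; case: eqVneq => // ac; case: eqVneq => // bc.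
  case: ifP => // _ /allP al; split=> // v; rewrite !inE => /norP[/norP[va vb] vc].
  have := al _ (fvs v); rewrite !vtxbE !(inj_eq fI) (negbTE va) (negbTE vb) (negbTE vc).
  have nF x : vin (f x) (nbh (f v) s) = false -> ~~ F x v by rewrite symF FN /N => ->.
  rewrite /=; case: ifP => [|_].
    by case: ifP => // /nF na /inW vW _; exists a; split; rewrite ?set3_move1 // !inE eqxx.
  case: ifP => [|_].
    by case: ifP => // /nF nb /inW vW _; exists b; split; rewrite ?set3_move2 // !inE eqxx orbT.
  by case: ifP => // /nF nc /inW vW; exists c; split; rewrite ?set3_move3 // !inE eqxx orbT.
exists W; split.
- have /hasP[a avs /hasP[b bvs /iszN[c cT]]] := ne.
  have cvs : c \in vs.
    have := allP (allP (allP cl _ avs) _ bvs) c; rewrite mem_vlist => /(_ cT).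
    by do 3 (case: ifP => // _); case: ifP => //; rewrite mem_set_of.
  have [[i iE] [[j jE] [l lE]]] := (fS avs, (fS bvs, fS cvs)).
  by exists [set i; j; l]; apply: inW; rewrite iE jE lE.
- move=> R /WP[a [b [c [-> ab ac bc _]]]]; split; first exact: subsetT.
  by rewrite -setUA cardsU1 !inE negb_or ab ac cards2 bc.
- by move=> R v /WP[a [b [c [_ _ _ _ h]]]] _ /h[x [xR _ xW]]; exists x.
- by move=> R v /WP[a [b [c [_ _ _ _ h]]]] _ /h[x [xR nF xW]] _; exists x.
- move=> R v y /WP[a [b [c [_ _ _ _ h]]]] _ /h[x [xR nF xW]] Fy; exists x; split=> //.
  by apply: contraNneq nF => ->.
- by move=> _ R v /WP[a [b [c [_ _ _ _ h]]]] _ /h[x [xR nF xW]]; exists x.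
Qed.
End Closed.

Definition co_graph (str : string) : state :=
  let n := g6_order str in let bs := g6_bits str in
  foldr (fun j s => foldr (fun i s => if nth false bs ('C(j, 2) + i) then s
    else set_edge (nth x0 vtxs i) (nth x0 vtxs j) s) s (iota 0 j)) no_edges (iota 0 n).
(** For every listed graph three guards win while the complement has no 3-colouring. Comparing
    [co_graph] with the bits entry by entry avoids reasoning about the folds that build it. *)
Definition listed_ok (n : nat) (str : string) : bool :=
  let s := co_graph str in let vs := take n vtxs in let bs := g6_bits str in
  if g6_order str == n then
    if all (fun i => all (fun j => vin (nth x0 vtxs j) (nbh (nth x0 vtxs i) s) ==
      (i != j) && ~~ ((i != j) && nth false bs ('C(maxn i j, 2) + minn i j))) (iota 0 n)) (iota 0 n)
    then if winning s vs then ~~ col_search s vs [::] 3 else false else false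
  else false.

Lemma listedP n str : listed_ok n str -> [/\ g6_order str = n,
  forall i j, i < n -> j < n -> N (co_graph str) (nth x0 vtxs i) (nth x0 vtxs j) =
    (i != j) && ~~ ((i != j) && nth false (g6_bits str) ('C(maxn i j, 2) + minn i j)),
  winning (co_graph str) (take n vtxs) & ~~ col_search (co_graph str) (take n vtxs) [::] 3].
Proof.
rewrite /listed_ok; case: eqP => // oE; case: ifP => // al; case: ifP => // wi nc; split=> // i j il jl.
by apply/eqP; apply: (allP (allP al i _) j); rewrite mem_iota.
Qed.

Lemma co_graphE n str (x y : graph6 str) : n <= 12 -> listed_ok n str ->
  N (co_graph str) (nth x0 vtxs x) (nth x0 vtxs y) = nonadj x y.
Proof.
move=> n12 /listedP[oE NE _ _]; have lt (z : 'I_(g6_order str)) : z < n by rewrite -[X in _ < X]oE.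
by rewrite NE ?lt // /nonadj /= /g6_adj -val_eqE /=.
Qed.

Lemma listed_bad n (G : sgraph) str : n <= 12 -> listed_ok n str -> isomorphic G (graph6 str) ->
  eternal_domination_number G < clique_covering_number G.
Proof.
move=> n12 lok [f bf fadj]; have [oE NE wi nc] := listedP lok; have [f' fK f'K] := bf.
pose h (x : G) : vtx := nth x0 vtxs (f x).
have lt (z : 'I_(g6_order str)) : z < n by rewrite -[X in _ < X]oE.
have hvs x : h x \in take n vtxs by rewrite mem_take_vtxs vnat_nth ?lt // (leq_trans (lt _)).
have hI : injective h.
  move=> x y /(congr1 vnat); rewrite !vnat_nth ?(leq_trans (lt _)) // => /val_inj E.
  exact: (bij_inj bf).
have hS v : v \in take n vtxs -> exists x, h x = v.
  rewrite mem_take_vtxs => vn; have vo : vnat v < g6_order str by rewrite oE.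
  by exists (f' (Ordinal vo)); rewrite /h f'K /= nth_vnat.
have hN x y : nonadj x y = N (co_graph str) (h x) (h y).
  by rewrite (co_graphE _ _ n12 lok) /nonadj fadj (inj_eq (bij_inj bf)).
have [W etW] := winning_eternal hI hvs hS hN (@nonadj_sym G) wi.
have gs : guards_suffice G 3 := eternal_guards etW.
have le3 : eternal_domination_number G <= 3.
  by rewrite /eternal_domination_number; case: ex_minnP => k _; apply; apply/boolp.asboolP.
apply: leq_ltn_trans le3 _; rewrite ltnNge; apply/negP=> /cover_colorable[c [ck cF]].
apply: (col_searchP (fun _ _ h => h) nc).
pose h' v := if [pick x | h x == v] is Some x then c x else 0.
have h'E x : h' (h x) = c x.
  by rewrite /h'; case: pickP => [y /eqP/hI-> //|/(_ x)]; rewrite eqxx.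
exists h'; split=> [v|u v]; rewrite !in_set; first by move=> /hS[x <-]; rewrite h'E ck.
by move=> /hS[x <-] /hS[y <-]; rewrite -hN !h'E; apply: cF.
Qed.

Lemma listed_iso n (G : sgraph) str (g : vtx -> G) : n <= 12 -> listed_ok n str -> #|G| = n ->
  {in take n vtxs &, injective g} ->
  {in take n vtxs &, forall u v, u != v -> N (co_graph str) u v = nonadj (g u) (g v)} ->
  isomorphic G (graph6 str).
Proof.
move=> n12 lok cG gI gN; have [oE _ _ _] := listedP lok.
have lt (z : 'I_(g6_order str)) : z < n by rewrite -[X in _ < X]oE.
have vvs (z : 'I_(g6_order str)) : nth x0 vtxs z \in take n vtxs.
  by rewrite mem_take_vtxs vnat_nth ?lt // (leq_trans (lt _)).
pose h (z : graph6 str) : G := g (nth x0 vtxs z).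
have hI : injective h.
  move=> x y /gI E; have /(congr1 vnat) := E (vvs x) (vvs y).
  by rewrite !vnat_nth ?(leq_trans (lt _)) // => /val_inj.
have bh : bijective h by apply: inj_card_bij hI _; rewrite cG card_ord oE.
have hadj x y : adj (h x) (h y) = adj x y.
  case: (eqVneq x y) => [->|xy]; first by rewrite !adj_irr.
  have E : nonadj (h x) (h y) = nonadj x y.
    rewrite -(co_graphE _ _ n12 lok) gN ?vvs //.
    by apply: contraNneq xy => /(congr1 vnat); rewrite !vnat_nth ?(leq_trans (lt _)) // => /val_inj ->.
  by move: E; rewrite /nonadj (inj_eq hI) xy /= => /negb_inj.
have [h' hK h'K] := bh; exists h'; first by exists h.
by move=> x y; rewrite -{2}(h'K x) -{2}(h'K y) hadj.
Qed.

(** Twice the number of edges, capped at 63: a cheap invariant compared before an isomorphism is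
    searched for. *)
Definition weight_of (vs : seq vtx) (s : state) : digit := foldr (fun v n => addd (pc (nbh v s)) n) d0 vs.
Definition has_copy (pats : seq state) (vs : seq vtx) (s : state) : bool :=
  let V := set_of vs in let n := weight_of vs s in
  has (fun p => if eqd (weight_of vs p) n then embeds true p s vs [::] V else false) pats.

(* [ps] lists the pairs that may still become edges *)
Fixpoint sup (pats : seq state) (vs : seq vtx) (n : nat) (s : state) (ps : seq (vtx * vtx)) {struct n} : bool :=
  match n with 0 => false | n.+1 =>
  if universal vs s then true else
  if dead 12 s vs v0 v0 true 3 then true else
  if has_copy pats vs s then
    (fix go (ps : seq (vtx * vtx)) : bool := match ps with [::] => true
      | p :: ps => let: (u, v) := p in
        if vin v (nbh u s) then go ps else
        if sup pats vs n (set_edge u v s) ps then go ps else false end) ps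
  else false end.
Fixpoint all_pairs (vs : seq vtx) : seq (vtx * vtx) :=
  match vs with [::] => [::] | v :: vs => map (fun u => (v, u)) vs ++ all_pairs vs end.

Definition pats10 := Eval vm_compute in map co_graph L10.
Definition pats11 := Eval vm_compute in map co_graph L11.

Fixpoint splits (pats : seq state) (vs : seq vtx) (v d : vtx) (s : state) (ws : seq vtx) : bool :=
  match ws with
  | [::] => sup pats vs 30 s (all_pairs vs)
  | w :: ws => if (if vin w (nbh v s) then true else vin w (nbh d s)) then splits pats vs v d s ws else
    if splits pats vs v d (set_edge v w s) ws then splits pats vs v d (set_edge d w s) ws else false
  end.
(* By the symmetry between [v] and [x10], the first neighbour may be given to [v]. *)
Definition split_case (v y1 y2 : vtx) : bool :=
  let vs := take 11 vtxs in
  let s := foldr (fun w s => cut v w s) crit10 (vlist (nbh v crit10)) in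
  let s := foldr (fun p s => set_edge p.1 p.2 s) s [:: (y1, y2); (v, y1); (v, y2); (x10, y1); (x10, y2)] in
  match [seq w <- vlist (nbh v crit10) | if vtxb w y1 then false else ~~ vtxb w y2] with
  | [::] => splits pats11 vs v x10 s [::]
  | w :: ws => splits pats11 vs v x10 (set_edge v w s) ws
  end.
Definition all_splits : bool :=
  all (fun v => all (fun p => if vtxb p.1 v then true else if vtxb p.2 v then true else split_case v p.1 p.2)
    (all_pairs (take 10 vtxs))) (take 10 vtxs).

Lemma N_set_sym s u v : u != v -> symmetric (N s) -> symmetric (N (set_edge u v s)).
Proof. by move=> uv sN x y; rewrite !N_set // sN -!orbA; congr (_ || _); rewrite orbC andbC [X in _ || X]andbC. Qed.

Lemma N_cut_sym s u v : u != v -> symmetric (N s) -> symmetric (N (cut u v s)).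
Proof. by move=> uv sN x y; rewrite !N_cut // sN; congr (_ && _); rewrite andbC andbC [(y == v) && _]andbC [(y == u) && _]andbC andbC. Qed.

Lemma mem_all_pairs vs u v : u \in vs -> v \in vs -> u != v -> (u, v) \in all_pairs vs \/ (v, u) \in all_pairs vs.
Proof.
elim: vs => //= x vs IH; rewrite !inE !mem_cat => /orP[/eqP->|uvs] /orP[/eqP->|vvs] uv.
- by rewrite eqxx in uv.
- by left; rewrite map_f.
- by right; rewrite map_f.
- by case: (IH uvs vvs uv) => ->; rewrite !orbT; [left | right].
Qed.

Lemma all_pairs_sub vs p : uniq vs -> p \in all_pairs vs -> [/\ p.1 \in vs, p.2 \in vs & p.1 != p.2].
Proof.
elim: vs => //= x vs IH /andP[xvs uvs]; rewrite mem_cat => /orP[/mapP[y yvs ->]|/(IH uvs)[h1 h2 h3]] /=.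
  by rewrite !inE eqxx yvs orbT; split=> //; apply: contraNneq xvs => ->.
by rewrite !inE h1 h2 !orbT.
Qed.

(** * Supergraphs of the exceptions *)

Section Sup.
Variables (pats : seq state) (vs : seq vtx).
Hypothesis pats_sym : forall i, symmetric (N (nth no_edges pats i)).
Hypothesis uvs : uniq vs.
Variables (I : finType) (F0 : rel I) (g : vtx -> I) (W : {set {set I}}).
Hypothesis gI : {in vs &, injective g}.
Hypothesis symF : symmetric F0.
Hypothesis irrF : irreflexive F0.
Hypothesis etW : eternal F0 set0 [set g v | v in vs] 3 true W.

Definition below s := {in vs &, forall u v, N s u v -> F0 (g u) (g v)}.
Definition within s (ps : seq (vtx * vtx)) :=
  {in vs &, forall u v, F0 (g u) (g v) -> [|| N s u v, (u, v) \in ps | (v, u) \in ps]}.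
Definition settled :=
  (exists2 i, i < size pats & exists p : vtx -> vtx, [/\ {in vs &, injective p}, forall u, u \in vs -> p u \in vs &
     {in vs &, forall u v, u != v -> N (nth no_edges pats i) u v = F0 (g (p u)) (g (p v))}]) \/
  (exists2 u, u \in vs & forall v, v \in vs -> v != u -> F0 (g u) (g v)).

Lemma below_set s u v : u \in vs -> v \in vs -> u != v -> F0 (g u) (g v) -> below s -> below (set_edge u v s).
Proof.
move=> uv_ vv uv Fuv b x y xvs yvs; rewrite N_set // => /orP[/orP[|/andP[/eqP-> /eqP->]]|/andP[/eqP-> /eqP->]] //.
  exact: b.
by rewrite symF.
Qed.

(** A universal vertex or a win of the attacker persists when edges are added, so the branch ends
    there. Otherwise [s] itself is listed, and a larger complement is classified by its first new
    edge among [ps]; the pairs before that edge are non-edges and drop out. *)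
Lemma supP n s ps : symmetric (N s) -> below s -> within s ps ->
  (forall p, p \in ps -> [/\ p.1 \in vs, p.2 \in vs & p.1 != p.2]) -> sup pats vs n s ps -> settled.
Proof.
elim: n s ps => //= n IH s ps sN b wi psP.
case: ifP => [/hasP[u uvs' /iszP E] _|_].
  right; exists u => // v vvs vu; apply: b => //; apply: contraT => nN.
  have : vin v (vdiff (vdiff (set_of vs) (vone u)) (nbh u s)) by rewrite vin_diff vin_diff mem_set_of vvs vin_one vu.
  by rewrite E vin0.
case: ifP => [d _|_].
  by case: (@deadP I F0 g vs gI s v0 true set0 3 W b _ etW symF uvs 12 v0 _ d) => [v|v]; rewrite ?inE ?vin0.
case: ifP => // cp; elim: ps wi psP => [|[u v] ps IHp] wi psP /=.
  move=> _; left; move: cp; rewrite /has_copy; set P := (fun p => _) => hs; exists (find P pats); first by rewrite -has_find.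
  have := nth_find no_edges hs; rewrite {1}/P; case: ifP => // _ /(embedsP (pats_sym _) sN uvs)[p [pa pI _ pp]].
  have pvs u : u \in vs -> p u \in vs by move=> /pa; rewrite mem_set_of.
  exists p; split=> // u v uv_ vv uv; have [h1 h2] := pp u v uv_ vv uv.
  apply/idP/idP => [/h1|Fuv]; first by apply: b; apply: pvs.
  apply: contraT => /(h2 isT); have := wi _ _ (pvs u uv_) (pvs v vv) Fuv; by rewrite !in_nil !orbF => ->.
have [/= uv_ vv uv] := psP (u, v) (mem_head _ _).
have psP' p : p \in ps -> [/\ p.1 \in vs, p.2 \in vs & p.1 != p.2] by move=> h; apply: psP; rewrite inE h orbT.
have skip : (F0 (g u) (g v) -> N s u v) -> within s ps.
  move=> h x y xvs yvs Fxy; have := wi x y xvs yvs Fxy; rewrite !inE !xpair_eqE.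
  case/or3P=> [->//|/orP[/andP[/eqP xu /eqP yv]|->]|/orP[/andP[/eqP yu /eqP xv]|->]]; rewrite ?orbT //.
    by rewrite xu yv h -?xu -?yv.
  by rewrite yu xv sN h // symF -yu -xv.
case: ifP => [Nuv|_]; first by apply: IHp => //; apply: skip.
case sp: (sup _ _ _ _ _) => //; case Fuv: (F0 (g u) (g v)); last by apply: IHp => //; apply: skip; rewrite Fuv.
move=> _; apply: IH sp => //; [exact: N_set_sym | exact: below_set |].
move=> x y xvs yvs Fxy; have := wi x y xvs yvs Fxy; rewrite N_set // !inE !xpair_eqE [(y == u) && _]andbC.
by case: (N s x y); case: ((x == u) && _); case: ((x == v) && _); rewrite ?orbT.
Qed.

Lemma sup_all s : symmetric (N s) -> below s -> sup pats vs 30 s (all_pairs vs) -> settled.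
Proof.
move=> sN b; apply: supP => // [x y xvs yvs Fxy|p]; last exact: all_pairs_sub.
have xy : x != y by apply: contraTneq Fxy => ->; rewrite irrF.
by case: (mem_all_pairs xvs yvs xy) => ->; rewrite !orbT.
Qed.

(** A vertex joined to the class is joined to [v] or to [d]. The case of both needs no branch of its
    own, since [sup] finally runs through all supergraphs. *)
Lemma splitsP v d s ws : v \in vs -> d \in vs -> symmetric (N s) -> below s ->
  (forall w, w \in ws -> [&& w \in vs, w != v, w != d & F0 (g v) (g w) || F0 (g d) (g w)]) ->
  splits pats vs v d s ws -> settled.
Proof.
move=> vvs dvs; elim: ws s => [|w ws IH] s sN b H /=; first exact: sup_all.
have H' x : x \in ws -> [&& x \in vs, x != v, x != d & F0 (g v) (g x) || F0 (g d) (g x)] by move=> h; apply: H; rewrite inE h orbT.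
have /and4P[wvs wv wd] := H w (mem_head _ _).
case: ifP => _; first by move=> _; apply: IH.
case: ifP => // s1 /orP[Fw|Fw] s2.
  by apply: IH s1 => //; [apply: N_set_sym; rewrite // eq_sym | apply: below_set; rewrite // eq_sym].
by apply: IH s2 => //; [apply: N_set_sym; rewrite // eq_sym | apply: below_set; rewrite // eq_sym].
Qed.

End Sup.

(** * The computations *)

Definition multi_sets (r : nat) (vs : seq vtx) : seq vset :=
  match r with 0 => [:: v0] | 1 => singles vs | _ => doubles vs end.
(** The degree test needs [12 * w] to stay within the cap of 63, hence [w] at most 5. The number 60
    is the fuel of the colouring search. *)
Definition run (m k r : nat) (js : seq nat) (univ : bool) (types : seq state) (w c : nat) (two : bool) : bool :=
  task m k c two w (if Nat.leb w 5 then ~~ (if Nat.eqb k 4 then Nat.eqb w 4 else false) else false) 60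
    (leafG k w (multi_sets r (take m vtxs)) js univ types (take m vtxs)).
(** The clique number of a kite-free graph is at most [k]. For small [k] the seed is a maximum
    clique, with larger cliques excluded below [k] and kites excluded at [k]. For larger [k] all
    graphs with clique number at least 4 share a seed of four vertices, which keeps the list of
    types short. *)
Definition kite_free_tasks (m k r : nat) (js : seq nat) (univ : bool) (types : seq state) : bool :=
  if Nat.leb k 5 then
    if all (fun w => run m k r js univ types w w false) (iota 2 (k - 2)) then run m k r js univ types k k.-1 true else false
  else if run m k r js univ types 2 2 false then
    if run m k r js univ types 3 3 false then run m k r js univ types 4 k.-1 true else false else false.
Definition free_tasks (m k : nat) : bool :=
  all (fun w => run m k 2 (iota 0 k.+1) false [::] w w false) (iota 2 k.-1).
Definition complete (m : nat) : state := foldr (fun p s => set_edge p.1 p.2 s) no_edges (all_pairs (take m vtxs)).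
Definition complete_dead (m : nat) : bool :=
  let vs := take m vtxs in
  all (fun M => all (fun j => dead 12 (complete m) vs (set_of vs) M (Nat.eqb j m.-1) j) (iota 0 m)) (doubles vs).

Definition sym_state (s : state) : bool := all (fun u => all (fun v => N s u v == N s v u) vtxs) vtxs.
Lemma sym_states l : all sym_state l -> forall i, symmetric (N (nth no_edges l i)).
Proof.
move=> al i u v; case: (ltnP i (size l)) => il.
  by have := all_nthP no_edges al i il => /allP/(_ u (mem_vtxs u))/allP/(_ v (mem_vtxs v))/eqP.
by rewrite nth_default //; case: u; case: v.
Qed.

Lemma N_complete m u v : N (complete m) u v -> [/\ u \in take m vtxs, v \in take m vtxs & u != v].
Proof.
rewrite /complete; have : {subset all_pairs (take m vtxs) <= all_pairs (take m vtxs)} by [].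
elim: {1 3}(all_pairs _) => [|p l IH] sub /=; first by rewrite /N; case: u; case: v.
have [h1 h2 h3] : [/\ p.1 \in take m vtxs, p.2 \in take m vtxs & p.1 != p.2].
  have : p \in all_pairs (take m vtxs) by apply: sub; rewrite inE eqxx.
  move: (take_uniq m uniq_vtxs); elim: (take m vtxs) => //= x vs IHv /andP[xvs uvs].
  rewrite mem_cat => /orP[/mapP[y yvs ->]|/(IHv uvs)[g1 g2 g3]] /=; last by rewrite !inE g1 g2 !orbT.
  by rewrite !inE eqxx yvs orbT; split=> //; apply: contraNneq xvs => ->.
rewrite N_set // => /orP[/orP[|/andP[/eqP-> /eqP->]]|/andP[/eqP-> /eqP->]].
- by apply: IH => q h; apply: sub; rewrite inE h orbT.
- by split.
- by split; rewrite // eq_sym.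
Qed.

Section Tasks.
Variables (m' k : nat) (F1 : rel 'I_m'.+1).
Notation m := m'.+1.
Notation vs := (take m vtxs).
Hypothesis m12 : m <= 12.
Hypothesis k2 : 1 < k.
Hypothesis k50 : k < 50.
Hypothesis crF : critical k F1.
Variables (r : nat) (js : seq nat) (univ : bool) (types : seq state).
Hypothesis types_sym : forall i, symmetric (N (nth no_edges types i)).
Notation F := (push F1).
Notation outcome := (outcome m k r js univ types).

Let x0vs : x0 \in vs. Proof. by rewrite mem_take_vtxs. Qed.

Lemma cover_multi (P : pred vtx) : r <= 2 -> count P vs <= r ->
  exists2 M, M \in multi_sets r vs & forall v, v \in vs -> P v -> vin v M.
Proof. by case: r => [|[|[|]]] // _; [apply: cover0 | apply: cover1 | apply: cover2]. Qed.

Lemma run_outcome w c two S : r <= 2 -> 1 < w -> 0 < c -> run m k r js univ types w c two -> clique_free c two F ->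
  size S = w -> pairwise F S -> outcome F.
Proof.
move=> r2 w2 c0 rn cf sS pS.
have wm : w <= m.
  have := uniq_leq_size (clique_uniq (push_irr crF) pS) (clique_sub _ pS (@push_supp _ F1)).
  by rewrite sS size_take_min => /(_ w2)/leq_trans; apply; apply: geq_minl.
apply: (task_outcome wm (ltnW k2) types_sym _ w2 m12 c0 k50 _ rn _ sS pS).
- by move=> P; apply: cover_multi.
- by rewrite lebE; case: ifP => // w5 _; move: w5; case: (w) => [|[|[|[|[|[|]]]]]].
- exact: push_target.
Qed.

Lemma kite_free_outcome : r <= 2 -> kite_free k F1 -> kite_free_tasks m k r js univ types -> outcome F.
Proof.
move=> r2 kf; rewrite /kite_free_tasks lebE.
have [w [[S sS pS] wb]] := omega (push_irr crF).
have wk : w <= k by rewrite -sS; apply: (kite_bound m12 crF kf k2).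
have w2 : 1 < w.
  have := leq_trans (ltnW k2) (push_degree m12 crF x0vs); rewrite /degree -has_count => /hasP[u _ Fu].
  by apply: (wb [:: x0; u]); rewrite /= Fu.
have cfw : clique_free w false F := bound_free wb.
have cfk := kite_push crF kf k2.
have k10 : 0 < k.-1 by case: (k) k2 => [|[]].
case: ifP => [k5|_].
  case: ifP => // /allP al rk; case: (eqVneq w k) => [E|wk'].
    by apply: (run_outcome r2 k2 k10 rk cfk _ pS); rewrite sS.
  apply: (run_outcome r2 w2 (ltnW w2) _ cfw sS pS); apply: al; rewrite mem_iota w2 subnKC //.
  by rewrite ltn_neqAle wk' wk.
case: ifP => // r_2; case: ifP => // r_3 r_4.
case: (ltngtP w 3) => [w3|w3|E].
- have E : w = 2 by apply/eqP; rewrite eqn_leq -ltnS w3 w2.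
  by rewrite E in cfw sS; apply: (run_outcome r2 _ _ r_2 cfw sS pS).
- apply: (run_outcome r2 _ k10 r_4 cfk (S := take 4 S)) => //; first by rewrite size_takel // sS.
  by move: pS; rewrite -{1}(cat_take_drop 4 S) pairwise_cat => /and3P[].
- by rewrite E in cfw sS; apply: (run_outcome r2 _ _ r_3 cfw sS pS).
Qed.
End Tasks.

(** Clique numbers from 2 to [k] are covered by the enumeration. A larger clique makes the critical
    graph complete on [k + 1] vertices, which is attacked directly. *)
Lemma free_dead m' k (F1 : rel 'I_m'.+1) : m' < 12 -> 1 < k -> k < 50 -> critical k F1 ->
  free_tasks m'.+1 k -> complete_dead m'.+1 -> dead_end m'.+1 k 2 (iota 0 k.+1) (push F1).
Proof.
move=> m12 k2 k50 crF ft cd.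
have x0vs : x0 \in take m'.+1 vtxs by rewrite mem_take_vtxs.
have [w [[S sS pS] wb]] := omega (push_irr crF).
have w2 : 1 < w.
  have := leq_trans (ltnW k2) (push_degree m12 crF x0vs); rewrite /degree -has_count => /hasP[u _ Fu].
  by apply: (wb [:: x0; u]); rewrite /= Fu.
have ts : forall i, symmetric (N (nth no_edges (@nil state) i)) by apply: sym_states.
case: (leqP w k) => [wk|kw].
  have rn : run m'.+1 k 2 (iota 0 k.+1) false [::] w w false.
    by apply: (allP ft); rewrite mem_iota w2 add2n prednK ?ltnS // ltnW.
  by case: (run_outcome m12 k2 k50 crF ts (leqnn 2) w2 (ltnW w2) rn (bound_free wb) sS pS) => [//|[]|[]].
have [mE full] : m'.+1 = k.+1 /\ forall u v, u \in take m'.+1 vtxs -> v \in take m'.+1 vtxs -> u != v -> push F1 u v.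
  apply: (clique_complete m12 crF (S := take k.+1 S) (ltnW k2)); last by rewrite size_takel // sS.
  by move: pS; rewrite -{1}(cat_take_drop k.+1 S) pairwise_cat => /and3P[].
move=> I F0 g sF gI gF M0 j W jj cM et.
have [M MM cov] := cover2 x0vs cM.
have := allP (allP cd M MM) j; rewrite mE => /(_ jj); rewrite eqbE /= => d.
apply: (@deadP I F0 g (take m'.+1 vtxs) gI (complete m'.+1) M (j == k) M0 j W _ cov et sF (take_uniq _ uniq_vtxs) 12 (set_of (take m'.+1 vtxs))).
- by move=> u v _ _ /N_complete[h1 h2 h3]; apply: gF; apply: full.
- by move=> v; rewrite mem_set_of.
- by rewrite mE.
Qed.

(** On at most 9 vertices the attacker wins on every critical graph, kites or not, even with two
    contracted classes and any number of guards up to [k]. *)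
Lemma free_ok : all (fun m => if all (fun k => free_tasks m k) (iota 2 (m - 2)) then complete_dead m else false) (iota 3 7).
Proof. vm_cast_no_check (erefl true). Qed.
(** All guard numbers up to [k] occur, because the ten vertices may lie among eleven; one contracted
    class is allowed for. *)
Lemma ten_ok : all (fun k => kite_free_tasks 10 k 1 (iota 0 k.+1) false (if Nat.eqb k 3 then [:: crit10] else [::])) (iota 2 8).
Proof. vm_cast_no_check (erefl true). Qed.
Lemma eleven_ok : all (fun k => kite_free_tasks 11 k 0 [:: k] (Nat.eqb k 4) (if Nat.eqb k 3 then crits11 else [::])) (iota 2 9).
Proof. vm_cast_no_check (erefl true). Qed.

Definition kite_free_on (I : finType) (F : rel I) (X : {set I}) k := forall A D (B : {set I}),
  A \in X -> D \in X -> B \subset X -> A != D -> #|B|.+1 = k ->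
  (forall x y, x \in B -> y \in B -> x != y -> F x y) ->
  (forall x, x \in B -> F x A) -> (forall x, x \in B -> F x D) -> False.

Lemma critical_lt m' k (F1 : rel 'I_m'.+1) : critical k F1 -> k < m'.+1.
Proof.
move=> cr; rewrite ltnNge; apply/negP=> km; apply: (crit_noncol cr); exists (fun i : 'I_m'.+1 => i : nat).
split=> [i _|i j _ _]; first exact: leq_trans (ltn_ord i) km.
by apply: contraTneq => /val_inj ->; rewrite (crit_irr cr).
Qed.

Lemma dead_push m' k r js (F1 : rel 'I_m'.+1) (I : finType) (F : rel I) (f : 'I_m'.+1 -> I) (M : {set I}) j W :
  m' < 12 -> dead_end m'.+1 k r js (push F1) -> symmetric F -> injective f -> subrel F1 (relpre f F) ->
  j \in js -> #|M| <= r -> eternal F M (f @: setT) j (j == k) W -> False.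
Proof.
move=> m12 d sF fI sub jj cM et; pose g (v : vtx) := f (inv m' v).
have gI : {in take m'.+1 vtxs &, injective g} by move=> u v uvs vvs /fI; apply: inv_inj.
apply: (d I F g sF gI _ M j W jj).
- by move=> u v /and3P[_ _ /sub].
- apply: leq_trans cM; rewrite -size_filter -(size_map g) cardE; apply: uniq_leq_size.
    rewrite map_inj_in_uniq ?filter_uniq ?take_uniq // => u v; rewrite !mem_filter => /andP[_ h1] /andP[_ h2]; exact: gI.
  by move=> x /mapP[v]; rewrite mem_filter => /andP[h _] ->; rewrite mem_enum.
- have -> // : [set g v | v in take m'.+1 vtxs] = f @: setT.
  apply/setP=> x; apply/imsetP/imsetP => -[v _ ->]; first by exists (inv m' v).
  by exists (vtx_of v); rewrite ?vtx_of_vs // /g vtx_ofK.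
Qed.

Definition labelled (I : finType) (F : rel I) (X : {set I}) (n : nat) (t : state) := exists g : vtx -> I,
  [/\ {in take n vtxs &, injective g}, forall u, u \in take n vtxs -> g u \in X &
    {in take n vtxs &, forall u v, u != v -> N t u v -> F (g u) (g v)}].

Lemma copy_labelled m' (F1 : rel 'I_m'.+1) (I : finType) (F : rel I) (f : 'I_m'.+1 -> I) (X : {set I}) t :
  m' < 12 -> injective f -> (forall i, f i \in X) -> subrel F1 (relpre f F) ->
  copy_of m'.+1 t (push F1) -> labelled F X m'.+1 t.
Proof.
move=> m12 fI fX sub [p [pI pv pN]]; exists (fun v => f (inv m' (p v))); split=> //.
- by move=> u v uvs vvs /fI/inv_inj E; apply: pI => //; apply: E; rewrite ?pv.
- by move=> u v uvs vvs uv /(pN u v uvs vvs uv)/and3P[_ _ /sub].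
Qed.

(** * Critical subgraphs of a surviving game *)

Section Analyse.
Variables (I : finType) (F : rel I) (M X : {set I}) (k : nat) (W : {set {set I}}).
Hypotheses (symF : symmetric F) (irrF : irreflexive F) (k2 : 1 < k).
Hypothesis etW : eternal F M X k true W.
Hypothesis ncol : ~ colorable F X k.
Hypothesis X11 : #|X| <= 11.

Lemma analyse : #|M| <= 2 -> exists m' (f : 'I_m'.+1 -> I) (F1 : rel 'I_m'.+1),
  [/\ injective f, forall i, f i \in X, subrel F1 (relpre f F), critical k F1 & 8 < m' < #|X|].
Proof.
move=> cM; have [m [f [F1 [fI fX sub cr]]]] := exists_critical symF irrF ncol.
case: m f F1 fI fX sub cr => [|m'] f F1 fI fX sub cr.
  by case: (crit_noncol cr); exists (fun=> 0); split=> [[]|[]].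
exists m', f, F1; split=> //.
have cX : m' < #|X|.
  by rewrite -[m'.+1]card_ord -(card_imset _ fI); apply: subset_leq_card; apply/subsetP=> _ /imsetP[i _ ->].
rewrite cX andbT ltnNge; apply/negP=> m8.
have YX : f @: setT \subset X by apply/subsetP=> _ /imsetP[i _ ->].
have [j [W' [jk et]]] := eternal_restrict YX etW.
have km := critical_lt cr.
have m3 : 2 < m'.+1 := leq_ltn_trans k2 km.
have m9 : m'.+1 \in iota 3 7 by rewrite mem_iota m3 /= !ltnS.
have := allP free_ok _ m9; case: ifP => // /allP fk cd.
have m12 : m' < 12 by apply: leq_ltn_trans m8 _.
have d : dead_end m'.+1 k 2 (iota 0 k.+1) (push F1).
  have k50 : k < 50 by apply: leq_trans km (leq_trans m12 _).
  apply: (free_dead m12 k2 k50 cr _ cd).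
  by apply: fk; rewrite mem_iota k2 subnKC // ltnW.
apply: (dead_push m12 d symF fI sub _ cM et).
by rewrite mem_iota add0n ltnS.
Qed.

Lemma sub_kite m (f : 'I_m -> I) F1 : injective f -> (forall i, f i \in X) -> subrel F1 (relpre f F) ->
  kite_free_on F X k -> kite_free k F1.
Proof.
move=> fI fX sub kf A D B AD cB cl BA BD; apply: (kf (f A) (f D) (f @: B)) => //.
- by apply/subsetP=> _ /imsetP[i _ ->].
- by rewrite (inj_eq fI).
- by rewrite card_imset.
- by move=> _ _ /imsetP[x xB ->] /imsetP[y yB ->]; rewrite (inj_eq fI) => xy; apply/sub/cl.
- by move=> _ /imsetP[x xB ->]; apply/sub/BA.
- by move=> _ /imsetP[x xB ->]; apply/sub/BD.
Qed.

Lemma order_ten (f : 'I_10 -> I) (F1 : rel 'I_10) : injective f -> (forall i, f i \in X) -> subrel F1 (relpre f F) ->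
  critical k F1 -> kite_free_on F X k -> #|M| <= 1 -> k = 3 /\ labelled F X 10 crit10.
Proof.
move=> fI fX sub cr kf cM.
have YX : f @: setT \subset X by apply/subsetP=> _ /imsetP[i _ ->].
have [j [W' [jk et]]] := eternal_restrict YX etW.
have km := critical_lt cr.
have kin : k \in iota 2 8 by rewrite mem_iota k2.
have := allP ten_ok k kin => ok.
have ts : forall i, symmetric (N (nth no_edges (if Nat.eqb k 3 then [:: crit10] else [::]) i)).
  by apply: sym_states; case: ifP => // _; vm_compute.
have k50 : k < 50 by apply: ltn_trans km _.
case: (kite_free_outcome _ k2 k50 cr ts _ (sub_kite fI fX sub kf) ok) => // [d|[//]|[i]].
  by case: (dead_push _ d symF fI sub _ cM et) => //; rewrite mem_iota add0n ltnS.
case: ifP => [|_]; last by [].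
rewrite eqbE => /eqP->; case: i => // _ cp; split=> //; exact: (copy_labelled (m' := 9) isT fI fX sub cp).
Qed.

Lemma order_eleven (f : 'I_11 -> I) (F1 : rel 'I_11) : injective f -> (forall i, f i \in X) -> subrel F1 (relpre f F) ->
  critical k F1 -> kite_free_on F X k -> #|M| <= 0 ->
  (exists2 u, u \in X & forall v, v \in X -> v != u -> F u v) \/
  k = 3 /\ exists2 i, i < size crits11 & labelled F X 11 (nth no_edges crits11 i).
Proof.
move=> fI fX sub cr kf cM.
(* The critical graph spans [X], so the unrestricted game is available, with its domination
   clause. *)
have XE : f @: setT = X.
  apply/eqP; rewrite eqEcard card_imset // cardsT card_ord X11 andbT.
  by apply/subsetP=> _ /imsetP[i _ ->].
have km := critical_lt cr.
have kin : k \in iota 2 9 by rewrite mem_iota k2.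
have := allP eleven_ok k kin => ok.
have ts : forall i, symmetric (N (nth no_edges (if Nat.eqb k 3 then crits11 else [::]) i)).
  by apply: sym_states; case: ifP => // _; vm_compute.
have k50 : k < 50 by apply: ltn_trans km _.
case: (kite_free_outcome _ k2 k50 cr ts _ (sub_kite fI fX sub kf) ok) => // [d|[_ [u uvs h]]|[i]].
- case: (@dead_push _ _ _ _ _ _ F f M k W _ d symF fI sub _ cM) => //; first by rewrite inE.
  by rewrite XE eqxx.
- left; exists (f (inv 10 u)) => // v; rewrite -XE => /imsetP[x _ ->]; rewrite (inj_eq fI) => xu.
  have xv : vtx_of x \in take 11 vtxs by apply: vtx_of_vs.
  have := h (vtx_of x) xv; rewrite /push => H; apply: sub; move: H; rewrite vtx_ofK //.
  by case/(_ _)/and3P=> //; apply: contraNneq xu => <-; rewrite vtx_ofK.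
- case: ifP => [|_]; last by [].
  by rewrite eqbE => /eqP-> il cp; right; split=> //; exists i => //; exact: (copy_labelled (m' := 10) isT fI fX sub cp).
Qed.
End Analyse.

(** Keeps one controlled unfolding before [split_case] is made opaque, so that later conversions do
    not evaluate the splits. *)
Lemma split_caseE v y1 y2 : split_case v y1 y2 =
  let s := foldr (fun w s => cut v w s) crit10 (vlist (nbh v crit10)) in
  let s := set_edge y1 y2 (set_edge v y1 (set_edge v y2 (set_edge x10 y1 (set_edge x10 y2 s)))) in
  match [seq w <- vlist (nbh v crit10) | if vtxb w y1 then false else ~~ vtxb w y2] with
  | [::] => splits pats11 (take 11 vtxs) v x10 s [::]
  | w :: ws => splits pats11 (take 11 vtxs) v x10 (set_edge v w s) ws
  end.
Proof. by []. Qed.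
Arguments split_case : simpl never.
Opaque split_case.

Lemma pats10_ok : pats10 = map co_graph L10. Proof. by vm_compute. Qed.
Lemma pats11_ok : pats11 = map co_graph L11. Proof. by vm_compute. Qed.
Lemma listed10 : all (listed_ok 10) L10. Proof. by vm_compute. Qed.
Lemma listed11 : all (listed_ok 11) L11. Proof. by vm_compute. Qed.
Lemma pats10_sym i : symmetric (N (nth no_edges pats10 i)). Proof. by apply: sym_states; vm_compute. Qed.
Lemma pats11_sym i : symmetric (N (nth no_edges pats11 i)). Proof. by apply: sym_states; vm_compute. Qed.
Lemma crit10_sym : symmetric (N crit10). Proof. by apply: (sym_states (l := [:: crit10]) _ 0); vm_compute. Qed.
Lemma crits11_sym i : symmetric (N (nth no_edges crits11 i)). Proof. by apply: sym_states; vm_compute. Qed.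
Lemma crits11_irr i : irreflexive (N (nth no_edges crits11 i)).
Proof.
have al : all (fun s => all (fun u => ~~ N s u u) vtxs) crits11 by vm_compute.
move=> u; case: (ltnP i (size crits11)) => il.
  by apply/negbTE; have := all_nthP no_edges al i il => /allP/(_ u (mem_vtxs u)).
by rewrite nth_default //; case: u.
Qed.
Lemma sup10 : sup pats10 (take 10 vtxs) 30 crit10 (all_pairs (take 10 vtxs)). Proof. vm_cast_no_check (erefl true). Qed.
Lemma sup11 : sup pats11 (take 11 vtxs) 30 crit10 (all_pairs (take 11 vtxs)). Proof. vm_cast_no_check (erefl true). Qed.
Lemma sups11 : all (fun s => sup pats11 (take 11 vtxs) 30 s (all_pairs (take 11 vtxs))) crits11. Proof. vm_cast_no_check (erefl true). Qed.
Lemma splits11 : all_splits. Proof. vm_cast_no_check (erefl true). Qed.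
Lemma crit10_ten : all (fun u => all (fun v => if N crit10 u v then [&& u \in take 10 vtxs, v \in take 10 vtxs & u != v] else true) vtxs) vtxs.
Proof. by vm_compute. Qed.
Lemma crit10_supp u v : N crit10 u v -> [&& u \in take 10 vtxs, v \in take 10 vtxs & u != v].
Proof. by move=> h; have := allP (allP crit10_ten u (mem_vtxs u)) v (mem_vtxs v); rewrite h. Qed.

Lemma nth_in i (l : seq string) : i < size l -> List.In (nth ""%string l i) l.
Proof. by elim: l i => //= x l IH [|i] /=; [left | move=> /IH; right]. Qed.

Lemma all_in (P : pred string) l s : all P l -> List.In s l -> P s.
Proof. by elim: l => //= x l IH /andP[Px /IH al] [<-|/al]. Qed.

(** * From surviving games to the listed graphs *)

Section Forward.
Variable G : sgraph.
Variable n : nat.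
Hypothesis cG : #|G| = n.
Hypothesis n12 : n <= 12.
Hypothesis n1 : 1 < n.
Hypothesis conG : connected_graph G.

Lemma no_universal (u : G) : (forall v, v != u -> nonadj u v) -> False.
Proof.
move=> H; have [v vu] : exists v : G, v != u.
  have : 1 < #|[set: G]| by rewrite cardsT cG.
  case/card_gt1P=> x [y [_ _ xy]]; case: (eqVneq x u) => [E|]; last by exists x.
  by exists y; rewrite -E eq_sym.
have /connectP[p pp lp] := conG u v.
case: p pp lp => [|x p] /=; first by move=> _ E; rewrite E eqxx in vu.
case/andP=> ux _ _; have xu : x != u by apply: contraTneq ux => ->; rewrite adj_irr.
by have := H x xu; rewrite /nonadj ux andbF.
Qed.

Lemma image_all (g : vtx -> G) : {in take n vtxs &, injective g} -> [set g v | v in take n vtxs] = setT.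
Proof.
move=> gI; have cT : #|take n vtxs| = n by rewrite (card_uniqP _) ?take_uniq // size_take_min; apply/minn_idPl.
by apply/eqP; rewrite eqEcard subsetT cardsT cG card_in_imset // cT leqnn.
Qed.

Lemma settled_iso (l : seq string) (pats : seq state) (g : vtx -> G) : pats = map co_graph l -> all (listed_ok n) l ->
  {in take n vtxs &, injective g} -> settled pats (take n vtxs) (@nonadj G) g ->
  exists2 s, List.In s l & isomorphic G (graph6 s).
Proof.
move=> pE lok gI.
have surj x : exists2 v, v \in take n vtxs & g v = x.
  have E := image_all gI.
  by have : x \in [set g v | v in take n vtxs] by [rewrite E inE]; case/imsetP=> v vvs ->; exists v.
case=> [[i]|[u uvs H]]; last first.
  case: (@no_universal (g u)) => x xu; have [v vvs vx] := surj x; rewrite -vx; apply: H => //.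
  by apply: contraNneq xu => <-; rewrite vx.
rewrite pE size_map => il [p [pI pv pN]]; exists (nth ""%string l i); first exact: nth_in.
have lo : listed_ok n (nth ""%string l i) := all_in lok (nth_in il).
apply: (listed_iso (g := g \o p) n12 lo cG) => [u v uvs vvs /gI E|u v uvs vvs uv].
  by apply: pI => //; apply: E; apply: pv.
by rewrite -(pN u v uvs vvs uv) (nth_map ""%string).
Qed.

(** A single guard standing on [a] cannot answer an attack on a vertex not adjacent to [a]. Such a
    pair exists: otherwise one colour would suffice, or there would be no guard at all to answer an
    attack. *)
Lemma small_k k W : eternal (@nonadj G) set0 setT k true W -> ~ colorable (@nonadj G) setT k -> 1 < k.
Proof.
move=> et nc; rewrite ltnNge; apply/negP=> k1.
have [a [b Fab]] : exists a b : G, nonadj a b.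
  case: (boolP [exists a, exists b, @nonadj G a b]) => [/existsP[a /existsP[b h]]|no]; first by exists a, b.
  case: k et nc k1 => [|[|//]] et nc _.
    have [R RW] := et_nonempty et; have [_ R0] := et_state et RW.
    have [x _] : exists x : G, x \in setT by apply/set0Pn; rewrite -card_gt0 cardsT cG ltnW.
    have xR : x \notin R by move/eqP: R0; rewrite cards_eq0 => /eqP->; rewrite inE.
    have [y yR _] := et_some et RW (in_setT x) xR; move/eqP: R0; rewrite cards_eq0 => /eqP E.
    by rewrite E inE in yR.
  case: nc; exists (fun=> 0); split=> // x y _ _ h; case/negP: no; apply/existsP; exists x; apply/existsP; by exists y.
have ab : a != b by case/andP: (Fab).
have [R RW aR] : exists2 R, R \in W & a \in R.
  have [R RW] := et_nonempty et; case aR: (a \in R); first by exists R.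
  have [x _ mW] := et_some et RW (in_setT a) (negbT aR).
  by exists (move R x a) => //; rewrite in_move eqxx.
have [_ cR] := et_state et RW.
have RE x : x \in R -> x = a by move=> xR; have := k1; rewrite -cR => /card_le1_eqP; apply.
have bR : b \notin R by apply: contraNN ab => /RE ->.
have [|x [xR nF _]] := et_single et RW (in_setT b) bR; first by rewrite inE.
by rewrite (RE x xR) Fab in nF.
Qed.

End Forward.

Lemma eternal_all (G : sgraph) n (g : vtx -> G) W : #|G| = n -> n <= 12 -> {in take n vtxs &, injective g} ->
  eternal (@nonadj G) set0 setT 3 true W -> eternal (@nonadj G) set0 [set g v | v in take n vtxs] 3 true W.
Proof. by move=> cG n12 gI; rewrite (image_all cG n12 gI). Qed.

Lemma N_cuts v ws s x y : v \notin ws -> N (foldr (fun w s => cut v w s) s ws) x y ->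
  [/\ N s x y, x = v -> y \notin ws & y = v -> x \notin ws].
Proof.
elim: ws => [|w ws IH] /=; first by [].
rewrite inE negb_or => /andP[vw vws]; rewrite N_cut // => /and3P[/(IH vws)[h1 h2 h3] n1 n2]; split=> // E.
  by rewrite inE negb_or h2 // andbT; apply: contra n1 => /eqP->; rewrite E !eqxx.
by rewrite inE negb_or h3 // andbT; apply: contra n2 => /eqP->; rewrite E !eqxx.
Qed.

Lemma in_eleven x : x \in take 11 vtxs -> x != x10 -> x \in take 10 vtxs.
Proof. by case: x. Qed.

Lemma extend_inj (T : eqType) (phi : vtx -> T) d : {in take 10 vtxs &, injective phi} ->
  (forall u, u \in take 10 vtxs -> phi u != d) ->
  {in take 11 vtxs &, injective (fun x => if x == x10 then d else phi x)}.
Proof.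
move=> pI pd u v uvs vvs; case: (eqVneq u x10) => [->|u10]; case: (eqVneq v x10) => [->|v10] // E.
- by have := pd v (in_eleven vvs v10); rewrite E eqxx.
- by have := pd u (in_eleven uvs u10); rewrite E eqxx.
- by apply: pI => //; apply: in_eleven.
Qed.

Lemma all_splitsP v p : v \in take 10 vtxs -> p \in all_pairs (take 10 vtxs) -> p.1 != v -> p.2 != v ->
  split_case v p.1 p.2.
Proof.
move=> vvs pp n1 n2; have /allP/(_ p pp) := allP splits11 v vvs.
by cbv beta; rewrite !vtxbE (negbTE n1) (negbTE n2).
Qed.

(* The surviving game on ten vertices comes from eleven vertices by contracting the ends
   [A], [D] of a kite: the neighbours of the contracted vertex split between [A] and [D]. *)
Lemma split_settled (G : sgraph) (W : {set {set G}}) (A D : G) (B : {set G}) :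
  #|G| = 11 -> eternal (@nonadj G) set0 setT 3 true W -> A != D -> #|B|.+1 = 3 ->
  (forall x y, x \in B -> y \in B -> x != y -> nonadj x y) ->
  (forall x, x \in B -> nonadj x A) -> (forall x, x \in B -> nonadj x D) ->
  labelled (merge (@nonadj G) A D) (setT :\ D) 10 crit10 ->
  exists2 g : vtx -> G, {in take 11 vtxs &, injective g} & settled pats11 (take 11 vtxs) (@nonadj G) g.
Proof.
move=> cG et AD [cB2] cl BA BD [phi [pI pX pN]].
have /cards2P[b1 [b2 [b12 BE]]] : #|B| == 2 by rewrite cB2.
have sF := @nonadj_sym G; have iF := @nonadj_irr G.
have pD u : u \in take 10 vtxs -> phi u != D by move=> /pX; rewrite !inE andbT.
have surj x : x != D -> exists2 v, v \in take 10 vtxs & phi v = x.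
  move=> xD; have E : [set phi v | v in take 10 vtxs] = setT :\ D.
    apply/eqP; rewrite eqEcard; apply/andP; split; first by apply/subsetP=> _ /imsetP[u /pX h ->].
    rewrite card_in_imset // (card_uniqP _) //= -(leq_add2l (D \in [set: G])) -cardsD1 cardsT cG.
    by rewrite inE.
  by have : x \in setT :\ D by [rewrite !inE xD]; rewrite -E => /imsetP[v vvs ->]; exists v.
have b1B : b1 \in B by rewrite BE !inE eqxx.
have b2B : b2 \in B by rewrite BE !inE eqxx orbT.
have ne (x y : G) : nonadj x y -> x != y by case/andP.
have [v vvs vA] := surj A AD.
have [z1 [z2 [zz Bz1 Bz2 zz12]]] : exists z1 z2, [/\ (z1, z2) \in all_pairs (take 10 vtxs), phi z1 \in B, phi z2 \in B & phi z1 != phi z2].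
  have [y1 y1vs y1E] := surj b1 (ne _ _ (BD _ b1B)); have [y2 y2vs y2E] := surj b2 (ne _ _ (BD _ b2B)).
  have y12 : y1 != y2 by apply: contraNneq b12 => E; rewrite -y1E -y2E E.
  by case: (mem_all_pairs y1vs y2vs y12) => h; [exists y1, y2 | exists y2, y1]; rewrite y1E y2E; split; rewrite // eq_sym.
have [/= z1vs z2vs z12] := all_pairs_sub (take_uniq 10 uniq_vtxs) zz.
have zv z : phi z \in B -> z != v by move=> /BA/ne; apply: contraNneq => ->; rewrite vA.
have z1v := zv _ Bz1; have z2v := zv _ Bz2.
have sc : split_case v z1 z2.
  exact: (all_splitsP vvs zz z1v z2v).
have ten x : x \in take 10 vtxs -> x != x10 by case: x.
have t11 x : x \in take 10 vtxs -> x \in take 11 vtxs by case: x.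
(* The split analysis is symmetric in the two tips, so [v] may stand for either of them and [x10]
   for the other; which one is decided at the end. *)
pose lab (a d : G) x := if x == x10 then d else if x == v then a else phi x.
have labI a d : (a = A /\ d = D) \/ (a = D /\ d = A) -> {in take 11 vtxs &, injective (lab a d)}.
  have pv x : x \in take 10 vtxs -> x != v -> phi x != A.
    by move=> xvs; apply: contraNneq => E; apply/eqP; apply: pI; rewrite // vA.
  move=> ad; apply: extend_inj => [x y xvs yvs|x xvs].
    case: (eqVneq x v) => [->|xv]; case: (eqVneq y v) => [->|yv] //; last exact: pI.
      by move=> E; case: ad => -[aE _]; [have := pv y yvs yv | have := pD y yvs]; rewrite -E aE eqxx.
    by move=> E; case: ad => -[aE _]; [have := pv x xvs xv | have := pD x xvs]; rewrite E aE eqxx.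
  case: ad => -[-> ->]; case: ifP => [_|/negbT xv] //; [exact: pD | by rewrite eq_sym | exact: pv].
have vten := ten v vvs.
have labv a d : lab a d v = a by rewrite /lab (negbTE vten) eqxx.
have labx a d x : x \in take 10 vtxs -> x != v -> lab a d x = phi x.
  by move=> xvs xv; rewrite /lab (negbTE (ten x xvs)) (negbTE xv).
have labd a d : lab a d x10 = d by rewrite /lab eqxx.
pose ws0 := vlist (nbh v crit10).
have ws0P w : w \in ws0 -> [/\ w \in take 10 vtxs, w != v & nonadj A (phi w) || nonadj D (phi w)].
  rewrite mem_vlist => Nvw; have /and3P[_ wvs vw] := crit10_supp Nvw.
  split; rewrite // 1?eq_sym //; have := pN v w vvs wvs vw Nvw; rewrite vA /merge eqxx /=.
  have wA : phi w == A = false by apply: contraNF vw => /eqP E; apply/eqP; apply: pI; rewrite // vA.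
  by rewrite wA orbF.
(* The edges of [crit10] at the contracted vertex are removed, as each may come from either tip;
   those to the base belong to both and are restored in [s2]. *)
pose s1 := foldr (fun w s => cut v w s) crit10 ws0.
have v_ws0 : v \notin ws0 by rewrite mem_vlist; apply/negP=> /crit10_supp/and3P[_ _]; rewrite eqxx.
pose s2 := set_edge z1 z2 (set_edge v z1 (set_edge v z2 (set_edge x10 z1 (set_edge x10 z2 s1)))).
have vz1 : v != z1 by rewrite eq_sym.
have vz2 : v != z2 by rewrite eq_sym.
have xz1 : x10 != z1 by rewrite eq_sym ten.
have xz2 : x10 != z2 by rewrite eq_sym ten.
have sym1 : symmetric (N s1).
  rewrite /s1; elim: (ws0) v_ws0 => [|w ws IH] /=; first by move=> _; apply: crit10_sym.
  by rewrite inE negb_or => /andP[vw /IH]; apply: N_cut_sym.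
have sym2 : symmetric (N s2) by rewrite /s2; do 5 (apply: N_set_sym; first by []).
have below2 a d : (a = A /\ d = D) \/ (a = D /\ d = A) -> below (take 11 vtxs) (@nonadj G) (lab a d) s2.
  move=> ad; have Ba z : phi z \in B -> nonadj a (phi z) /\ nonadj d (phi z).
    by move=> h; rewrite ![nonadj _ (phi z)]sF; case: ad => -[-> ->]; rewrite BA ?BD.
  have [az1 dz1] := Ba _ Bz1; have [az2 dz2] := Ba _ Bz2.
  have z1t := t11 _ z1vs; have z2t := t11 _ z2vs; have vt := t11 _ vvs; have dt : x10 \in take 11 vtxs by [].
  rewrite /s2; do 5 (apply: below_set; [by [] | by [] | by [] | by []
    | by rewrite ?labv ?labd ?(labx _ _ _ z1vs z1v) ?(labx _ _ _ z2vs z2v) //; apply: cl | ]).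
  move=> x y xvs yvs /(N_cuts v_ws0)[Nxy hx hy]; have /and3P[xt yt xy] := crit10_supp Nxy.
  have xv : x != v by apply/eqP=> E; have := hx E; rewrite mem_vlist -E [vin y _]Nxy.
  have yv : y != v by apply/eqP=> E; have := hy E; rewrite mem_vlist -E -/(N crit10 y x) crit10_sym Nxy.
  rewrite !labx //; have := pN x y xt yt xy Nxy; rewrite /merge.
  have nA z : z \in take 10 vtxs -> z != v -> phi z == A = false.
    by move=> zt zn; apply: contraNF zn => /eqP E; apply/eqP; apply: pI; rewrite // vA.
  by rewrite !nA // !orbF.
have sz g : {in take 11 vtxs &, injective g} -> eternal (@nonadj G) set0 [set g u | u in take 11 vtxs] 3 true W.
  by move=> gI; apply: eternal_all.
have v11 := t11 v vvs; have d11 : x10 \in take 11 vtxs by [].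
move: sc; rewrite split_caseE -/ws0 -/s1 -/s2.
have wsP a d w : (a = A /\ d = D) \/ (a = D /\ d = A) -> w \in ws0 ->
    [&& w \in take 11 vtxs, w != v, w != x10 & nonadj (lab a d v) (lab a d w) || nonadj (lab a d x10) (lab a d w)].
  move=> ad /ws0P[wt wv AD_]; rewrite t11 // wv ten // labv labd labx //.
  by case: ad => -[-> ->] //; rewrite orbC.
case E: [seq w <- ws0 | _] => [|w ws] sp.
  exists (lab A D); first by apply: labI; left.
  apply: (splitsP pats11_sym (take_uniq _ uniq_vtxs) (labI _ _ _) sF iF (sz _ (labI _ _ _)) v11 d11 sym2 (below2 _ _ _) _ sp) => //; by left.
have wsub x : x \in w :: ws -> x \in ws0 by rewrite -E mem_filter => /andP[].
have w0 : w \in ws0 by apply: wsub; rewrite inE eqxx.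
have [wt wv ADw] := ws0P w w0; have vw : v != w by rewrite eq_sym.
(* The tip joined to the first undistributed neighbour is named [v], matching the choice made in
   [split_case]. *)
have [a [d [ad aw]]] : exists a d, ((a = A /\ d = D) \/ (a = D /\ d = A)) /\ nonadj a (phi w).
  by case/orP: ADw => h; [exists A, D | exists D, A]; split=> //; [left | right].
exists (lab a d); first exact: labI.
apply: (splitsP pats11_sym (take_uniq _ uniq_vtxs) (labI _ _ ad) sF iF (sz _ (labI _ _ ad)) v11 d11 (N_set_sym vw sym2) _ _ sp).
  by apply: below_set => //; rewrite ?t11 ?labv ?labx //; apply: below2.
by move=> x xws; apply: wsP => //; apply: wsub; rewrite inE xws orbT.
Qed.

Lemma merged (I : finType) (F : rel I) (M X : {set I}) k W A D (B : {set I}) : symmetric F -> irreflexive F ->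
  eternal F M X k true W -> #|M| <= 1 -> ~ colorable F X k -> A \in X -> D \in X -> B \subset X -> A != D ->
  #|B|.+1 = k -> (forall x y, x \in B -> y \in B -> x != y -> F x y) ->
  (forall x, x \in B -> F x A) -> (forall x, x \in B -> F x D) ->
  [/\ symmetric (merge F A D), irreflexive (merge F A D),
      eternal (merge F A D) (A |: M) (X :\ D) k true [set R in W | D \notin R],
      ~ colorable (merge F A D) (X :\ D) k & #|X :\ D|.+1 = #|X|].
Proof.
move=> sF iF et cM nc AX DX BX AD cB cl BA BD; split.
- exact: merge_sym.
- exact: (merge_irr sF iF et cM AX DX BX AD cB cl BA BD).
- exact: (merge_eternal sF iF et cM AX DX BX AD cB cl BA BD).
- by move=> /(merge_colorable iF AX AD).
- by rewrite (cardsD1 D X) DX.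
Qed.

(** A kite in the complement would contract to nine vertices, too few for the critical graph on at
    least ten vertices that [analyse] provides. So the complement is kite-free and contains [crit10]
    as a spanning subgraph. *)
Theorem forward10 (G : sgraph) : #|G| = 10 -> connected_graph G ->
  eternal_domination_number G < clique_covering_number G -> exists2 s, List.In s L10 & isomorphic G (graph6 s).
Proof.
move=> cG con; rewrite /eternal_domination_number; case: ex_minnP => k /boolp.asboolP/guards_eternal[W et] _ lt.
have nc : ~ colorable (@nonadj G) setT k by move/cover_colorable; rewrite leqNgt lt.
have k2 := small_k cG isT et nc.
have sF := @nonadj_sym G; have iF := @nonadj_irr G.
have cX : #|[set: G]| <= 11 by rewrite cardsT cG.
case: (boolp.pselect (kite_free_on (@nonadj G) setT k)) => [kf|nkf].
  have [|m' [f [F1 [fI fX sub cr /andP[m8 mX]]]]] := analyse sF iF k2 et nc; first by rewrite cards0.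
  have E : m' = 9 by apply/eqP; rewrite eqn_leq m8 andbT -ltnS; rewrite cardsT cG in mX.
  move: f F1 fI fX sub cr; rewrite E => f F1 fI fX sub cr.
  have [|k3 [g [gI _ gN]]] := order_ten sF k2 et fI fX sub cr kf; first by rewrite cards0.
  rewrite k3 in et; apply: (settled_iso cG isT isT con pats10_ok listed10 gI).
  apply: (sup_all pats10_sym (take_uniq _ uniq_vtxs) gI sF iF (eternal_all cG isT gI et) crit10_sym _ sup10).
  by move=> u v uvs vvs Nuv; apply: gN => //; case/and3P: (crit10_supp Nuv).
case: nkf => A D B AX DX BX AD cB cl BA BD.
have c0 : #|@set0 G| <= 1 by rewrite cards0.
have [sF' iF' et' nc' cX'] := merged sF iF et c0 nc AX DX BX AD cB cl BA BD.
have [|m' [f [F1 [_ _ _ _ /andP[m8 mX]]]]] := analyse sF' iF' k2 et' nc'.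
  by rewrite setU0 cards1.
by have := leq_ltn_trans m8 mX; rewrite -ltnS cX' cardsT cG.
Qed.

(** Without a kite the critical subgraph has ten or eleven vertices. After one contraction that
    leaves no kite it must be [crit10] on all ten classes, and the contraction is undone by
    [split_settled]. A second contraction would leave nine vertices, which [analyse] excludes. *)
Theorem forward11 (G : sgraph) : #|G| = 11 -> connected_graph G ->
  eternal_domination_number G < clique_covering_number G -> exists2 s, List.In s L11 & isomorphic G (graph6 s).
Proof.
move=> cG con; rewrite /eternal_domination_number; case: ex_minnP => k /boolp.asboolP/guards_eternal[W et] _ lt.
have nc : ~ colorable (@nonadj G) setT k by move/cover_colorable; rewrite leqNgt lt.
have k2 := small_k cG isT et nc.
have sF := @nonadj_sym G; have iF := @nonadj_irr G.
have cX : #|[set: G]| <= 11 by rewrite cardsT cG.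
have iso := settled_iso cG isT isT con pats11_ok listed11.
have c0 : #|@set0 G| <= 0 by rewrite cards0.
have u11 := take_uniq 11 uniq_vtxs.
case: (boolp.pselect (kite_free_on (@nonadj G) setT k)) => [kf|nkf].
  have [|m' [f [F1 [fI fX sub cr /andP[m8 mX]]]]] := analyse sF iF k2 et nc; first by rewrite cards0.
  have [E|E] : m' = 9 \/ m' = 10 by move: m8 mX; rewrite cardsT cG; case: (m') => [|[|[|[|[|[|[|[|[|[|[|n]]]]]]]]]]] // _ _; [left | right].
    move: f F1 fI fX sub cr; rewrite E => f F1 fI fX sub cr.
    have [|k3 [g [gI _ gN]]] := order_ten sF k2 et fI fX sub cr kf; first by rewrite cards0.
    rewrite k3 in et.
    (* The vertex missed by the copy of [crit10] receives the label [x10]; [sup11] allows it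
       arbitrary edges. *)
    have [d dN] : exists d, d \notin [set g u | u in take 10 vtxs].
      apply/existsP; rewrite -negb_forall; apply/negP=> /forallP al.
      have sub' : [set: G] \subset [set g u | u in take 10 vtxs] by apply/subsetP=> x _; apply: al.
      by have := subset_leq_card sub'; rewrite cardsT cG card_in_imset // (card_uniqP _) ?take_uniq.
    have gd u : u \in take 10 vtxs -> g u != d by move=> ut; apply: contraNneq dN => <-; apply: imset_f.
    have gI' := extend_inj gI gd; apply: (iso _ gI').
    apply: (sup_all pats11_sym u11 gI' sF iF (eternal_all cG isT gI' et) crit10_sym _ sup11).
    move=> u v uvs vvs Nuv; have /and3P[ut vt uv] := crit10_supp Nuv.
    have ten x : x \in take 10 vtxs -> (x == x10) = false by case: x.
    by rewrite !ten //; apply: gN.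
  move: f F1 fI fX sub cr; rewrite E => f F1 fI fX sub cr.
  case: (order_eleven sF k2 et cX fI fX sub cr kf c0) => [[u _ h]|[k3 [i il [g [gI _ gN]]]]].
    by case: (no_universal cG isT con (u := u)) => v; apply: h.
  rewrite k3 in et; apply: (iso _ gI).
  have := all_nthP no_edges sups11 i il; apply: (sup_all pats11_sym u11 gI sF iF (eternal_all cG isT gI et) (crits11_sym i)).
  move=> u v uvs vvs Nuv; apply: gN => //; apply/eqP=> uv.
  have := crits11_irr i; rewrite uv in Nuv; by move=> /(_ v); rewrite Nuv.
apply: boolp.contrapT => no; apply: nkf => A D B AX DX BX AD cB cl BA BD.
have c0' := leq_trans c0 (leq0n 1).
have [sF' iF' et' nc' cX'] := merged sF iF et c0' nc AX DX BX AD cB cl BA BD.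
have cA : #|A |: set0| <= 1 by rewrite setU0 cards1.
have c10 : #|setT :\ D| = 10 by apply/eqP; rewrite -eqSS cX' cardsT cG.
case: (boolp.pselect (kite_free_on (merge (@nonadj G) A D) (setT :\ D) k)) => [kf|nkf].
  have [|m' [f [F1 [fI fX sub cr /andP[m8 mX]]]]] := analyse sF' iF' k2 et' nc'; first exact: leq_trans cA _.
  have E : m' = 9 by apply/eqP; rewrite eqn_leq m8 andbT -ltnS -c10.
  move: f F1 fI fX sub cr; rewrite E => f F1 fI fX sub cr.
  have [k3 la] := order_ten sF' k2 et' fI fX sub cr kf cA; rewrite k3 in et cB.
  have [g gI st] := split_settled cG et AD cB cl BA BD la.
  by apply: no; apply: (iso _ gI).
apply: nkf => A2 D2 B2 AX2 DX2 BX2 AD2 cB2 cl2 BA2 BD2.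
have [sF2 iF2 et2 nc2 cX2] := merged sF' iF' et' cA nc' AX2 DX2 BX2 AD2 cB2 cl2 BA2 BD2.
have [|m' [f [F1 [_ _ _ _ /andP[m8 mX]]]]] := analyse sF2 iF2 k2 et2 nc2.
  by rewrite cardsU1 (leq_add (n1 := 1)) // leq_b1.
by have := leq_ltn_trans m8 mX; rewrite -ltnS cX2 c10.
Qed.

Theorem mainTheorem3 :
  (forall G : sgraph, #|G| = 10 -> connected_graph G ->
    (eternal_domination_number G < clique_covering_number G <->
     exists2 s : string, List.In s L10 & isomorphic G (graph6 s)))
  /\
  (forall G : sgraph, #|G| = 11 -> connected_graph G ->
    (eternal_domination_number G < clique_covering_number G <->
     exists2 s : string, List.In s L11 & isomorphic G (graph6 s))).
Proof.
split=> G cG con; split.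
- exact: forward10.
- by case=> s sL; apply: (listed_bad (n := 10)) => //; apply: all_in listed10 sL.
- exact: forward11.
- by case=> s sL; apply: (listed_bad (n := 11)) => //; apply: all_in listed11 sL.
Qed.
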